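(* Let $\Lambda=\begin{pmatrix} A & N \\ M & B \end{pmatrix}$ be a null-square projective algebra, and let $\mathbb A=A\times B$ and $\mathbb M=M\oplus N$. For $m>0$, there is a five-term exact sequence $$0\to\mathsf{HH}^{2m}(\Lambda)\to\mathsf{HH}^{2m}(\mathbb A)\oplus\mathsf{Hom}_{\mathbb A-\mathbb A}\left(\mathbb M^{\otimes_{\mathbb A}2m},\mathbb A\right)\xrightarrow{\nabla_{2m}}\mathsf{Hom}_{\mathbb A-\mathbb A}\left(\mathbb M^{\otimes_{\mathbb A}2m+1},\mathbb M\right)\to\mathsf{HH}^{2m+1}(\Lambda)\to\mathsf{HH}^{2m+1}(\mathbb A)\to0.$$ For $m=0$ there is the exact sequence $$0\to\mathsf{HH}^0(\Lambda)\to\mathsf{HH}^0(\mathbb A)\xrightarrow{\nabla_0}\mathsf{End}_{\mathbb A-\mathbb A}\mathbb M\to\mathsf{HH}^1(\Lambda)\to\mathsf{HH}^1(\mathbb A)\to0.$$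
   Context: $k$ is a field; algebras are nonzero associative unital $k$-algebras, not necessarily finite dimensional. $\mathsf{HH}^n(\Lambda)=\mathsf{Ext}^n_{\Lambda\otimes_k\Lambda^{op}}(\Lambda,\Lambda)$; $\mathsf{Hom}_{\mathbb A-\mathbb A}$ denotes morphisms of $\mathbb A$-bimodules. **Null-square projective algebras.** Let $A,B$ be algebras, $M$ a nonzero $B$-$A$-bimodule and $N$ a nonzero $A$-$B$-bimodule. The null-square algebra $\Lambda=\begin{pmatrix} A & N \\ M & B \end{pmatrix}$ has matrix multiplication given by the bimodule structures, with all products $mn$ and $nm$ ($m\in M$, $n\in N$) equal to zero. It is called null-square projective if $M$ and $N$ are projective bimodules, equivalently if $\mathbb M=M\oplus N$ is a projective bimodule over $\mathbb A=A\times B$ (actions extended by zero). Thus $\Lambda=\mathbb A\oplus\mathbb M$ with $\mathbb M^2=0$. **The maps $\nabla_{2m}$.** Let $D=k\times k\subset\mathbb A$ and let $\mathsf J^\bullet$ be the complex $\mathsf J^0=\Lambda^D$, $\mathsf J^n=\mathsf{Hom}_{D-D}(\Lambda^{\otimes_Dn},\Lambda)$ with the Hochschild coboundary; its cohomology is $\mathsf{HH}^\bullet(\Lambda)$. Let $\mathsf D^\bullet\subset\mathsf J^\bullet$ be the subcomplex of cochains that vanish on all tensors $x_1\otimes\cdots\otimes x_n$ (each $x_i$ in $\mathbb A$ or $\mathbb M$) having an even number of factors in $\mathbb M$ (in degree $0$, $\mathsf D^0=0$). When $\mathbb M$ is projective, the cohomology of $\mathsf D^\bullet$ in odd degree $n$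 is $\mathsf{Hom}_{\mathbb A-\mathbb A}(\mathbb M^{\otimes_{\mathbb A}n},\mathbb M)$, and that of $(\mathsf J/\mathsf D)^\bullet$ in even degree $n>0$ is $\mathsf{HH}^n(\mathbb A)\oplus\mathsf{Hom}_{\mathbb A-\mathbb A}(\mathbb M^{\otimes_{\mathbb A}n},\mathbb A)$ (and $\mathsf{HH}^0(\mathbb A)$ for $n=0$), where a bimodule map on $\mathbb M^{\otimes_{\mathbb A}n}$ is viewed as the cochain supported on $\mathbb M^{\otimes_Dn}$ through the projection $\mathbb M^{\otimes_Dn}\to\mathbb M^{\otimes_{\mathbb A}n}$, and $\mathsf{HH}^n(\mathbb A)$ is given by cochains supported on $\mathbb A^{\otimes_Dn}$. $\nabla_{2m}$ is the connecting homomorphism of the long exact sequence of $0\to\mathsf D^\bullet\to\mathsf J^\bullet\to(\mathsf J/\mathsf D)^\bullet\to0$ under these identifications. *)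

(* Defs.v *)
From HB Require Import structures.
From mathcomp Require Import all_boot all_order all_algebra.
From mathcomp Require Import boolp functions.

Set Implicit Arguments.
Unset Strict Implicit.
Unset Printing Implicit Defensive.

Import GRing.Theory.
Local Open Scope ring_scope.
Local Open Scope quotient_scope.

#[local] Obligation Tactic := idtac.

Section Subspace.
Variables (k : fieldType) (V : lmodType k).

Record subspace := Subspace {
  subspace_mem :> V -> Prop;
  subspace0 : subspace_mem 0;
  subspaceDZ : forall (a : k) u v,
    subspace_mem u -> subspace_mem v -> subspace_mem (a *: u + v)
}.

Definition in_subspace (S : subspace) : V -> bool := fun v => `[< S v >].

Lemma in_subspace_closed (S : subspace) : subsemimod_closed (in_subspace S).
Proof.
split; first split.
- exact/asboolP/subspace0.
- move=> u v /asboolP Su /asboolP Sv; apply/asboolP.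
  by rewrite -[u]scale1r; exact: subspaceDZ.
- move=> a v /asboolP Sv; apply/asboolP; rewrite -[_ *: _]addr0.
  by apply: subspaceDZ => //; exact: subspace0.
Qed.

HB.instance Definition _ (S : subspace) :=
  GRing.isSubmodClosed.Build k V (in_subspace S) (in_subspace_closed S).

Record sub_of (S : subspace) :=
  SubOf { sub_val : V; sub_valP : in_subspace S sub_val }.

HB.instance Definition _ (S : subspace) := [isSub for @sub_val S].
HB.instance Definition _ (S : subspace) := [Choice of sub_of S by <:].
HB.instance Definition _ (S : subspace) :=
  [SubChoice_isSubLmodule of sub_of S by <:].

Definition zmod_subspace (S : subspace) : zmodClosed V :=
  GRing.ZmodClosed.clone V (in_subspace S) _.

Definition quot_of (S : subspace) : Type := Quotient.quot (zmod_subspace S).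
HB.instance Definition _ (S : subspace) := GRing.Zmodule.on (quot_of S).
HB.instance Definition _ (S : subspace) :
  EqQuotient V (Quotient.equiv (zmod_subspace S)) (quot_of S) :=
  EqQuotient.on (quot_of S).

Section QuotScale.
Variable S : subspace.
Local Notation Q := (quot_of S).

Definition quot_scale (a : k) (x : Q) : Q := \pi_Q (a *: repr x).

Lemma quot_piP (u v : V) : (\pi_Q u = \pi_Q v) <-> S (u - v).
Proof.
split=> [/eqP|Suv].
  by rewrite -[_ == _]/(u == v %[mod Quotient.quot (zmod_subspace S)])
     -Quotient.idealrBE => /asboolP.
apply/eqP.
rewrite -[_ == _]/(u == v %[mod Quotient.quot (zmod_subspace S)]).
by rewrite -Quotient.idealrBE; exact/asboolP.
Qed.

Lemma quot_piD (u v : V) : \pi_Q (u + v) = \pi_Q u + \pi_Q v.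
Proof. exact: Quotient.pi_add. Qed.

Lemma quot_piZ (a : k) (u : V) : \pi_Q (a *: u) = quot_scale a (\pi_Q u).
Proof.
apply/quot_piP; rewrite -scalerBr -[_ *: _]addr0.
apply: (subspaceDZ _ _ (subspace0 S)).
by apply: (proj1 (quot_piP _ _)); rewrite reprK.
Qed.

Lemma quot_scaleA a b x : quot_scale a (quot_scale b x) = quot_scale (a * b) x.
Proof. by rewrite -[x]reprK -(quot_piZ b) -!quot_piZ scalerA. Qed.
Lemma quot_scale1 : left_id 1 quot_scale.
Proof. by move=> x; rewrite -[x]reprK -quot_piZ scale1r. Qed.
Lemma quot_scaleDr : right_distributive quot_scale +%R.
Proof.
move=> a x y; rewrite -[x]reprK -[y]reprK.
by rewrite -quot_piD -!quot_piZ scalerDr quot_piD.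
Qed.
Lemma quot_scaleDl x : {morph quot_scale^~ x : a b / a + b}.
Proof. by move=> a b; rewrite -[x]reprK -!quot_piZ scalerDl quot_piD. Qed.

HB.instance Definition _ := GRing.Zmodule_isLmodule.Build k Q
  quot_scaleA quot_scale1 quot_scaleDr quot_scaleDl.

End QuotScale.
End Subspace.

Section Subquotient.
Variables (k : fieldType) (V : lmodType k) (Z B : subspace V).

Lemma trace_subspace0 : B (val (0 : sub_of Z)).
Proof. by rewrite raddf0; exact: subspace0. Qed.
Lemma trace_subspaceDZ (a : k) (u v : sub_of Z) :
  B (val u) -> B (val v) -> B (val (a *: u + v)).
Proof. by rewrite linearP; exact: subspaceDZ. Qed.
Definition trace_subspace : subspace (sub_of Z) :=
  @Subspace k (sub_of Z) (fun z => B (val z)) trace_subspace0 trace_subspaceDZ.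

(* Z / (Z ∩ B) *)
Definition subquot : Type := quot_of trace_subspace.
HB.instance Definition _ := GRing.Lmodule.on subquot.

Definition cls (z : sub_of Z) : subquot := \pi_(quot_of trace_subspace) z.

Lemma cls_linear : linear cls.
Proof. by move=> a u v; rewrite /cls quot_piD quot_piZ. Qed.
HB.instance Definition _ := GRing.isLinear.Build k (sub_of Z) subquot _ cls cls_linear.

Lemma clsP (u v : sub_of Z) : (cls u = cls v) <-> B (val u - val v).
Proof. by rewrite -raddfB; exact: quot_piP. Qed.

Lemma cls_surj (x : subquot) : exists z, cls z = x.
Proof. by exists (repr (x : quot_of trace_subspace)); rewrite /cls reprK. Qed.

End Subquotient.

(* k acts centrally: these are the modules over S (x)_k T^op *)

Record bimod (k : fieldType) (S T : algType k) := Bimod {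
  bimod_car :> lmodType k;
  lact : S -> bimod_car -> bimod_car;
  ract : bimod_car -> T -> bimod_car;
  lactDl : forall (a : k) s s' x, lact (a *: s + s') x = a *: lact s x + lact s' x;
  lactDr : forall (a : k) s x y, lact s (a *: x + y) = a *: lact s x + lact s y;
  ractDl : forall (a : k) x y t, ract (a *: x + y) t = a *: ract x t + ract y t;
  ractDr : forall (a : k) x t t', ract x (a *: t + t') = a *: ract x t + ract x t';
  lact1 : forall x, lact 1 x = x;
  ract1 : forall x, ract x 1 = x;
  lactA : forall s s' x, lact (s * s') x = lact s (lact s' x);
  ractA : forall x t t', ract x (t * t') = ract (ract x t) t';
  lractA : forall s x t, lact s (ract x t) = ract (lact s x) t
}.

Section BimodFacts.
Variables (k : fieldType) (S T : algType k) (X : bimod S T).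
Lemma lact0r (s : S) : lact s (0 : X) = 0.
Proof. by have := lactDr (-1) s (0 : X) 0; rewrite scaler0 addr0 scaleN1r addNr. Qed.
Lemma lact0l (x : X) : lact 0 x = 0.
Proof. by have := lactDl (-1) (0 : S) 0 x; rewrite scaler0 addr0 scaleN1r addNr. Qed.
Lemma ract0l (t : T) : ract (0 : X) t = 0.
Proof. by have := ractDl (-1) (0 : X) 0 t; rewrite scaler0 addr0 scaleN1r addNr. Qed.
Lemma ract0r (x : X) : ract x 0 = 0.
Proof. by have := ractDr (-1) x (0 : T) 0; rewrite scaler0 addr0 scaleN1r addNr. Qed.
Lemma lactD (s : S) (x y : X) : lact s (x + y) = lact s x + lact s y.
Proof. by have := lactDr 1 s x y; rewrite !scale1r. Qed.
Lemma lactZ (a : k) (s : S) (x : X) : lact s (a *: x) = a *: lact s x.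
Proof. by have := lactDr a s x 0; rewrite lact0r !addr0. Qed.
Lemma lactDs (s s' : S) (x : X) : lact (s + s') x = lact s x + lact s' x.
Proof. by have := lactDl 1 s s' x; rewrite !scale1r. Qed.
Lemma lactZs (a : k) (s : S) (x : X) : lact (a *: s) x = a *: lact s x.
Proof. by have := lactDl a s 0 x; rewrite lact0l !addr0. Qed.
Lemma ractD (x y : X) (t : T) : ract (x + y) t = ract x t + ract y t.
Proof. by have := ractDl 1 x y t; rewrite !scale1r. Qed.
Lemma ractZ (a : k) (x : X) (t : T) : ract (a *: x) t = a *: ract x t.
Proof. by have := ractDl a x 0 t; rewrite ract0l !addr0. Qed.
Lemma ractDt (x : X) (t t' : T) : ract x (t + t') = ract x t + ract x t'.
Proof. by have := ractDr 1 x t t'; rewrite !scale1r. Qed.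
Lemma ractZt (a : k) (x : X) (t : T) : ract x (a *: t) = a *: ract x t.
Proof. by have := ractDr a x t 0; rewrite ract0r !addr0. Qed.
End BimodFacts.

Section Constructions.
Variable k : fieldType.

Program Definition regbimod (S : algType k) : bimod S S :=
  @Bimod k S S S (fun s x => s * x) (fun x t => x * t) _ _ _ _ _ _ _ _ _.
Next Obligation. by move=> S a s s' x /=; rewrite mulrDl scalerAl. Qed.
Next Obligation. by move=> S a s x y /=; rewrite mulrDr scalerAr. Qed.
Next Obligation. by move=> S a x y t /=; rewrite mulrDl scalerAl. Qed.
Next Obligation. by move=> S a x t t' /=; rewrite mulrDr scalerAr. Qed.
Next Obligation. by move=> S x /=; rewrite mul1r. Qed.
Next Obligation. by move=> S x /=; rewrite mulr1. Qed.
Next Obligation. by move=> S s s' x /=; rewrite mulrA. Qed.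
Next Obligation. by move=> S x t t' /=; rewrite mulrA. Qed.
Next Obligation. by move=> S s x t /=; rewrite mulrA. Qed.

Program Definition restr (R S : algType k) (eta : {lrmorphism R -> S})
    (X : bimod S S) : bimod R R :=
  @Bimod k R R X (fun r x => lact (eta r) x) (fun x r => ract x (eta r))
    _ _ _ _ _ _ _ _ _.
Next Obligation. by move=> R S eta X a r r' x /=; rewrite linearP lactDl. Qed.
Next Obligation. by move=> R S eta X a r x y /=; rewrite lactDr. Qed.
Next Obligation. by move=> R S eta X a x y r /=; rewrite ractDl. Qed.
Next Obligation. by move=> R S eta X a x r r' /=; rewrite linearP ractDr. Qed.
Next Obligation. by move=> R S eta X x /=; rewrite rmorph1 lact1. Qed.
Next Obligation. by move=> R S eta X x /=; rewrite rmorph1 ract1. Qed.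
Next Obligation. by move=> R S eta X r r' x /=; rewrite rmorphM lactA. Qed.
Next Obligation. by move=> R S eta X x r r' /=; rewrite rmorphM ractA. Qed.
Next Obligation. by move=> R S eta X r x r' /=; rewrite lractA. Qed.

(* M ⊕ N over A × B: A × B acts on M and N through the relevant factors *)
Program Definition sumbimod (A B : algType k) (M : bimod B A) (N : bimod A B) :
    bimod (A * B)%type (A * B)%type :=
  @Bimod k (A * B)%type (A * B)%type (M * N)%type
    (fun s x => (lact s.2 x.1, lact s.1 x.2))
    (fun x s => (ract x.1 s.1, ract x.2 s.2))
    _ _ _ _ _ _ _ _ _.
Next Obligation. by move=> A B M N a s s' x /=; rewrite !lactDl. Qed.
Next Obligation. by move=> A B M N a s x y /=; rewrite !lactDr. Qed.
Next Obligation. by move=> A B M N a x y s /=; rewrite !ractDl. Qed.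
Next Obligation. by move=> A B M N a x s s' /=; rewrite !ractDr. Qed.
Next Obligation. by move=> A B M N [x y] /=; rewrite !lact1. Qed.
Next Obligation. by move=> A B M N [x y] /=; rewrite !ract1. Qed.
Next Obligation. by move=> A B M N s s' x /=; rewrite !lactA. Qed.
Next Obligation. by move=> A B M N x s s' /=; rewrite !ractA. Qed.
Next Obligation. by move=> A B M N s x s' /=; rewrite !lractA. Qed.

End Constructions.

Section BimodHom.
Variables (k : fieldType) (S T : algType k).

Definition is_bihom (X Y : bimod S T) (f : X -> Y) : Prop :=
  [/\ forall (a : k) x y, f (a *: x + y) = a *: f x + f y,
      forall s x, f (lact s x) = lact s (f x)
    & forall x t, f (ract x t) = ract (f x) t].

Lemma bihom0 (X Y : bimod S T) : is_bihom (0 : X -> Y).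
Proof.
by split=> *; rewrite /= ?scaler0 ?addr0 ?lact0r ?ract0l.
Qed.

Lemma bihomDZ (X Y : bimod S T) (a : k) (f g : X -> Y) :
  is_bihom f -> is_bihom g -> is_bihom (a *: f + g).
Proof.
have E z : (a *: f + g) z = a *: f z + g z by [].
move=> [f1 f2 f3] [g1 g2 g3]; split=> *; rewrite !E ?f1 ?g1 ?f2 ?g2 ?f3 ?g3.
- by rewrite !scalerDr !scalerA [a * _]mulrC addrACA.
- by rewrite lactDr.
- by rewrite ractDl.
Qed.

Definition bihom_space (X Y : bimod S T) : subspace (X -> Y) :=
  Subspace (bihom0 X Y) (@bihomDZ X Y).

Definition bihom (X Y : bimod S T) : Type := sub_of (bihom_space X Y).
HB.instance Definition _ X Y := GRing.Lmodule.on (bihom X Y).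

Definition bihom_fun (X Y : bimod S T) (f : bihom X Y) : X -> Y := sub_val f.
Coercion bihom_fun : bihom >-> Funclass.

Definition projective (P : bimod S T) : Prop :=
  forall (X Y : bimod S T) (g : bihom X Y) (f : bihom P Y),
    (forall y, exists x, g x = y) -> exists h : bihom P X, forall p, g (h p) = f p.

Record resolution (X : bimod S T) := Resolution {
  res_obj :> nat -> bimod S T;
  res_d : forall n, bihom (res_obj n.+1) (res_obj n);
  res_eps : bihom (res_obj 0) X;
  res_proj : forall n, projective (res_obj n);
  res_eps_surj : forall x, exists y, res_eps y = x;
  res_exact0 : forall y, res_eps y = 0 <-> exists z, res_d 0 z = y;
  res_exact : forall n y, res_d n y = 0 <-> exists z, res_d n.+1 z = y
}.

Section Ext.
Variables (X : bimod S T) (P : resolution X) (Y : bimod S T).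

Lemma ext_cocycle0 n z : (0 : bihom (P n) Y) (res_d P n z) = 0.
Proof. by []. Qed.
Lemma ext_cocycleDZ n (a : k) (u v : bihom (P n) Y) :
  (forall z, u (res_d P n z) = 0) -> (forall z, v (res_d P n z) = 0) ->
  forall z, (a *: u + v : bihom _ _) (res_d P n z) = 0.
Proof.
by move=> u0 v0 z; rewrite -[LHS]/(a *: u _ + v _) u0 v0 scaler0 addr0.
Qed.
Definition ext_cocycle n : subspace (bihom (P n) Y) :=
  @Subspace k (bihom (P n) Y) (fun u : bihom (P n) Y => forall z, u (res_d P n z) = 0)
    (@ext_cocycle0 n) (@ext_cocycleDZ n).

Definition is_ext_cobound n : bihom (P n) Y -> Prop :=
  match n with
  | 0 => fun u => u = 0
  | m.+1 => fun u => exists v : bihom (P m) Y, forall x, u x = v (res_d P m x)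
  end.
Lemma ext_cobound0 n : is_ext_cobound (0 : bihom (P n) Y).
Proof. by case: n => [//|n]; exists 0. Qed.
Lemma ext_coboundDZ n (a : k) (u v : bihom (P n) Y) :
  is_ext_cobound u -> is_ext_cobound v -> is_ext_cobound (a *: u + v).
Proof.
case: n u v => [|n] u v /=; first by move=> -> ->; rewrite scaler0 addr0.
move=> [u' uE] [v' vE]; exists (a *: u' + v') => x.
by rewrite -[LHS]/(a *: u _ + v _) uE vE.
Qed.
Definition ext_cobound n : subspace (bihom (P n) Y) :=
  Subspace (ext_cobound0 n) (@ext_coboundDZ n).

(* Ext^n(X, Y) = H^n(Hom(P, Y)), computed from a projective resolution P of X *)
Definition Ext n : Type := subquot (ext_cocycle n) (ext_cobound n).
HB.instance Definition _ n := GRing.Lmodule.on (Ext n).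

Definition ext_cls n (u : sub_of (ext_cocycle n)) : Ext n := cls (ext_cobound n) u.

End Ext.
End BimodHom.

Definition HH (k : fieldType) (S : algType k) (P : resolution (regbimod S))
  (n : nat) : Type := Ext P (regbimod S) n.
HB.instance Definition _ (k : fieldType) (S : algType k)
  (P : resolution (regbimod S)) n := GRing.Lmodule.on (HH P n).

Definition upd (T : Type) n (x : 'I_n -> T) (i : 'I_n) (u : T) : 'I_n -> T :=
  fun j => if j == i then u else x j.

Section TensorHom.
Variables (k : fieldType) (S : algType k) (X Y : bimod S S) (n : nat).

(* f(x_0, ..., x_(n-1)) stands for the value at x_0 (x)_S ... (x)_S x_(n-1) of
   an S-bimodule morphism from the n-fold tensor power of X over S to Y. The
   last clause is only for n = 0, where the tensor power is S and a morphism
   S -> Y is an element of Y commuting with S. *)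
Definition is_tenshom (f : ('I_n -> X) -> Y) : Prop :=
  [/\ forall x i (a : k) u v,
        f (upd x i (a *: u + v)) = a *: f (upd x i u) + f (upd x i v),
      forall x (i j : 'I_n) s, i.+1 = j :> nat ->
        f (upd x i (ract (x i) s)) = f (upd x j (lact s (x j))),
      forall x (i : 'I_n) s, i = 0%N :> nat ->
        f (upd x i (lact s (x i))) = lact s (f x),
      forall x (i : 'I_n) s, i.+1 = n ->
        f (upd x i (ract (x i) s)) = ract (f x) s
    & n = 0%N -> forall x s, lact s (f x) = ract (f x) s].

Lemma tenshom0 : is_tenshom 0.
Proof.
by split=> *; rewrite /= ?scaler0 ?addr0 ?lact0r ?ract0l.
Qed.

Lemma tenshomDZ (a : k) (f g : ('I_n -> X) -> Y) :
  is_tenshom f -> is_tenshom g -> is_tenshom (a *: f + g).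
Proof.
have E z : (a *: f + g) z = a *: f z + g z by [].
move=> [f1 f2 f3 f4 f5] [g1 g2 g3 g4 g5]; split.
- move=> x i b u v; rewrite !E f1 g1 !scalerDr !scalerA [a * _]mulrC.
  by rewrite addrACA.
- by move=> x i j s ij; rewrite !E (f2 _ _ _ _ ij) (g2 _ _ _ _ ij).
- by move=> x i s i0; rewrite !E f3 // g3 // lactDr.
- by move=> x i s i0; rewrite !E f4 // g4 // ractDl.
- by move=> n0 x s; rewrite !E lactDr ractDl f5 // g5.
Qed.

Definition tenshom_space : subspace (('I_n -> X) -> Y) :=
  Subspace tenshom0 tenshomDZ.

Definition tenshom : Type := sub_of tenshom_space.
HB.instance Definition _ := GRing.Lmodule.on tenshom.

Definition tenshom_fun (f : tenshom) : ('I_n -> X) -> Y := sub_val f.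

End TensorHom.

Arguments tenshom {k S} X Y n.
Coercion tenshom_fun : tenshom >-> Funclass.

(* (x_0, ..., x_n) |-> (x_0, ..., x_i x_(i+1), ..., x_n) *)
Definition merge_at (S : pzRingType) n (x : 'I_n.+1 -> S) (i : 'I_n) : 'I_n -> S :=
  fun j => if (j < i)%N then x (widen_ord (leqnSn n) j)
           else if j == i then x (widen_ord (leqnSn n) j) * x (lift ord0 j)
           else x (lift ord0 j).

Definition hcobound (k : fieldType) (S : algType k) (Y : bimod S S) n
    (f : ('I_n -> S) -> Y) : ('I_n.+1 -> S) -> Y := fun x =>
  lact (x ord0) (f (fun j => x (lift ord0 j)))
  + \sum_(i < n) (-1) ^+ i.+1 *: f (merge_at x i)
  + (-1) ^+ n.+1 *: ract (f (fun j => x (widen_ord (leqnSn n) j))) (x ord_max).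

(* Hom_{R-R}(S^{(x)_R n}, Y), where R acts through eta : R -> S *)
Notation relcochain eta Y n :=
  (tenshom (restr eta (regbimod _)) (restr eta Y) n).

(* [phi] encodes a chain map over the identity of S from the R-relative bar
   resolution (S (x)_R S^{(x)_R n} (x)_R S)_n to the resolution P, by
   phi n (x_1, ..., x_n) = image of 1 (x) x_1 (x) ... (x) x_n (x) 1.
   Composition with phi sends cocycles of Hom(P, Y) to R-relative Hochschild
   cocycles; for R separable it induces the canonical isomorphism from Ext^n(S, Y)
   to the R-relative Hochschild cohomology, which does not depend on phi. *)
Definition bar_comparison (k : fieldType) (R S : algType k)
    (eta : {lrmorphism R -> S}) (P : resolution (regbimod S))
    (phi : forall n, relcochain eta (P n) n) : Prop :=
  (forall x : 'I_0 -> S, res_eps P (phi 0 x) = 1)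
  /\ (forall n (x : 'I_n.+1 -> S),
        res_d P n (phi n.+1 x) = hcobound (Y := P n) (phi n) x).

Section NullSquare.
Variables (k : fieldType) (A B : algType k) (M : bimod B A) (N : bimod A B).

(* ((a, n), (m, b)) is the matrix with rows (a n) and (m b) *)
Definition nullsq : Type := ((A * N) * (M * B))%type.
HB.instance Definition _ := GRing.Lmodule.on nullsq.

Definition nullsq_one : nullsq := ((1, 0), (0, 1)).
Definition nullsq_mul (x y : nullsq) : nullsq :=
  let: ((a, n), (m, b)) := x in let: ((a', n'), (m', b')) := y in
  ((a * a', lact a n' + ract n b'), (ract m a' + lact b m', b * b')).

Lemma nullsq_mulA : associative nullsq_mul.
Proof.
case=> [[a n] [m b]] [[a' n'] [m' b']] [[a2 n2] [m2 b2]] /=.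
by rewrite !mulrA !lactD !ractD !lactA !ractA !lractA !addrA.
Qed.
Lemma nullsq_mul1r : left_id nullsq_one nullsq_mul.
Proof.
by case=> [[a n] [m b]] /=; rewrite !mul1r !lact1 ract0l ract0l add0r addr0.
Qed.
Lemma nullsq_mulr1 : right_id nullsq_one nullsq_mul.
Proof.
by case=> [[a n] [m b]] /=; rewrite !mulr1 !ract1 !lact0r add0r addr0.
Qed.
Lemma nullsq_mulDl : left_distributive nullsq_mul +%R.
Proof.
case=> [[a n] [m b]] [[a' n'] [m' b']] [[a2 n2] [m2 b2]].
rewrite -[LHS]/(((a + a') * a2, lact (a + a') n2 + ract (n + n') b2),
  (ract (m + m') a2 + lact (b + b') m2, (b + b') * b2)).
by rewrite !mulrDl !lactDs !ractD addrACA [X in (_, (X, _))]addrACA.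
Qed.
Lemma nullsq_mulDr : right_distributive nullsq_mul +%R.
Proof.
case=> [[a n] [m b]] [[a' n'] [m' b']] [[a2 n2] [m2 b2]].
rewrite -[LHS]/((a * (a' + a2), lact a (n' + n2) + ract n (b' + b2)),
  (ract m (a' + a2) + lact b (m' + m2), b * (b' + b2))).
by rewrite !mulrDr !lactD !ractDt addrACA [X in (_, (X, _))]addrACA.
Qed.
Lemma nullsq_one_neq0 : nullsq_one != 0.
Proof.
by apply/eqP => /(congr1 (fun x : nullsq => x.1.1)) /eqP; rewrite oner_eq0.
Qed.

HB.instance Definition _ := GRing.Zmodule_isNzRing.Build nullsq
  nullsq_mulA nullsq_mul1r nullsq_mulr1 nullsq_mulDl nullsq_mulDr nullsq_one_neq0.

Lemma nullsq_scaleAl (c : k) (x y : nullsq) : c *: (x * y) = (c *: x) * y.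
Proof.
case: x y => [[a n] [m b]] [[a' n'] [m' b']].
rewrite -[LHS]/((c *: (a * a'), c *: (lact a n' + ract n b')),
  (c *: (ract m a' + lact b m'), c *: (b * b'))).
rewrite -[RHS]/(((c *: a) * a', lact (c *: a) n' + ract (c *: n) b'),
  (ract (c *: m) a' + lact (c *: b) m', (c *: b) * b')).
by rewrite !scalerAl !scalerDr !lactZs !ractZ.
Qed.
HB.instance Definition _ :=
  GRing.Lmodule_isLalgebra.Build k nullsq nullsq_scaleAl.

Lemma nullsq_scaleAr (c : k) (x y : nullsq) : c *: (x * y) = x * (c *: y).
Proof.
case: x y => [[a n] [m b]] [[a' n'] [m' b']].
rewrite -[LHS]/((c *: (a * a'), c *: (lact a n' + ract n b')),
  (c *: (ract m a' + lact b m'), c *: (b * b'))).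
rewrite -[RHS]/((a * (c *: a'), lact a (c *: n') + ract n (c *: b')),
  (ract m (c *: a') + lact b (c *: m'), b * (c *: b'))).
by rewrite !scalerAr !scalerDr !lactZ !ractZt.
Qed.
HB.instance Definition _ :=
  GRing.Lalgebra_isAlgebra.Build k nullsq nullsq_scaleAr.

Local Notation diagalg := (A * B)%type.

(* The decomposition of the algebra as (A × B) ⊕ (M ⊕ N) *)
Definition inA (a : diagalg) : nullsq := ((a.1, 0), (0, a.2)).
Definition prA (x : nullsq) : diagalg := (x.1.1, x.2.2).
Definition inM (m : sumbimod M N) : nullsq := ((0, m.2), (m.1, 0)).
Definition prM (x : nullsq) : sumbimod M N := (x.2.1, x.1.2).

Local Notation diagk := (k^o * k^o)%type.

Definition etaA (d : diagk) : diagalg := (d.1%:A, d.2%:A).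
Lemma etaA_linear : linear etaA.
Proof.
move=> c x y.
rewrite -[LHS]/((c * x.1 + y.1)%:A, (c * x.2 + y.2)%:A).
by rewrite !scalerDl -!scalerA.
Qed.
HB.instance Definition _ :=
  GRing.isLinear.Build k diagk diagalg _ etaA etaA_linear.
Lemma etaA_monoid : monoid_morphism etaA.
Proof.
split; first by congr pair; exact: scale1r.
by move=> x y; congr pair; rewrite /= -scalerAl mul1r scalerA.
Qed.
HB.instance Definition _ :=
  GRing.isMonoidMorphism.Build diagk diagalg etaA etaA_monoid.

Lemma inA_linear : linear inA.
Proof.
move=> c x y; rewrite /inA.
by congr ((_, _), (_, _)); rewrite /= scaler0 addr0.
Qed.
HB.instance Definition _ :=
  GRing.isLinear.Build k diagalg nullsq _ inA inA_linear.
Lemma inA_monoid : monoid_morphism inA.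
Proof.
split=> // x y; rewrite /inA -[RHS]/(nullsq_mul _ _) /=.
by rewrite !lact0r !ract0l !addr0.
Qed.
HB.instance Definition _ :=
  GRing.isMonoidMorphism.Build diagalg nullsq inA inA_monoid.

Definition etaL : {lrmorphism diagk -> nullsq} := inA \o etaA.

Local Notation J n := (relcochain etaL (regbimod nullsq) n).

(* vanishing at the tensors with an even number of factors in M ⊕ N, the other
   factors being in A × B; s is the set of positions of the former *)
Definition even_vanish n (f : ('I_n -> nullsq) -> nullsq) : Prop :=
  forall (s : {set 'I_n}) (x : 'I_n -> nullsq),
    (forall i, if i \in s then prA (x i) = 0 else prM (x i) = 0) ->
    ~~ odd #|s| -> f x = 0.

Definition inD n (f : J n) : Prop := even_vanish f.

(* The class in H^n(J/D) of y : J^n is sent by the connecting homomorphism to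
   the class in H^n.+1(D) of z: some t : J^n congruent to y modulo D^n has a
   coboundary cohomologous to z in D. *)
Definition connecting n (y : ('I_n -> nullsq) -> nullsq)
    (z : ('I_n.+1 -> nullsq) -> nullsq) : Prop :=
  exists t h : J n,
    [/\ even_vanish (fun x => t x - y x), inD h &
        forall x, hcobound (Y := regbimod nullsq) t x
                  = z x + hcobound (Y := regbimod nullsq) h x].

(* Extensions by zero: for n > 0, a multilinear map composed with a projection
   vanishes as soon as one argument lies in the other summand. *)
Definition extA n (c : ('I_n -> diagalg) -> diagalg) :
    ('I_n -> nullsq) -> nullsq :=
  fun x => inA (c (fun i => prA (x i))).
Definition extMA n (f : ('I_n -> sumbimod M N) -> diagalg) :
    ('I_n -> nullsq) -> nullsq :=
  fun x => inA (f (fun i => prM (x i))).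
Definition extMM n (f : ('I_n -> sumbimod M N) -> sumbimod M N) :
    ('I_n -> nullsq) -> nullsq :=
  fun x => inM (f (fun i => prM (x i))).

Variable Q : resolution (regbimod diagalg).

(* The class of the cocycle u in HH^{2m}(A × B) is represented by the Hochschild
   cocycle u \o phi, for some comparison phi. *)
Definition is_nabla m
    (nabla : HH Q (2 * m) * tenshom (sumbimod M N) (regbimod diagalg) (2 * m)
             -> tenshom (sumbimod M N) (sumbimod M N) (2 * m).+1) : Prop :=
  exists2 phi : forall n, relcochain etaA (Q n) n, bar_comparison phi &
    forall (u : sub_of (ext_cocycle Q (regbimod diagalg) (2 * m)))
           (f : tenshom (sumbimod M N) (regbimod diagalg) (2 * m)),
      connecting
        (fun x => extA (fun a => (val u : bihom _ _) (phi _ a)) x + extMA f x)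
        (extMM (nabla (ext_cls u, f))).

Definition is_nabla0
    (nabla : HH Q 0 -> bihom (sumbimod M N) (sumbimod M N)) : Prop :=
  exists2 phi : forall n, relcochain etaA (Q n) n, bar_comparison phi &
    forall u : sub_of (ext_cocycle Q (regbimod diagalg) 0),
      connecting
        (extA (fun a => (val u : bihom _ _) (phi _ a)))
        (extMM (fun x : 'I_1 -> sumbimod M N => nabla (ext_cls u) (x ord0))).

End NullSquare.

(* 0 -> V1 -> V2 -> V3 -> V4 -> V5 -> 0 is exact *)
Definition five_term_exact (V1 V2 V3 V4 V5 : zmodType) (f1 : V1 -> V2)
    (f2 : V2 -> V3) (f3 : V3 -> V4) (f4 : V4 -> V5) : Prop :=
  [/\ injective f1,
      forall y, f2 y = 0 <-> exists x, f1 x = y,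
      forall y, f3 y = 0 <-> exists x, f2 x = y,
      forall y, f4 y = 0 <-> exists x, f3 x = y
    & forall y, exists x, f4 x = y].

(* Main.v *)
(* Through the augmentation of the square-zero extension L = AA (+) MM over
   AA = A x B, the sequence 0 -> MM -> L -> AA -> 0 is one of L-bimodules. Parity
   with respect to the idempotents of D = k x k identifies D^. with C^.(L, MM) and
   (J/D)^. with C^.(L, AA), cochains being D-relative, so that the exact sequences
   are pieces of the long exact sequence of these coefficients.
   - For an AA-bimodule X, C^.(L, X) is computed by a homotopy that inserts a
     section of AA (x) MM -> MM at the first argument in MM: a cocycle is the sum
     of one inflated from AA and of one with first argument in MM, that is, of a
     cocycle with values in W = Hom_AA(MM, X), of degree one less. By induction,
     and because W is acyclic in positive degrees as a retract of a coinduced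
     bimodule, H^n(L, X) is HH^n(AA, X) + Hom(MM^(x)n, X). Parity kills
     HH^n(AA, MM), and one of Hom(MM^(x)n, AA), Hom(MM^(x)n, MM) for each n.
   - D-relative cochains compute Ext over any projective resolution P. Tensor
     products are avoided: a cochain of degree n+1 in Y is a cochain of degree n
     in the coinduced bimodule of Y (currying), so that a chain map from P to the
     bar resolution and its homotopies are defined by recursion on n for all Y at
     once. A projective bimodule X is used through a section of
     S (x) X (x) T -> X, and vector spaces through generalized inverses of linear
     maps (Zorn). *)
From HB Require Import structures.
Require Import Defs.
From mathcomp Require Import all_boot all_order all_algebra.
From mathcomp Require Import boolp functions.
From mathcomp Require classical_sets.

Set Implicit Arguments.
Unset Strict Implicit.
Unset Printing Implicit Defensive.

Import GRing.Theory.
Local Open Scope ring_scope.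

#[local] Obligation Tactic := idtac.

(** * Linear maps over a field *)

(** The obstacle is the alternating sum: a cochain is a function on tuples subject to balancing
    conditions, and checking each identity on merged tuples would be long. The identity [cur_dlt]
    takes its place: the coboundary, once curried, is the canonical map to the coinduced bimodule
    minus the coboundary of the curried cochain. This is why statements on cochains quantify over
    all coefficient bimodules, also where a single one is wanted in the end. On square-zero
    extensions, Hom_AA(MM, X) lowers the degree in the same manner. The terms of the sequence are
    quotients attached to given resolutions, whereas the connecting map is specified on cochains.
    Each space is therefore tied to cocycles by a relation, [realizes], and maps come from linear
    relations, so that no sequence is transported along isomorphisms. The base D = k x k serves
    twice: its idempotents detect the parity of a tensor, and its separability turns linear choices
    of preimages into D-bilinear ones, from which the comparison maps are made. *)

Section LinearPredicate.
Variables (k : fieldType) (X Y : lmodType k) (f : X -> Y).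
Hypothesis f_lin : linear f.

Lemma lin0 : f 0 = 0.
Proof. by have := f_lin (-1) 0 0; rewrite scaler0 addr0 scaleN1r addNr. Qed.
Lemma linD u v : f (u + v) = f u + f v.
Proof. by have := f_lin 1 u v; rewrite !scale1r. Qed.
Lemma linZ a u : f (a *: u) = a *: f u.
Proof. by have := f_lin a u 0; rewrite lin0 !addr0. Qed.
Lemma linN u : f (- u) = - f u.
Proof. by rewrite -scaleN1r linZ scaleN1r. Qed.
Lemma linB u v : f (u - v) = f u - f v.
Proof. by rewrite linD linN. Qed.
Lemma lin_sum (I : Type) (r : seq I) (F : I -> X) :
  f (\sum_(i <- r) F i) = \sum_(i <- r) f (F i).
Proof. exact: (big_morph f linD lin0). Qed.
End LinearPredicate.

Section LinearClosure.
Variables (k : fieldType).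

Lemma linear_funcomp (X Y Z : lmodType k) (g : Y -> Z) (f : X -> Y) :
  linear g -> linear f -> linear (fun x => g (f x)).
Proof. by move=> gl fl a u v; rewrite fl gl. Qed.

Lemma linear_funB (X Y : lmodType k) (f g : X -> Y) :
  linear f -> linear g -> linear (fun x => f x - g x).
Proof.
by move=> fl gl a u v; rewrite fl gl scalerBr opprD addrACA.
Qed.
End LinearClosure.

Section GeneralizedInverse.
Variables (k : fieldType) (X Y : lmodType k) (f : X -> Y).
Hypothesis f_lin : linear f.
Import classical_sets.
Local Open Scope classical_set_scope.

(* Graphs of partial linear maps g with f (g y) = y for y in the domain of g
   and in the image of f. The empty graph is allowed: it is the union of the
   empty chain. *)
Let partial_inverse (G : set (Y * X)%type) : Prop :=
  [/\ forall (a : k) u v, G u -> G v -> G (a *: u + v),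
      forall x, G (0, x) -> x = 0
    & forall x1 x, G (f x1, x) -> f x = f x1].

Let partial_inverse_chain (F : set (set (Y * X)%type)) :
  F `<=` partial_inverse -> total_on F subset ->
  partial_inverse (\bigcup_(G in F) G).
Proof.
move=> FP Ftot; split.
- move=> a u v [G FG Gu] [H FH Hv].
  case: (Ftot _ _ FG FH) => sub.
    by exists H => //; have [+ _ _] := FP _ FH; apply=> //; exact: sub.
  by exists G => //; have [+ _ _] := FP _ FG; apply=> //; exact: sub.
- by move=> x [G FG Gx]; have [_ + _] := FP _ FG; exact.
- by move=> x1 x [G FG Gx]; have [_ _ +] := FP _ FG; exact.
Qed.

(** A maximal partial inverse is total, since a vector outside its domain can always be added with a
    suitable value. Applied to differentials, this supplies the linear choices of preimages behind
    homotopies and comparison maps. *)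
Lemma generalized_inverse :
  exists g : Y -> X, linear g /\ forall x, f (g (f x)) = f x.
Proof.
have [G [[Glin Gfun Ginv] Gmax]] := Zorn_bigcup partial_inverse_chain.
have G0 : G (0, 0).
  have [[u Gu]|Gempty] := pselect (exists u, G u).
    by have := Glin (-1) u u Gu Gu; rewrite scaleN1r addNr.
  have sub : G `<` [set (0, 0)].
    split=> [p Gp|/(_ (0, 0) erefl) H]; by case: Gempty; eexists; eassumption.
  case: (Gmax _ sub); split.
  - by move=> a u v -> ->; congr pair; rewrite /= scaler0 addr0.
  - by move=> x [].
  - by move=> x1 x [-> ->]; exact: lin0.
have Gfun2 y x1 x2 : G (y, x1) -> G (y, x2) -> x1 = x2.
  move=> G1 G2; apply/eqP; rewrite -subr_eq0; apply/eqP/Gfun.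
  have := Glin (-1) _ _ G2 G1; rewrite scaleN1r [_ + _]surjective_pairing /=.
  by rewrite addNr addrC.
have Gtot y : exists x, G (y, x).
  apply: contrapT => Gy.
  pose ext x0 : set (Y * X)%type :=
    [set p | exists q a, G q /\ p = (q.1 + a *: y, q.2 + a *: x0)].
  have ext_sub x0 : G `<` ext x0.
    split=> [[y1 x1] G1|/(_ (y, x0))].
      by exists (y1, x1), 0; rewrite !scale0r !addr0.
    move=> H; apply: Gy; exists x0; apply: H.
    by exists (0, 0), 1; rewrite !scale1r !add0r.
  have ext_lin x0 a u v : ext x0 u -> ext x0 v -> ext x0 (a *: u + v).
    move=> [[q1 q2] [b [Gq ->]]] [[r1 r2] [c [Gr ->]]].
    exists (a *: (q1, q2) + (r1, r2)), (a * b + c); split; first exact: Glin.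
    by congr pair; rewrite /= scalerDr scalerDl !scalerA addrACA.
  have coef0 (q : Y * X) a : G q -> q.1 + a *: y = 0 -> a = 0.
    move=> Gq /eqP; rewrite addr_eq0 => /eqP E; apply: contra_notP Gy => /eqP a0.
    exists (- (a^-1) *: q.2); have := Glin (- (a^-1)) q 0 Gq G0.
    rewrite addr0 [_ *: q]surjective_pairing /= E scalerN scaleNr opprK scalerA.
    by rewrite mulVf // scale1r.
  have ext_fun x0 x : ext x0 (0, x) -> x = 0.
    move=> [q [a [Gq [E ->]]]]; have a0 := coef0 q a Gq (esym E).
    move: E; rewrite a0 !scale0r !addr0 => E; apply: Gfun.
    by rewrite E -surjective_pairing.
  (* The value at y is constrained only if y is congruent to some f x1 modulo the domain of G; then
     [x1 - q.2] puts the pair (f x1, x1) in the new graph. Otherwise no new vector of the image of f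
     enters the domain, and 0 is a valid choice. *)
  have [[q [x1 [Gq E]]]|Nim] := pselect (exists q x1, G q /\ q.1 + y = f x1).
    apply: (Gmax _ (ext_sub (x1 - q.2))); split; [exact: ext_lin|exact: ext_fun|].
    move=> x2 _ [r [a [Gr [E2 ->]]]].
    have Gd : G ((r.1 - a *: q.1), (r.2 - a *: q.2)).
      have := Glin (- a) q r Gq Gr; rewrite [_ + r]surjective_pairing /=.
      by rewrite !scaleNr addrC [- _ + _]addrC.
    have Ed : r.1 - a *: q.1 = f (x2 - a *: x1).
      rewrite (linB f_lin) (linZ f_lin) -E E2 scalerDr opprD addrA.
      by rewrite [RHS]addrAC addrK.
    rewrite Ed in Gd; have := Ginv _ _ Gd; rewrite !(linB f_lin) !(linZ f_lin).
    move=> E3; rewrite (linD f_lin) (linZ f_lin) (linB f_lin).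
    by rewrite scalerBr addrCA E3 addrC subrK.
  apply: (Gmax _ (ext_sub 0)); split; [exact: ext_lin|exact: ext_fun|].
  move=> x2 _ [r [a [Gr [E2 ->]]]].
  have [a0|a0] := eqVneq a 0.
    rewrite a0 scale0r addr0; apply: Ginv.
    by rewrite E2 a0 scale0r addr0 -surjective_pairing.
  case: Nim; exists (a^-1 *: r + 0), (a^-1 *: x2); split; first exact: Glin.
  by rewrite (linZ f_lin) E2 scalerDr scalerA mulVf // scale1r /= addr0.
have [g gP] := choice Gtot; exists g; split.
  move=> a u v; apply: (Gfun2 (a *: u + v)) => //.
  exact: (Glin a _ _ (gP u) (gP v)).
by move=> x; exact: Ginv.
Qed.

End GeneralizedInverse.

(** A generalized inverse of a -> a w is a linear form l with l(w) w = w. If all linear forms kill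
    w, this reads 0 = w. *)
Lemma functional_separation (k : fieldType) (W : lmodType k) (w : W) :
  (forall l : W -> k^o, linear l -> l w = 0) -> w = 0.
Proof.
move=> lw; have f_lin : linear (fun a : k^o => a *: w).
  by move=> a u v; rewrite scalerDl scalerA.
have [g [g_lin /(_ 1)]] := generalized_inverse f_lin.
by rewrite scale1r lw // scale0r => ->.
Qed.

Lemma functional_ext (k : fieldType) (W : lmodType k) (v w : W) :
  (forall l : W -> k^o, linear l -> l v = l w) -> v = w.
Proof.
move=> lvw; apply/eqP; rewrite -subr_eq0; apply/eqP/functional_separation.
by move=> l l_lin; rewrite linB // lvw // subrr.
Qed.

(** * Sections of S (x) X (x) T -> X *)

Definition trilinear (k : fieldType) (U V T W : lmodType k)
    (g : U -> V -> T -> W) : Prop :=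
  [/\ forall v t, linear (fun u => g u v t),
      forall u t, linear (fun v => g u v t)
    & forall u v, linear (fun t => g u v t)].

Definition tsum (U V T : Type) (W : nmodType) (g : U -> V -> T -> W)
    (l : seq (U * V * T)) : W :=
  \sum_(p <- l) g p.1.1 p.1.2 p.2.

Lemma eq_tsum (U V T : Type) (W : nmodType) (g h : U -> V -> T -> W) l :
  (forall u v t, g u v t = h u v t) -> tsum g l = tsum h l.
Proof. by move=> gh; apply: eq_bigr => p _. Qed.

Lemma tsumDZ (k : fieldType) (U V T : Type) (W : lmodType k)
    (g h : U -> V -> T -> W) (a : k) l :
  tsum (fun u v t => a *: g u v t + h u v t) l = a *: tsum g l + tsum h l.
Proof. by rewrite /tsum big_split /= scaler_sumr. Qed.

Lemma tsumB (U V T : Type) (W : zmodType) (g h : U -> V -> T -> W) l :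
  tsum (fun u v t => g u v t - h u v t) l = tsum g l - tsum h l.
Proof. exact: sumrB. Qed.

Lemma lin_tsum (k : fieldType) (U V T : Type) (W W' : lmodType k)
    (f : W -> W') (g : U -> V -> T -> W) l :
  linear f -> f (tsum g l) = tsum (fun u v t => f (g u v t)) l.
Proof. by move=> f_lin; rewrite /tsum lin_sum. Qed.

Lemma trilinear_comp (k : fieldType) (U V T W W' : lmodType k)
    (f : W -> W') (g : U -> V -> T -> W) :
  linear f -> trilinear g -> trilinear (fun u v t => f (g u v t)).
Proof.
by move=> f_lin [g1 g2 g3]; split=> *; apply: linear_funcomp.
Qed.

Lemma in_subspaceT (k : fieldType) (V : lmodType k) (S : subspace V) v :
  S v -> in_subspace S v.
Proof. exact: (introT (asboolP _)). Qed.

Definition mk_bihom (k : fieldType) (S T : algType k) (X Y : bimod S T)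
    (f : X -> Y) (fP : is_bihom f) : bihom X Y :=
  @SubOf _ _ (bihom_space X Y) f (in_subspaceT (S := bihom_space X Y) fP).

Lemma bihomP (k : fieldType) (S T : algType k) (X Y : bimod S T)
    (f : bihom X Y) : is_bihom f.
Proof. exact: (elimT (asboolP _) (valP f)). Qed.

Section BimoduleActions.
Variables (k : fieldType) (S T : algType k).

Section BimodLinear.
Variable X : bimod S T.
Lemma lact_lin (s : S) : linear (fun x : X => lact s x).
Proof. by move=> a x y; exact: lactDr. Qed.
Lemma lact_linl (x : X) : linear (fun s : S => lact s x).
Proof. by move=> a s s'; exact: lactDl. Qed.
Lemma ract_lin (t : T) : linear (fun x : X => ract x t).
Proof. by move=> a x y; exact: ractDl. Qed.
Lemma ract_linr (x : X) : linear (fun t : T => ract x t).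
Proof. by move=> a t t'; exact: ractDr. Qed.

Lemma trilinear_act : trilinear (fun (s : S) (x : X) (t : T) => ract (lact s x) t).
Proof.
split=> [x t|s t|s x] a u v.
- by rewrite lactDl ractDl.
- by rewrite lactDr ractDl.
- by rewrite ractDr.
Qed.
End BimodLinear.

Lemma mull_lin (a : S) : linear (fun s : S => a * s).
Proof. by move=> b s s'; rewrite mulrDr scalerAr. Qed.
Lemma mulr_lin (a : S) : linear (fun s : S => s * a).
Proof. by move=> b s s'; rewrite mulrDl scalerAl. Qed.

End BimoduleActions.

Section Splitting.
Variables (k : fieldType) (S T : algType k).

Lemma trilinear_mul (X : lmodType k) (W : lmodType k) (g : S -> X -> T -> W) a b :
  trilinear g -> trilinear (fun s x t => g (a * s) x (t * b)).
Proof.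
move=> [g1 g2 g3]; split=> [x t|s t|s x].
- by apply: (linear_funcomp (g1 x (t * b))); exact: mull_lin.
- exact: g2.
- by apply: (linear_funcomp (g3 (a * s) x)); exact: mulr_lin.
Qed.

(* sigma m is a formal sum of tensors s (x) x (x) t representing the value at
   m of a bimodule section of the multiplication S (x) X (x) T -> X; tensors are
   compared by means of the trilinear maps on S * X * T. *)
Record splitting (X : bimod S T) (sigma : X -> seq (S * X * T)) : Prop := {
  split_lin : forall (W : lmodType k) (g : S -> X -> T -> W), trilinear g ->
    linear (fun m => tsum g (sigma m));
  split_lact : forall (W : lmodType k) (g : S -> X -> T -> W), trilinear g ->
    forall a m, tsum g (sigma (lact a m))
                = tsum (fun s x t => g (a * s) x t) (sigma m);
  split_ract : forall (W : lmodType k) (g : S -> X -> T -> W), trilinear g ->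
    forall m b, tsum g (sigma (ract m b))
                = tsum (fun s x t => g s x (t * b)) (sigma m);
  split_id : forall m, tsum (fun s x t => ract (lact s x) t) (sigma m) = m
}.

Section FreeBimodule.
Variable X : bimod S T.

(* S (x) X (x) T, realized as functions on trilinear forms. *)
Definition tens_ev (l : seq (S * X * T)) : (S -> X -> T -> k^o) -> k^o :=
  fun g => if `[< trilinear g >] then tsum g l else 0.

Definition is_tens (u : (S -> X -> T -> k^o) -> k^o) : Prop :=
  exists l, u = tens_ev l.

Lemma tens0 : is_tens 0.
Proof.
by exists [::]; apply/funext => g; rewrite /tens_ev /tsum big_nil if_same.
Qed.

Lemma tensDZ a u v : is_tens u -> is_tens v -> is_tens (a *: u + v).
Proof.
move=> [l ->] [l' ->]; exists ([seq (a *: p.1.1, p.1.2, p.2) | p <- l] ++ l').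
apply/funext => g; rewrite -[LHS]/(a *: tens_ev l g + tens_ev l' g) /tens_ev.
case: asboolP => [[g1 _ _]|_]; last by rewrite scaler0 addr0.
rewrite /tsum big_cat big_map /= scaler_sumr; congr (_ + _).
by apply: eq_bigr => p _; rewrite (linZ (g1 _ _)).
Qed.

Definition tens_space : subspace ((S -> X -> T -> k^o) -> k^o) :=
  Subspace tens0 tensDZ.

(** The value 0 away from trilinear forms agrees with the convention of [tens_ev], so that the
    action preserves [tens_space] and equality of tensors is tested on trilinear forms only. *)
Definition tens_act (a : S) (b : T) (u : (S -> X -> T -> k^o) -> k^o) :
    (S -> X -> T -> k^o) -> k^o :=
  fun g => if `[< trilinear g >] then u (fun s x t => g (a * s) x (t * b)) else 0.

Lemma tens_act_ev a b l :
  tens_act a b (tens_ev l) = tens_ev [seq (a * p.1.1, p.1.2, p.2 * b) | p <- l].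
Proof.
apply/funext => g; rewrite /tens_act /tens_ev; case: asboolP => // gtri.
rewrite asboolT; last exact: trilinear_mul.
by rewrite /tsum big_map.
Qed.

Lemma tens_act_in a b (u : sub_of tens_space) :
  in_subspace tens_space (tens_act a b (val u)).
Proof.
apply/asboolP; have /asboolP[l ->] := valP u.
by exists [seq (a * p.1.1, p.1.2, p.2 * b) | p <- l]; rewrite tens_act_ev.
Qed.

Definition tens_sact a b (u : sub_of tens_space) : sub_of tens_space :=
  SubOf (tens_act_in a b u).

Lemma tensE (u : sub_of tens_space) : {l | val u = tens_ev l}.
Proof. by apply: cid; exact/asboolP/(valP u). Qed.

Lemma tens_eqP (u v : sub_of tens_space) :
  (forall g, trilinear g -> val u g = val v g) -> u = v.
Proof.
move=> uv; apply: val_inj; apply/funext => g.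
have [gtri|ngtri] := pselect (trilinear g); first exact: uv.
have [l ->] := tensE u; have [l' ->] := tensE v.
by rewrite /tens_ev asboolF.
Qed.

Lemma val_tens_sact a b u g : trilinear g ->
  val (tens_sact a b u) g = val u (fun s x t => g (a * s) x (t * b)).
Proof. by move=> gtri; rewrite /= /tens_act asboolT. Qed.

Lemma val_tensDZ a (u v : sub_of tens_space) g :
  val (a *: u + v) g = a *: val u g + val v g.
Proof. by rewrite [val _]linearP. Qed.

Lemma val_tensE (u : sub_of tens_space) g :
  trilinear g -> val u g = tsum g (sval (tensE u)).
Proof. by move=> gtri; case: (tensE u) => l /= ->; rewrite /tens_ev asboolT. Qed.

Program Definition free_bimod : bimod S T :=
  @Bimod k S T (sub_of tens_space) (fun s u => tens_sact s 1 u)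
    (fun u t => tens_sact 1 t u) _ _ _ _ _ _ _ _ _.
Next Obligation.
move=> a s s' u /=; apply: tens_eqP => g gtri.
have [g1 _ _] := gtri.
rewrite val_tensDZ !val_tens_sact // !val_tensE; try exact: trilinear_mul.
by rewrite -tsumDZ; apply: eq_tsum => *; rewrite mulrDl -scalerAl g1.
Qed.
Next Obligation.
move=> a s u v /=; apply: tens_eqP => g gtri.
rewrite [RHS]val_tensDZ [LHS]val_tens_sact // [LHS]val_tensDZ.
by rewrite !val_tens_sact.
Qed.
Next Obligation.
move=> a u v t /=; apply: tens_eqP => g gtri.
rewrite [RHS]val_tensDZ [LHS]val_tens_sact // [LHS]val_tensDZ.
by rewrite !val_tens_sact.
Qed.
Next Obligation.
move=> a u t t' /=; apply: tens_eqP => g gtri.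
have [_ _ g3] := gtri.
rewrite val_tensDZ !val_tens_sact // !val_tensE; try exact: trilinear_mul.
by rewrite -tsumDZ; apply: eq_tsum => *; rewrite mulrDr -scalerAr g3.
Qed.
Next Obligation.
move=> u /=; apply: tens_eqP => g gtri; rewrite val_tens_sact //.
by congr (val u _); apply/funext => s; apply/funext => x; apply/funext => t;
  rewrite mul1r mulr1.
Qed.
Next Obligation.
move=> u /=; apply: tens_eqP => g gtri; rewrite val_tens_sact //.
by congr (val u _); apply/funext => s; apply/funext => x; apply/funext => t;
  rewrite mul1r mulr1.
Qed.
Next Obligation.
move=> s s' u /=; apply: tens_eqP => g gtri.
rewrite !val_tens_sact //; last exact: (trilinear_mul s 1 gtri).
by congr (val u _); apply/funext => s1; apply/funext => x; apply/funext => t;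
  rewrite !mulr1 mulrA.
Qed.
Next Obligation.
move=> u t t' /=; apply: tens_eqP => g gtri.
rewrite !val_tens_sact //; last exact: (trilinear_mul 1 t' gtri).
by congr (val u _); apply/funext => s1; apply/funext => x; apply/funext => t1;
  rewrite !mul1r mulrA.
Qed.
Next Obligation.
move=> s u t /=; apply: tens_eqP => g gtri.
rewrite !val_tens_sact //;
  [|exact: (trilinear_mul 1 t gtri)|exact: (trilinear_mul s 1 gtri)].
by congr (val u _); apply/funext => s1; apply/funext => x; apply/funext => t1;
  rewrite !mul1r !mulr1.
Qed.

(* Trilinear maps to an arbitrary space factor through the tensors because
   linear forms separate points. *)
Lemma tens_factor (W : lmodType k) (g : S -> X -> T -> W) : trilinear g ->
  forall (u : free_bimod) (f : W -> k^o), linear f ->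
  f (tsum g (sval (tensE u))) = val u (fun s x t => f (g s x t)).
Proof.
move=> gtri u f f_lin.
by rewrite (lin_tsum _ _ f_lin) val_tensE //; exact: trilinear_comp.
Qed.

(** The product is computed on a chosen list representing u. The choice is harmless: composed with a
    linear form, the product is the value of u at a trilinear form ([tens_factor]), and linear forms
    separate the points of X. *)
Lemma tens_mul_bihom :
  is_bihom (Y := X)
    (fun u : free_bimod => tsum (fun s x t => ract (lact s x) t) (sval (tensE u))).
Proof.
have tri := trilinear_act X.
split=> [a u v|s u|u t]; apply: functional_ext => f f_lin.
- rewrite f_lin (tens_factor tri (a *: u + v) f_lin).
  by rewrite (tens_factor tri u f_lin) (tens_factor tri v f_lin); exact: val_tensDZ.
- rewrite tens_factor // [LHS]val_tens_sact; last exact: trilinear_comp.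
  have fs : linear (fun x : X => f (lact s x)).
    exact: (linear_funcomp f_lin (@lact_lin _ _ _ X s)).
  rewrite (tens_factor tri u fs : f (lact s _) = _).
  congr (val u _); apply/funext => s1; apply/funext => x; apply/funext => t1.
  by rewrite /= mulr1 lactA lractA.
- rewrite tens_factor // [LHS]val_tens_sact; last exact: trilinear_comp.
  have ft : linear (fun x : X => f (ract x t)).
    exact: (linear_funcomp f_lin (@ract_lin _ _ _ X t)).
  rewrite (tens_factor tri u ft : f (ract _ t) = _).
  congr (val u _); apply/funext => s1; apply/funext => x; apply/funext => t1.
  by rewrite /= mul1r ractA.
Qed.

(** Projectivity lifts the identity of X through the surjection S (x) X (x) T -> X, and sigma picks
    a list for each lifted value. The lists need not be additive or equivariant; their images under
    trilinear maps are, again because linear forms separate points. *)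
Lemma projective_splitting :
  projective X -> exists sigma, @splitting X sigma.
Proof.
move=> Xproj.
pose mu : bihom free_bimod X := mk_bihom tens_mul_bihom.
have id_bihom : is_bihom (fun x : X => x) by [].
pose one : bihom X X := mk_bihom id_bihom.
have muE u : mu u = tsum (fun s x t => ract (lact s x) t) (sval (tensE u)) by [].
have mu_surj x : exists u, mu u = x.
  have Hl : in_subspace tens_space (tens_ev [:: (1, x, 1)]).
    by apply/asboolP; eexists.
  exists (SubOf Hl); apply: functional_ext => f f_lin.
  rewrite muE tens_factor //; last exact: trilinear_act.
  rewrite /= /tens_ev asboolT; last exact/trilinear_comp/trilinear_act.
  by rewrite /tsum big_cons big_nil /= lact1 ract1 addr0.
have [h hP] := Xproj _ _ mu one mu_surj.
have [h1 h2 h3] := bihomP h.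
exists (fun x => sval (tensE (h x))); split.
- move=> W g gtri a u v; apply: functional_ext => f f_lin.
  rewrite f_lin h1 (tens_factor gtri (a *: h u + h v) f_lin).
  rewrite (tens_factor gtri (h u) f_lin) (tens_factor gtri (h v) f_lin).
  exact: val_tensDZ.
- move=> W g gtri a m; apply: functional_ext => f f_lin.
  rewrite tens_factor // h2.
  have gtri' := trilinear_mul a 1 gtri.
  transitivity (f (tsum (fun s x t => g (a * s) x (t * 1)) (sval (tensE (h m))))).
    by rewrite tens_factor // [LHS]val_tens_sact //; exact: trilinear_comp.
  by congr f; apply: eq_tsum => *; rewrite mulr1.
- move=> W g gtri m b; apply: functional_ext => f f_lin.
  rewrite tens_factor // h3.
  have gtri' := trilinear_mul 1 b gtri.
  transitivity (f (tsum (fun s x t => g (1 * s) x (t * b)) (sval (tensE (h m))))).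
    by rewrite tens_factor // [LHS]val_tens_sact //; exact: trilinear_comp.
  by congr f; apply: eq_tsum => *; rewrite mul1r.
- by move=> m; rewrite -muE hP.
Qed.

End FreeBimodule.
End Splitting.

(** * Currying of balanced multilinear maps *)

Section IndexedTuples.
Variables (T : Type) (n : nat).
Implicit Types (s : T).

Definition icons s (y : 'I_n -> T) : 'I_n.+1 -> T :=
  fun i => oapp y s (unlift ord0 i).
Definition itail (x : 'I_n.+1 -> T) : 'I_n -> T := fun i => x (lift ord0 i).

Lemma icons0 s y : icons s y ord0 = s.
Proof. by rewrite /icons unlift_none. Qed.
Lemma iconsS s y i : icons s y (lift ord0 i) = y i.
Proof. by rewrite /icons liftK. Qed.
Lemma itail_icons s y : itail (icons s y) = y.
Proof. by apply/funext => i; rewrite /itail iconsS. Qed.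
Lemma icons_eta x : icons (x ord0) (itail x) = x.
Proof.
apply/funext => i; case: (unliftP ord0 i) => [j ->|->]; last exact: icons0.
exact: iconsS.
Qed.
Lemma upd_icons0 s y u : upd (icons s y) ord0 u = icons u y.
Proof.
apply/funext => i; rewrite /upd; case: (unliftP ord0 i) => [j ->|->].
  by rewrite !iconsS.
by rewrite eqxx icons0.
Qed.
Lemma upd_iconsS s y i u :
  upd (icons s y) (lift ord0 i) u = icons s (upd y i u).
Proof.
apply/funext => j; rewrite /upd; case: (unliftP ord0 j) => [h ->|->].
  by rewrite !iconsS (inj_eq lift_inj).
by rewrite !icons0 (negPf (neq_lift _ _)).
Qed.
End IndexedTuples.

Lemma upd_id (T : Type) n (x : 'I_n -> T) i : upd x i (x i) = x.
Proof. by apply/funext => j; rewrite /upd; case: eqP => [->|]. Qed.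

Lemma ituple0 (T : Type) (x y : 'I_0 -> T) : x = y.
Proof. by apply/funext => -[]. Qed.

Lemma icons_comp (T U : Type) n (g : T -> U) s (y : 'I_n -> T) :
  (fun i => g (icons s y i)) = icons (g s) (fun i => g (y i)).
Proof.
apply/funext => i; case: (unliftP ord0 i) => [j ->|->].
  by rewrite !iconsS.
by rewrite !icons0.
Qed.

Lemma upd_comp (T U : Type) n (g : T -> U) (x : 'I_n -> T) i u :
  (fun j => g (upd x i u j)) = upd (fun j => g (x j)) i (g u).
Proof. by apply/funext => j; rewrite /upd; case: ifP. Qed.

Section Tenshom.
Variables (k : fieldType) (S : algType k).

Definition mk_tenshom (X Y : bimod S S) n (f : ('I_n -> X) -> Y)
    (fP : is_tenshom f) : tenshom X Y n :=
  @SubOf _ _ (tenshom_space X Y n) f (in_subspaceT (S := tenshom_space X Y n) fP).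

Lemma tenshomP (X Y : bimod S S) n (f : tenshom X Y n) : is_tenshom f.
Proof. exact: (elimT (asboolP _) (valP f)). Qed.

Lemma tenshom_ext (X Y : bimod S S) n (f g : tenshom X Y n) :
  (forall x, f x = g x) -> f = g.
Proof. by move=> fg; apply/val_inj/funext. Qed.

Lemma tenshom_comp (X X' Y Y' : bimod S S) n (p : X' -> X) (g : Y -> Y')
    (f : ('I_n -> X) -> Y) :
  is_bihom p -> is_bihom g -> is_tenshom f ->
  is_tenshom (fun x : 'I_n -> X' => g (f (fun i => p (x i)))).
Proof.
move=> [p1 p2 p3] [g1 g2 g3] [f1 f2 f3 f4 f5]; split.
- by move=> x i a u v; rewrite !upd_comp p1 f1 g1.
- by move=> x i j s ij; rewrite !upd_comp p2 p3 (f2 _ _ j).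
- by move=> x i s i0; rewrite upd_comp p2 f3 // g2.
- by move=> x i s i0; rewrite upd_comp p3 f4 // g3.
- by move=> n0 x s; rewrite -g2 -g3 f5.
Qed.

Lemma bihom_id (X : bimod S S) : is_bihom (fun x : X => x).
Proof. by []. Qed.

Definition post (X Y Y' : bimod S S) n (g : Y -> Y') (gP : is_bihom g)
    (f : tenshom X Y n) : tenshom X Y' n :=
  mk_tenshom (tenshom_comp (bihom_id X) gP (tenshomP f)).

Lemma post_lin (X Y Y' : bimod S S) n (g : Y -> Y') (gP : is_bihom g) :
  linear (@post X Y Y' n g gP).
Proof.
by have [g1 _ _] := gP; move=> a u v; apply: tenshom_ext => x; exact: g1.
Qed.

Definition left_linear (T U : algType k) (X : bimod S T) (Y : bimod S U)
    (f : X -> Y) : Prop :=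
  linear f /\ forall s x, f (lact s x) = lact s (f x).

(* Z is the bimodule of left linear maps X -> Y: left multiplications on Z
   come from the right multiplications on X. *)
Record hom_spec (X Y Z : bimod S S) := HomSpec {
  hev : Z -> X -> Y;
  hmk : forall f : X -> Y, left_linear f -> Z;
  hmkE : forall f (fl : left_linear f) x, hev (hmk fl) x = f x;
  hev_inj : forall F G, (forall x, hev F x = hev G x) -> F = G;
  hev_linl : forall x, linear (hev^~ x);
  hev_left : forall F, left_linear (hev F);
  hev_lact : forall s F x, hev (lact s F) x = hev F (ract x s);
  hev_ract : forall s F x, hev (ract F s) x = ract (hev F x) s
}.

Section Curry.
Variables (X Y Z : bimod S S) (H : hom_spec X Y Z) (n : nat).

(** Balancing between the arguments 0 and 1 is left linearity of f in its first argument, because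
    the left action on Z is the right action on the argument in X. For n = 0 the centrality clause
    takes over and gives right linearity in the only argument. *)
Lemma tuncurry_tenshom (f : ('I_n -> X) -> Z) : is_tenshom f ->
  is_tenshom (fun x => hev H (f (itail x)) (x ord0)).
Proof.
move=> [f1 f2 f3 f4 f5]; split.
- move=> x i a u v; rewrite -(icons_eta x).
  case: (unliftP ord0 i) => [j ->|->].
    by rewrite !upd_iconsS !itail_icons !icons0 f1 hev_linl.
  by rewrite !upd_icons0 !itail_icons !icons0 (hev_left H _).1.
- move=> x i j s; rewrite -(icons_eta x).
  case: (unliftP ord0 i) => [i' ->|->]; case: (unliftP ord0 j) => [j' ->|->] //.
    rewrite !lift0 => -[ij]; rewrite !upd_iconsS !iconsS !itail_icons !icons0.
    by rewrite (f2 _ _ j').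
  rewrite lift0 => -[j0]; rewrite upd_icons0 upd_iconsS !itail_icons !icons0.
  by rewrite iconsS -hev_lact f3 // -j0.
- move=> x i s i0; rewrite (_ : i = ord0); last exact: val_inj.
  rewrite -(icons_eta x) upd_icons0 !itail_icons !icons0.
  exact: (hev_left H _).2.
- move=> x i s; rewrite -(icons_eta x).
  case: (unliftP ord0 i) => [i' ->|->].
    rewrite lift0 => -[ii]; rewrite upd_iconsS !itail_icons !icons0 !iconsS.
    by rewrite f4 // hev_ract.
  move=> -[n0]; rewrite upd_icons0 !itail_icons !icons0.
  by rewrite -hev_ract -f5 // hev_lact.
- by [].
Qed.

Definition tuncurry (f : tenshom X Z n) : tenshom X Y n.+1 :=
  mk_tenshom (tuncurry_tenshom (tenshomP f)).

Lemma tuncurryE (f : tenshom X Z n) x y : tuncurry f (icons x y) = hev H (f y) x.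
Proof.
by rewrite -[LHS]/(hev H (f (itail (icons x y))) _) itail_icons icons0.
Qed.

Lemma tcurry_left (f : tenshom X Y n.+1) y :
  left_linear (fun x => f (icons x y)).
Proof.
have [f1 _ f3 _ _] := tenshomP f; split=> [a u v|s x].
  by have := f1 (icons 0 y) ord0 a u v; rewrite !upd_icons0.
by have := f3 (icons x y) ord0 s erefl; rewrite upd_icons0 icons0.
Qed.

Lemma tcurry_tenshom (f : tenshom X Y n.+1) :
  is_tenshom (fun y => hmk H (tcurry_left f y)).
Proof.
have [f1 f2 f3 f4 f5] := tenshomP f; split.
- move=> x i a u v; apply: (hev_inj (h := H)) => z.
  by rewrite hev_linl !hmkE -!upd_iconsS f1.
- move=> x i j s ij; apply: (hev_inj (h := H)) => z; rewrite !hmkE -!upd_iconsS.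
  by have := f2 (icons z x) (lift ord0 i) (lift ord0 j) s; rewrite !iconsS => -> //;
    rewrite !lift0 ij.
- move=> x i s i0; apply: (hev_inj (h := H)) => z.
  rewrite hev_lact !hmkE -!upd_iconsS.
  have := f2 (icons z x) ord0 (lift ord0 i) s; rewrite !iconsS icons0 => <- //.
    by rewrite upd_icons0.
  by rewrite lift0 i0.
- move=> x i s ni; apply: (hev_inj (h := H)) => z.
  rewrite hev_ract !hmkE -!upd_iconsS.
  by rewrite -(f4 _ (lift ord0 i)) ?iconsS // lift0 ni.
- move=> n0 x s; apply: (hev_inj (h := H)) => z.
  rewrite hev_ract hev_lact !hmkE.
  by have := f4 (icons z x) ord0 s; rewrite upd_icons0 icons0 => -> //; rewrite n0.
Qed.

Definition tcurry (f : tenshom X Y n.+1) : tenshom X Z n :=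
  mk_tenshom (tcurry_tenshom f).

Lemma tcurryE (f : tenshom X Y n.+1) x y : hev H (tcurry f y) x = f (icons x y).
Proof. exact: hmkE. Qed.

Lemma tuncurryK : cancel tuncurry tcurry.
Proof.
move=> f; apply: tenshom_ext => y; apply: (hev_inj (h := H)) => x.
by rewrite tcurryE tuncurryE.
Qed.
Lemma tcurryK : cancel tcurry tuncurry.
Proof.
move=> f; apply: tenshom_ext => x; rewrite -(icons_eta x).
by rewrite tuncurryE tcurryE.
Qed.

Lemma tcurry_lin : linear tcurry.
Proof.
move=> a f g; apply: tenshom_ext => y; apply: (hev_inj (h := H)) => x.
by rewrite tcurryE [RHS](hev_linl H x) !tcurryE.
Qed.
Lemma tuncurry_lin : linear tuncurry.
Proof.
move=> a f g; apply: tenshom_ext => x; rewrite -(icons_eta x).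
by rewrite tuncurryE [LHS](hev_linl H _) -!tuncurryE.
Qed.
End Curry.
End Tenshom.

(** * Bimodules of left linear maps *)

Section InternalHom.
Variables (k : fieldType) (R S T : algType k) (X : bimod R S) (Y : bimod R T).

Lemma left_linear0 : left_linear (0 : X -> Y).
Proof. by split=> [a u v|s x] /=; rewrite ?scaler0 ?addr0 ?lact0r. Qed.
Lemma left_linearDZ (a : k) (f g : X -> Y) :
  left_linear f -> left_linear g -> left_linear (a *: f + g).
Proof.
have E z : (a *: f + g) z = a *: f z + g z by [].
move=> [f1 f2] [g1 g2]; split=> [b u v|s x]; rewrite !E.
  by rewrite f1 g1 !scalerDr !scalerA [a * _]mulrC addrACA.
by rewrite f2 g2 lactDr.
Qed.
Definition left_linear_space : subspace (X -> Y) :=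
  Subspace left_linear0 left_linearDZ.

Definition lhom_car := sub_of left_linear_space.
HB.instance Definition _ := GRing.Lmodule.on lhom_car.
Definition lhom_fun (F : lhom_car) : X -> Y := sub_val F.
Definition mk_lhom (f : X -> Y) (fP : left_linear f) : lhom_car :=
  @SubOf _ _ left_linear_space f (in_subspaceT (S := left_linear_space) fP).

Lemma lhomP F : left_linear (lhom_fun F).
Proof. exact: (elimT (asboolP _) (valP F)). Qed.
Lemma lhom_ext F G : (forall x, lhom_fun F x = lhom_fun G x) -> F = G.
Proof. by move=> FG; apply/val_inj/funext. Qed.
Lemma lhom_funDZ (a : k) F G x :
  lhom_fun (a *: F + G) x = a *: lhom_fun F x + lhom_fun G x.
Proof. by []. Qed.

Lemma lhom_lact_subproof s F : left_linear (fun x => lhom_fun F (ract x s)).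
Proof.
have [F1 F2] := lhomP F; split=> [a u v|r x]; first by rewrite ractDl F1.
by rewrite -lractA F2.
Qed.
Lemma lhom_ract_subproof F t : left_linear (fun x => ract (lhom_fun F x) t).
Proof.
have [F1 F2] := lhomP F; split=> [a u v|r x]; first by rewrite F1 ractDl.
by rewrite F2 lractA.
Qed.

Program Definition lhom : bimod S T :=
  @Bimod k S T lhom_car (fun s F => mk_lhom (lhom_lact_subproof s F))
    (fun F t => mk_lhom (lhom_ract_subproof F t)) _ _ _ _ _ _ _ _ _.
Next Obligation.
by move=> a s s' F; apply: lhom_ext => x /=; rewrite ractDr (lhomP F).1.
Qed.
Next Obligation. by move=> a s F G; apply: lhom_ext. Qed.
Next Obligation.
move=> a F G t; apply: lhom_ext => x.
by rewrite lhom_funDZ /= -ractDl.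
Qed.
Next Obligation.
by move=> a F t t'; apply: lhom_ext => x; rewrite lhom_funDZ /= -ractDr.
Qed.
Next Obligation. by move=> F; apply: lhom_ext => x /=; rewrite ract1. Qed.
Next Obligation. by move=> F; apply: lhom_ext => x /=; rewrite ract1. Qed.
Next Obligation. by move=> s s' F; apply: lhom_ext => x /=; rewrite ractA. Qed.
Next Obligation. by move=> F t t'; apply: lhom_ext => x /=; rewrite ractA. Qed.
Next Obligation. by move=> s F t; apply: lhom_ext. Qed.

Lemma lhom_lactE s (F : lhom) x : lhom_fun (lact s F) x = lhom_fun F (ract x s).
Proof. by []. Qed.
Lemma lhom_ractE (F : lhom) t x : lhom_fun (ract F t) x = ract (lhom_fun F x) t.
Proof. by []. Qed.
End InternalHom.

Definition lhom_spec (k : fieldType) (S : algType k) (X Y : bimod S S) :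
    hom_spec X Y (lhom X Y) :=
  @HomSpec k S X Y (lhom X Y) (@lhom_fun k S S S X Y)
    (@mk_lhom k S S S X Y) (fun f fl x => erefl)
    (@lhom_ext k S S S X Y) (fun x a F G => erefl) (@lhomP k S S S X Y)
    (fun s F x => erefl) (fun s F x => erefl).

(** * Relative Hochschild cochains *)

Section Merge.
Variables (S : pzRingType) (n : nat).
Implicit Types (s : S) (y : 'I_n.+1 -> S).

Definition iinit (T : Type) m (x : 'I_m.+1 -> T) : 'I_m -> T :=
  fun j => x (widen_ord (leqnSn m) j).

Lemma iinit_icons s y : iinit (icons s y) = icons s (iinit y).
Proof.
apply/funext => i; rewrite /iinit; case: (unliftP ord0 i) => [j ->|->].
  rewrite iconsS (_ : widen_ord _ _ = lift ord0 (widen_ord (leqnSn n) j));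
    last exact: val_inj.
  by rewrite iconsS.
by rewrite icons0 (_ : widen_ord _ _ = ord0) ?icons0 //; exact: val_inj.
Qed.

Lemma icons_max s y : icons s y ord_max = y ord_max.
Proof.
by rewrite (_ : ord_max = lift ord0 ord_max) ?iconsS //; exact: val_inj.
Qed.

Lemma merge_at_icons0 s y :
  merge_at (icons s y) ord0 = icons (s * y ord0) (itail y).
Proof.
apply/funext => j; rewrite /merge_at; case: (unliftP ord0 j) => [i ->|->].
  by rewrite /= !iconsS.
rewrite /= (_ : widen_ord _ _ = ord0); last exact: val_inj.
by rewrite !icons0 iconsS.
Qed.

Lemma merge_at_iconsS s y (i : 'I_n) :
  merge_at (icons s y) (lift ord0 i) = icons s (merge_at y i).
Proof.
apply/funext => j; rewrite /merge_at; case: (unliftP ord0 j) => [h ->|->].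
  rewrite !iconsS (inj_eq lift_inj) !lift0 ltnS.
  rewrite (_ : widen_ord _ _ = lift ord0 (widen_ord (leqnSn n) h));
    last exact: val_inj.
  by rewrite iconsS.
rewrite icons0 lift0 /= (_ : widen_ord _ _ = ord0) ?icons0 //; exact: val_inj.
Qed.
End Merge.

Section RightCoboundary.
Variable k : fieldType.

(* The part of the Hochschild coboundary that does not involve the left action,
   up to sign. *)
Definition rcobound (S T : algType k) (Y : bimod T S) n (f : ('I_n -> S) -> Y) :
    ('I_n.+1 -> S) -> Y := fun x =>
  \sum_(i < n) (-1) ^+ i *: f (merge_at x i)
  + (-1) ^+ n *: ract (f (iinit x)) (x ord_max).

Lemma hcoboundE (S : algType k) (Y : bimod S S) n (f : ('I_n -> S) -> Y) x :
  hcobound f x = lact (x ord0) (f (itail x)) - rcobound f x.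
Proof.
rewrite /hcobound /rcobound -addrA opprD; congr (_ + (_ + _)).
  by rewrite -sumrN; apply: eq_bigr => i _; rewrite exprS mulN1r scaleNr.
by rewrite exprS mulN1r scaleNr.
Qed.

Lemma rcobound0 (S T : algType k) (Y : bimod T S) (f : ('I_0 -> S) -> Y) x :
  rcobound f x = ract (f (itail x)) (x ord0).
Proof.
rewrite /rcobound big_ord0 add0r expr0 scale1r (ituple0 (iinit x) (itail x)).
by congr (ract _ (x _)); exact: val_inj.
Qed.

(** With the first argument frozen, only the merge of the first two arguments is new. Every other
    term keeps its shape with its position shifted by one, hence the change of sign. *)
Lemma rcoboundS (S T : algType k) (Y : bimod T S) n (f : ('I_n.+1 -> S) -> Y)
    s (y : 'I_n.+1 -> S) :
  rcobound f (icons s y) =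
  f (icons (s * y ord0) (itail y)) - rcobound (fun z => f (icons s z)) y.
Proof.
rewrite /rcobound big_ord_recl expr0 scale1r merge_at_icons0 -addrA opprD.
congr (_ + (_ + _)).
  rewrite -sumrN; apply: eq_bigr => i _.
  by rewrite merge_at_iconsS lift0 exprS mulN1r scaleNr.
by rewrite iinit_icons icons_max exprS mulN1r scaleNr.
Qed.

Section Naturality.
Variables (S S' T T' : algType k) (p : S' -> S).
Hypothesis pM : forall x y, p (x * y) = p x * p y.

Lemma merge_at_comp n (x : 'I_n.+1 -> S') i :
  (fun j => p (merge_at x i j)) = merge_at (fun j => p (x j)) i.
Proof.
by apply/funext => j; rewrite /merge_at; case: ifP => // _; case: ifP.
Qed.

Lemma rcobound_comp (Y : bimod T S) (Y' : bimod T' S') (g : Y -> Y') n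
    (f : ('I_n -> S) -> Y) x :
  linear g -> (forall y s, g (ract y (p s)) = ract (g y) s) ->
  rcobound (fun z => g (f (fun i => p (z i)))) x
  = g (rcobound f (fun i => p (x i))).
Proof.
move=> g_lin gr; rewrite /rcobound (linD g_lin) (lin_sum g_lin) (linZ g_lin).
congr (_ + _ *: _); last by rewrite -gr.
by apply: eq_bigr => i _; rewrite (linZ g_lin) merge_at_comp.
Qed.
End Naturality.

Lemma hcobound_comp (S S' : algType k) (p : S' -> S) (Y : bimod S S)
    (Y' : bimod S' S') (g : Y -> Y') n (f : ('I_n -> S) -> Y) x :
  (forall x y, p (x * y) = p x * p y) ->
  linear g -> (forall y s, g (ract y (p s)) = ract (g y) s) ->
  (forall y s, g (lact (p s) y) = lact s (g y)) ->
  hcobound (fun z => g (f (fun i => p (z i)))) x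
  = g (hcobound f (fun i => p (x i))).
Proof.
move=> pM g_lin gr gl.
by rewrite !hcoboundE (linB g_lin) (rcobound_comp _ _ _ g_lin gr) // -gl.
Qed.

Lemma rcoboundDZ (S T : algType k) (Y : bimod T S) n a
    (f g : ('I_n -> S) -> Y) x :
  rcobound (a *: f + g) x = a *: rcobound f x + rcobound g x.
Proof.
rewrite /rcobound scalerDr addrACA; congr (_ + _).
  rewrite scaler_sumr -big_split; apply: eq_bigr => i _ /=.
  by rewrite -[X in _ *: X]/(a *: f _ + g _) scalerDr !scalerA mulrC.
by rewrite -[X in ract X]/(a *: f _ + g _) ractDl scalerDr !scalerA mulrC.
Qed.

Lemma hcoboundDZ (S : algType k) (Y : bimod S S) n a
    (f g : ('I_n -> S) -> Y) x :
  hcobound (a *: f + g) x = a *: hcobound f x + hcobound g x.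
Proof.
rewrite !hcoboundE rcoboundDZ -[X in lact _ X]/(a *: f _ + g _) lactDr.
by rewrite scalerBr opprD addrACA.
Qed.
End RightCoboundary.

Section RestrictLeft.
Variables (k : fieldType) (R S T : algType k) (eta : {lrmorphism R -> S}).

Program Definition lrestr (X : bimod S T) : bimod R T :=
  @Bimod k R T X (fun r x => lact (eta r) x) (fun x t => ract x t)
    _ _ _ _ _ _ _ _ _.
Next Obligation. by move=> X a r r' x /=; rewrite linearP lactDl. Qed.
Next Obligation. by move=> X a r x y /=; rewrite lactDr. Qed.
Next Obligation. by move=> X a x y r /=; rewrite ractDl. Qed.
Next Obligation. by move=> X a x r r' /=; rewrite ractDr. Qed.
Next Obligation. by move=> X x /=; rewrite rmorph1 lact1. Qed.
Next Obligation. by move=> X x /=; rewrite ract1. Qed.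
Next Obligation. by move=> X r r' x /=; rewrite rmorphM lactA. Qed.
Next Obligation. by move=> X x r r' /=; rewrite ractA. Qed.
Next Obligation. by move=> X r x r' /=; rewrite lractA. Qed.
End RestrictLeft.

Lemma restr_bihom (k : fieldType) (R S : algType k) (eta : {lrmorphism R -> S})
    (X Y : bimod S S) (g : X -> Y) :
  is_bihom g -> is_bihom (X := restr eta X) (Y := restr eta Y) g.
Proof. by move=> [g1 g2 g3]; split=> *; [exact: g1|exact: g2|exact: g3]. Qed.

Lemma bihom_linear (k : fieldType) (S T : algType k) (X Y : bimod S T)
  (g : X -> Y) : is_bihom g -> linear g.
Proof. by case. Qed.

(** * Coinduced bimodules *)

Section Coinduced.
Variables (k : fieldType) (R S : algType k) (eta : {lrmorphism R -> S}).

(** This is Hom_R(S, Y). The left action of S is by right translation of the argument and only the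
    right action comes from Y; the left action of S on Y enters through the embedding [co_unit], of
    which [co_ev1] is a retraction as R-bimodules. *)
Definition coind (Y : bimod S S) : bimod S S :=
  lhom (lrestr eta (regbimod S)) (lrestr eta Y).

Definition coval (Y : bimod S S) (F : coind Y) : S -> Y := lhom_fun F.

Lemma coind_ext (Y : bimod S S) (F G : coind Y) :
  (forall s, coval F s = coval G s) -> F = G.
Proof. exact: (@lhom_ext _ _ _ _ (lrestr eta (regbimod S)) (lrestr eta Y)). Qed.

Lemma coval_lact (Y : bimod S S) (F : coind Y) t s :
  coval (lact t F) s = coval F (s * t).
Proof. by []. Qed.
Lemma coval_ract (Y : bimod S S) (F : coind Y) t s :
  coval (ract F t) s = ract (coval F s) t.
Proof. by []. Qed.
Lemma coval_lin (Y : bimod S S) (F : coind Y) : linear (coval F).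
Proof. exact: (lhomP F).1. Qed.
Lemma coval_linl (Y : bimod S S) s : linear (fun F : coind Y => coval F s).
Proof. by []. Qed.
Lemma coval_left (Y : bimod S S) (F : coind Y) r s :
  coval F (eta r * s) = lact (eta r) (coval F s).
Proof. exact: (lhomP F).2. Qed.

Definition coind_spec (Y : bimod S S) :
    hom_spec (restr eta (regbimod S)) (restr eta Y) (restr eta (coind Y)) :=
  @HomSpec k R (restr eta (regbimod S)) (restr eta Y) (restr eta (coind Y))
    (@coval Y) (@mk_lhom _ _ _ _ (lrestr eta (regbimod S)) (lrestr eta Y))
    (fun f fl x => erefl)
    (@lhom_ext _ _ _ _ (lrestr eta (regbimod S)) (lrestr eta Y))
    (fun x a F G => erefl)
    (@lhomP _ _ _ _ (lrestr eta (regbimod S)) (lrestr eta Y))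
    (fun s F x => erefl) (fun s F x => erefl).

Section Maps.
Variable Y : bimod S S.

Lemma unit_subproof (y : Y) :
  left_linear (X := lrestr eta (regbimod S)) (Y := lrestr eta Y)
    (fun s => lact (s : S) y).
Proof.
by split=> [a s t|r s]; [exact: (lactDl a s t y)|exact: (lactA (eta r) s y)].
Qed.
Definition co_unit (y : Y) : coind Y := mk_lhom (unit_subproof y).
Lemma co_unitE y s : coval (co_unit y) s = lact s y. Proof. by []. Qed.

Lemma co_unit_bihom : is_bihom co_unit.
Proof.
split=> [a x y|s x|x t]; apply: coind_ext => z.
- by rewrite [RHS](coval_linl z) !co_unitE lactDr.
- by rewrite coval_lact !co_unitE lactA.
- by rewrite coval_ract !co_unitE lractA.
Qed.

Definition co_ev1 (F : coind Y) : Y := coval F 1.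
Lemma co_ev1_bihom :
  is_bihom (X := restr eta (coind Y)) (Y := restr eta Y) co_ev1.
Proof.
split=> // s F; rewrite /co_ev1 [LHS](coval_lact F).
by rewrite mul1r -[eta s]mulr1 coval_left.
Qed.
Lemma co_ev1_unit y : co_ev1 (co_unit y) = y.
Proof. by rewrite /co_ev1 co_unitE lact1. Qed.
End Maps.

Section Functor.
Variables (Y Z : bimod S S) (g : Y -> Z) (gP : is_bihom g).
Lemma co_map_subproof (F : coind Y) :
  left_linear (X := lrestr eta (regbimod S)) (Y := lrestr eta Z)
    (fun s => g (coval F s)).
Proof.
have [g1 g2 _] := gP; split=> [a s t|r s].
  by rewrite coval_lin g1.
by rewrite coval_left [LHS]g2.
Qed.
Definition co_map (F : coind Y) : coind Z := mk_lhom (co_map_subproof F).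
Lemma co_mapE F s : coval (co_map F) s = g (coval F s). Proof. by []. Qed.
Lemma co_map_bihom : is_bihom co_map.
Proof.
have [g1 g2 g3] := gP.
split=> [a F G|s F|F t]; apply: coind_ext => z //.
  by rewrite [RHS](coval_linl z) !co_mapE -g1.
by rewrite coval_ract !co_mapE -g3.
Qed.
End Functor.
End Coinduced.

Section Cochains.
Variables (k : fieldType) (R S : algType k) (eta : {lrmorphism R -> S}).
Local Notation CC Y n := (relcochain eta Y n).
Implicit Types (Y Z : bimod S S) (n : nat).

Definition cur Y n (f : CC Y n.+1) : CC (coind eta Y) n := tcurry (coind_spec eta Y) f.
Lemma curE Y n (f : CC Y n.+1) s y : coval (cur f y) s = f (icons s y).
Proof. exact: (tcurryE (coind_spec eta Y) f). Qed.

Lemma cur_inj Y n : injective (@cur Y n).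
Proof. exact: (can_inj (tcurryK (coind_spec eta Y) (n := n))). Qed.

Lemma cur_lin Y n : linear (@cur Y n).
Proof. exact: tcurry_lin. Qed.

Definition postS Y Z n (g : Y -> Z) (gP : is_bihom g) (f : CC Y n) : CC Z n :=
  post (restr_bihom eta gP) f.
Lemma postSE Y Z n (g : Y -> Z) (gP : is_bihom g) (f : CC Y n) x :
  postS gP f x = g (f x).
Proof. by []. Qed.

Lemma postS_lin Y Z n (g : Y -> Z) (gP : is_bihom g) : linear (@postS Y Z n g gP).
Proof.
by move=> a u v; apply: tenshom_ext => x; rewrite postSE (bihom_linear gP).
Qed.

Definition ev1_post Y n (f : CC (coind eta Y) n) : CC Y n :=
  post (co_ev1_bihom eta Y) f.
Lemma ev1_postE Y n (f : CC (coind eta Y) n) x : ev1_post f x = coval (f x) 1.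
Proof. by []. Qed.
Lemma ev1_post_lin Y n : linear (@ev1_post Y n).
Proof. exact: post_lin. Qed.

Definition unit_post Y n (f : CC Y n) : CC (coind eta Y) n :=
  postS (co_unit_bihom eta Y) f.
Lemma ev1_unit_post Y n (f : CC Y n) : ev1_post (unit_post f) = f.
Proof. by apply: tenshom_ext => x; exact: (co_ev1_unit eta (f x)). Qed.

Lemma cur_postS Y Z n (g : Y -> Z) (gP : is_bihom g) (f : CC Y n.+1) :
  cur (postS gP f) = postS (co_map_bihom eta gP) (cur f).
Proof.
apply: tenshom_ext => y; apply: coind_ext => s.
by rewrite curE [RHS]co_mapE curE.
Qed.

Section RightMultiplication.
Variables (Y : bimod S S) (c : CC Y 0).

(** The degree 0 clause of [is_tenshom] says that c commutes with R, which makes s -> c s left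
    R-linear. This map replaces [dlt (cur c)], undefined in degree 0, in the curried coboundary. *)
Lemma rmul_subproof (x : 'I_0 -> S) :
  left_linear (X := lrestr eta (regbimod S)) (Y := lrestr eta Y)
    (fun s => ract (c x : Y) s).
Proof.
have [_ _ _ _ c5] := tenshomP c; split=> [a s t|r s]; first exact: ractDr.
have cr : ract (c x : Y) (eta r) = lact (eta r) (c x : Y) by rewrite [RHS]c5.
by rewrite -[RHS]/(lact (eta r) (ract (c x : Y) _)) lractA -cr -ractA.
Qed.
Definition rmul_fun (x : 'I_0 -> S) : coind eta Y := mk_lhom (rmul_subproof x).
Lemma rmul_tenshom :
  is_tenshom (X := restr eta (regbimod S)) (Y := restr eta (coind eta Y)) rmul_fun.
Proof.
split=> [x []//|x []//|x []//|x []//|_ x s].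
apply: (coind_ext (eta := eta)) => t; rewrite [LHS]coval_lact [RHS]coval_ract.
exact: ractA.
Qed.
Definition rmul : CC (coind eta Y) 0 := mk_tenshom rmul_tenshom.
Lemma rmulE x s : coval (rmul x) s = ract (c x : Y) s. Proof. by []. Qed.
End RightMultiplication.

(** The merge of the first two arguments becomes the left action on the coinduced bimodule, a right
    translation by the first entry of y; the other terms change sign by [rcoboundS]. *)
Lemma hcobound_cur Y n (f : CC Y n.+1) s y :
  hcobound (Y := Y) f (icons s y)
  = lact s (f y) - coval (hcobound (Y := coind eta Y) (cur f) y) s.
Proof.
rewrite hcoboundE icons0 itail_icons; congr (_ - _).
rewrite hcoboundE (linB (coval_linl (Y := Y) s)) coval_lact curE rcoboundS.
congr (_ - _).
have E := @rcobound_comp _ S S S S id (fun _ _ => erefl) (coind eta Y) Y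
  (fun F => coval F s) n (cur f) y (coval_linl s) (fun _ _ => erefl).
apply: etrans E; congr (rcobound _ y).
Qed.

(** No balancing condition is checked on merged tuples: the coboundary is the uncurrying of a
    difference of two balanced maps, the second one by induction with coefficients in the coinduced
    bimodule. *)
Lemma dlt_subproof n : forall Y (f : CC Y n),
  is_tenshom (X := restr eta (regbimod S)) (Y := restr eta Y)
    (hcobound (Y := Y) f).
Proof.
elim: n => [|n IHn] Y f.
  have := tuncurry_tenshom (coind_spec eta Y) (tenshomP (unit_post f - rmul f)).
  congr is_tenshom; apply/funext => x.
  by rewrite /= hcoboundE rcobound0.
have := tuncurry_tenshom (coind_spec eta Y)
  (tenshomP (unit_post f - mk_tenshom (IHn _ (cur f)))).
congr is_tenshom; apply/funext => x.
by rewrite -[in RHS](icons_eta x) hcobound_cur.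
Qed.

Definition dlt Y n (f : CC Y n) : CC Y n.+1 := mk_tenshom (dlt_subproof f).
Lemma dltE Y n (f : CC Y n) x : dlt f x = hcobound (Y := Y) f x.
Proof. by []. Qed.

Lemma dlt_lin Y n : linear (@dlt Y n).
Proof.
move=> a f g; apply: tenshom_ext => x.
exact: (@hcoboundDZ _ S Y n a (f : CC Y n) (g : CC Y n) x).
Qed.

Lemma cur_dlt Y n (f : CC Y n.+1) :
  cur (dlt f) = unit_post f - dlt (cur f).
Proof.
apply: tenshom_ext => y; apply: (coind_ext (eta := eta)) => s.
by rewrite curE dltE hcobound_cur.
Qed.

Lemma cur_dlt0 Y (f : CC Y 0) : cur (dlt f) = unit_post f - rmul f.
Proof.
apply: tenshom_ext => y; apply: (coind_ext (eta := eta)) => s.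
by rewrite curE dltE hcoboundE rcobound0 icons0 itail_icons.
Qed.

Lemma dlt_postS Y Z n (g : Y -> Z) (gP : is_bihom g) (f : CC Y n) :
  dlt (postS gP f) = postS gP (dlt f).
Proof.
have [g1 g2 g3] := gP; apply: tenshom_ext => x.
by rewrite postSE !dltE -(hcobound_comp (p := id)).
Qed.

(** Currying turns [dlt (dlt f)] into [dlt (dlt (cur f))], the two terms with the unit cancelling.
    The descent ends with [rmul f], which is central in the coinduced bimodule and hence a
    cocycle. *)
Lemma dlt_dlt Y n (f : CC Y n) : dlt (dlt f) = 0.
Proof.
apply: cur_inj; rewrite (lin0 (@cur_lin _ _)) cur_dlt.
elim: n Y f => [|n IHn] Y f.
  rewrite cur_dlt0 (linB (@dlt_lin _ _)) dlt_postS opprB addrC addrNK.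
  apply: tenshom_ext => x; rewrite dltE hcoboundE rcobound0.
  apply: (coind_ext (eta := eta)) => s; rewrite (linB (coval_linl s)).
  by rewrite coval_lact coval_ract !rmulE ractA subrr.
rewrite cur_dlt (linB (@dlt_lin _ _)) dlt_postS opprB addrC addrNK.
by apply: cur_inj; rewrite cur_dlt IHn (lin0 (@cur_lin _ _)).
Qed.
End Cochains.

(** * Comparison with Ext *)

Section Average.
Variables (k : fieldType) (S T : algType k) (X : bimod S T).
Variable sigma : X -> seq (S * X * T).
Hypothesis sigmaP : splitting sigma.

(** A linear map on a bimodule with a splitting becomes a bimodule map, while maps that are already
    bilinear are unchanged. Linear choices of preimages thus turn into bilinear ones. *)
Definition avg (Y : bimod S T) (q : X -> Y) (x : X) : Y :=
  tsum (fun s z t => ract (lact s (q z)) t) (sigma x).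

Lemma trilinear_avg (Y : bimod S T) (q : X -> Y) : linear q ->
  trilinear (fun s z t => ract (lact s (q z)) t).
Proof.
move=> q_lin; split=> [x t|s t|s x] a u v.
- by rewrite lactDl ractDl.
- by rewrite q_lin lactDr ractDl.
- by rewrite ractDr.
Qed.

Lemma avg_bihom (Y : bimod S T) (q : X -> Y) : linear q -> is_bihom (avg q).
Proof.
move=> q_lin; have tri := trilinear_avg q_lin; split.
- exact: (split_lin sigmaP tri).
- move=> a x; rewrite /avg (split_lact sigmaP tri).
  rewrite (lin_tsum _ _ (@lact_lin _ _ _ Y a)); apply: eq_tsum => s z t.
  by rewrite lactA lractA.
- move=> x b; rewrite /avg (split_ract sigmaP tri).
  rewrite (lin_tsum _ _ (@ract_lin _ _ _ Y b)); apply: eq_tsum => s z t.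
  by rewrite ractA.
Qed.

Lemma avg_comp (Y Z : bimod S T) (g : Y -> Z) (q : X -> Y) x :
  is_bihom g -> avg (fun z => g (q z)) x = g (avg q x).
Proof.
move=> [g1 g2 g3]; rewrite /avg (lin_tsum _ _ g1).
by apply: eq_tsum => s z t; rewrite g3 g2.
Qed.

Lemma avg_id (Y : bimod S T) (q : X -> Y) x : is_bihom q -> avg q x = q x.
Proof. by move=> qP; rewrite (avg_comp id) // /avg (split_id sigmaP). Qed.

Lemma eq_avg (Y : bimod S T) (q r : X -> Y) x :
  (forall z, q z = r z) -> avg q x = avg r x.
Proof. by move=> qr; apply: eq_tsum => s z t; rewrite qr. Qed.

Lemma avgDZ (Y : bimod S T) a (q r : X -> Y) x :
  avg (fun z => a *: q z + r z) x = a *: avg q x + avg r x.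
Proof.
by rewrite /avg -tsumDZ; apply: eq_tsum => s z t; rewrite lactDr ractDl.
Qed.
End Average.

Section Resolutions.
Variables (k : fieldType) (S : algType k) (P : resolution (regbimod S)).
Local Notation d n := (res_d P n).
Local Notation eps := (res_eps P).

Lemma res_dd n x : d n (d n.+1 x) = 0.
Proof. by apply/res_exact; exists x. Qed.
Lemma res_eps_d x : eps (d 0 x) = 0.
Proof. by apply/res_exact0; exists x. Qed.

Variable sig : forall n, P n -> seq (S * P n * S).
Hypothesis sigP : forall n, splitting (sig (n := n)).

Section NullHomotopy.
Variable w : forall n, P n -> P n.
Hypothesis w_bihom : forall n, is_bihom (w (n := n)).
Hypothesis eps_w : forall x, eps (w (n := 0) x) = 0.
Hypothesis d_w : forall n x, d n (w x) = w (d n x).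

Variable gam : forall n, P n -> P n.+1.
Hypothesis gam_lin : forall n, linear (gam (n := n)).
Hypothesis gamP : forall n x, d n (gam (d n x)) = d n x.

Fixpoint null_htpy n : P n -> P n.+1 :=
  match n with
  | 0 => avg (sig (n := 0)) (fun z => gam (w z))
  | m.+1 => avg (sig (n := m.+1)) (fun z => gam (w z - null_htpy (d m z)))
  end.

Definition null_src n : P n -> P n :=
  match n with
  | 0 => fun x => w x
  | m.+1 => fun x => w x - null_htpy (d m x)
  end.

Lemma null_htpyE n : null_htpy (n := n)
  = avg (sig (n := n)) (fun z => gam (null_src z)).
Proof. by case: n. Qed.

(** An endomorphism w of P that covers zero is null-homotopic. The difference [null_src] between w
    and the previous homotopy after d is killed by the augmentation or by d, so it takes values in
    the image of the next differential, where [gam] gives preimages; averaging makes the result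
    bilinear. The three claims need each other and are proved by one induction. *)
Lemma null_htpyP n :
  [/\ is_bihom (null_htpy (n := n)), forall x, null_src (d n x) = w (d n x)
    & forall x, d n (null_htpy x) = null_src x].
Proof.
have step m : is_bihom (null_src (n := m)) ->
    (forall x, exists y, d m y = null_src x) ->
    is_bihom (null_htpy (n := m)) /\ forall x, d m (null_htpy x) = null_src x.
  move=> sP simg; rewrite null_htpyE; split=> [|x].
    by apply: avg_bihom => //; apply: linear_funcomp => //; case: sP.
  rewrite -(avg_comp _ _ _ (bihomP (d m))) -[RHS](avg_id (sigP m) x sP).
  by apply: eq_avg => z; have [y <-] := simg z; exact: gamP.
elim: n => [|n [hP sd dh]].
  have [x|h1 h2] := step 0%N (w_bihom 0); last by split.
  exact/res_exact0/eps_w.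
have [w1 w2 w3] := w_bihom n.+1.
have [d1 d2 d3] := bihomP (d n); have [h1 h2 h3] := hP.
have sP : is_bihom (null_src (n := n.+1)).
  split=> /=.
  - by apply: linear_funB => //; exact: linear_funcomp.
  - by move=> s x; rewrite w2 d2 h2 -scaleN1r addrC -lactDr scaleN1r addrC.
  - by move=> x t; rewrite w3 d3 h3 -scaleN1r addrC -ractDl scaleN1r addrC.
have [x|hP' dh'] := step n.+1 sP.
  by apply/res_exact; rewrite /= (linB d1) dh d_w sd subrr.
by split=> // x; rewrite /= res_dd (lin0 h1) subr0.
Qed.
End NullHomotopy.
End Resolutions.

Section Coboundaries.
Variables (k : fieldType) (R S : algType k) (eta : {lrmorphism R -> S}).

Definition cob (Y : bimod S S) n : relcochain eta Y n -> Prop :=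
  match n with
  | 0 => fun c => c = 0
  | m.+1 => fun c => exists h, c = dlt h
  end.

Lemma cob0 Y n : cob (0 : relcochain eta Y n).
Proof. by case: n => [//|n]; exists 0; rewrite (lin0 (@dlt_lin _ _ _ _ _ _)). Qed.

Lemma cobDZ Y n a (f g : relcochain eta Y n) : cob f -> cob g -> cob (a *: f + g).
Proof.
case: n f g => [|n] f g /=; first by move=> -> ->; rewrite scaler0 addr0.
by move=> [h ->] [h' ->]; exists (a *: h + h'); rewrite dlt_lin.
Qed.

Lemma cobB Y n (f g : relcochain eta Y n) : cob f -> cob g -> cob (f - g).
Proof. by move=> fP gP; rewrite addrC -scaleN1r; apply: cobDZ. Qed.
Lemma cobD Y n (f g : relcochain eta Y n) : cob f -> cob g -> cob (f + g).
Proof. by move=> fP gP; rewrite -[f]scale1r; apply: cobDZ. Qed.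
Lemma cob_dlt Y n (f : relcochain eta Y n) : cob f -> dlt f = 0.
Proof.
case: n f => [|n] f /=; first by move=> ->; rewrite (lin0 (@dlt_lin _ _ _ _ _ _)).
by move=> [h ->]; rewrite dlt_dlt.
Qed.

Lemma cob_postS (Y Z : bimod S S) n (g : Y -> Z) (gP : is_bihom g)
    (f : relcochain eta Y n) :
  cob f -> cob (postS gP f).
Proof.
case: n f => [|n] f /=.
  by move=> ->; rewrite (lin0 (@postS_lin _ _ _ _ _ _ _ _ _)).
by move=> [h ->]; exists (postS gP h); rewrite dlt_postS.
Qed.
End Coboundaries.

Section Comparison.
Variables (k : fieldType) (R S : algType k) (eta : {lrmorphism R -> S}).
Variable P : resolution (regbimod S).
Local Notation CC Y n := (relcochain eta Y n).
Local Notation d n := (res_d P n).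
Local Notation eps := (res_eps P).

Variable sig : forall n, P n -> seq (S * P n * S).
Hypothesis sigP : forall n, splitting (sig (n := n)).

Definition inil : 'I_0 -> S := fun _ => 0.

(* Psi turns a cochain, seen as a map on the relative bar resolution, into its
   composite with a chain map from P to the bar resolution. The latter is never
   written: the contraction 1 (x) - of the bar resolution appears as [cur]
   followed by evaluation at 1. *)
Fixpoint Psi n : forall Y : bimod S S, CC Y n -> P n -> Y :=
  match n with
  | 0 => fun Y c => avg (sig (n := 0)) (fun z => ract (c inil : Y) (eps z))
  | m.+1 => fun Y c =>
      avg (sig (n := m.+1)) (fun z => coval (Psi (cur c) (d m z)) 1)
  end.

Lemma PsiS n Y (c : CC Y n.+1) x :
  Psi c x = avg (sig (n := n.+1)) (fun z => coval (Psi (cur c) (d n z)) 1) x.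
Proof. by []. Qed.

Lemma Psi_bihom n : forall Y (c : CC Y n), is_bihom (Psi c).
Proof.
elim: n => [|n IHn] Y c /=; apply: avg_bihom => //.
  apply: (linear_funcomp (g := fun s : S => ract (c inil : Y) s)).
    exact: ract_linr.
  exact: (bihom_linear (bihomP eps)).
apply: (linear_funcomp (g := fun F : coind eta Y => coval F 1)) => //.
apply: (linear_funcomp (bihom_linear (IHn _ _))).
exact: (bihom_linear (bihomP (d n))).
Qed.

Lemma PsiDZ n : forall Y x a (c c' : CC Y n),
  Psi (a *: c + c') x = a *: Psi c x + Psi c' x.
Proof.
elim: n => [|n IHn] Y x a c c' /=; rewrite -avgDZ; apply: eq_avg => z.
  rewrite -[LHS]/(ract (a *: (c inil : Y) + (c' inil : Y)) (eps z)).
  by rewrite ractDl.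
by rewrite (cur_lin a c c') IHn.
Qed.

Lemma Psi_lin n Y x : linear (fun c : CC Y n => Psi c x).
Proof. exact: PsiDZ. Qed.

Lemma Psi_postS n :
  forall (Y Z : bimod S S) (g : Y -> Z) (gP : is_bihom g) (c : CC Y n) x,
  Psi (postS gP c) x = g (Psi c x).
Proof.
elim: n => [|n IHn] Y Z g gP c x /=; rewrite -(avg_comp _ _ _ gP);
  apply: eq_avg => z.
  by have [_ _ g3] := gP; rewrite g3.
by rewrite cur_postS IHn co_mapE.
Qed.

(** For central F, the map x -> F eps(x) is already bilinear, so averaging does not affect it. This
    is applied to [rmul c], central in the coinduced bimodule. *)
Lemma avg_central (Y : bimod S S) (F : Y) x : (forall s, lact s F = ract F s) ->
  avg (sig (n := 0)) (fun z => ract F (eps z)) x = ract F (eps x).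
Proof.
move=> cF; apply: (avg_id (sigP 0)); have [e1 e2 e3] := bihomP eps.
split=> [a u v|s u|u t].
- by rewrite e1; exact: ractDr.
- rewrite e2 -[ract F _]/(ract F (s * eps u)).
  by rewrite ractA -cF lractA.
- by rewrite e3 -[ract F _]/(ract F (eps u * t)) ractA.
Qed.

Lemma Psi_rmul Y (c : CC Y 0) x : coval (Psi (rmul c) x) 1 = ract (c inil : Y) (eps x).
Proof.
rewrite -(rmulE c) -[eps x]mul1r -coval_lact.
have cr (s : S) :
    lact s (rmul c inil : coind eta Y) = ract (rmul c inil : coind eta Y) s.
  apply: (coind_ext (eta := eta)) => t; rewrite coval_lact coval_ract !rmulE.
  by rewrite ractA.
by rewrite cr -(avg_central x cr).
Qed.

(** In the curried coboundary, the unit term evaluated at 1 gives the right-hand side. The other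
    term vanishes: by induction it is a value at d (d z), and in degree 0 it carries the factor eps
    (d z). *)
Lemma Psi_dlt n Y (c : CC Y n) x : Psi (dlt c) x = Psi c (d n x).
Proof.
elim: n Y c x => [|n IHn] Y c x.
  have PP := Psi_bihom c; rewrite PsiS.
  have bP : is_bihom (fun z : P 1%N => Psi c (d 0 z)).
    have [p1 p2 p3] := PP; have [d1 d2 d3] := bihomP (d 0).
    by split=> *; rewrite ?d1 ?d2 ?d3 ?p1 ?p2 ?p3.
  rewrite -[RHS](avg_id (sigP 1) x bP); apply: eq_avg => z.
  rewrite cur_dlt0 (linB (Psi_lin (d 0 z))) (linB (coval_linl 1)).
  by rewrite Psi_postS co_unitE lact1 Psi_rmul res_eps_d ract0r subr0.
have PP := Psi_bihom c; rewrite PsiS.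
have bP : is_bihom (fun z : P n.+2 => Psi c (d n.+1 z)).
  have [p1 p2 p3] := PP; have [d1 d2 d3] := bihomP (d n.+1).
  by split=> *; rewrite ?d1 ?d2 ?d3 ?p1 ?p2 ?p3.
rewrite -[RHS](avg_id (sigP n.+2) x bP); apply: eq_avg => z.
rewrite cur_dlt (linB (Psi_lin (d n.+1 z))) (linB (coval_linl 1)).
rewrite Psi_postS co_unitE lact1 IHn res_dd.
by rewrite (lin0 (bihom_linear (Psi_bihom _))) (lin0 (coval_linl 1)) subr0.
Qed.

Variable phi : forall n, CC (P n) n.
Hypothesis phiP : bar_comparison phi.

Lemma dlt_phi n : dlt (phi n) = postS (bihomP (d n)) (phi n.+1).
Proof. by apply: tenshom_ext => x; rewrite dltE postSE phiP.2. Qed.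

Definition pull n (Y : bimod S S) (u : P n -> Y) (uP : is_bihom u) : CC Y n :=
  postS uP (phi n).

(** The effect on cochains of the identity minus the composite of the two chain maps, from the bar
    resolution to P and back. It commutes with coboundaries and with changes of coefficients. *)
Definition defect n Y (c : CC Y n) : CC Y n := c - pull (Psi_bihom c).

Lemma defect_lin n Y : linear (@defect n Y).
Proof.
apply: linear_funB => // a c c'; apply: tenshom_ext => x.
exact: Psi_lin.
Qed.

Lemma defect_dlt n Y (c : CC Y n) : defect (dlt c) = dlt (defect c).
Proof.
rewrite /defect (linB (@dlt_lin _ _ _ _ _ _)); congr (_ - _).
rewrite /pull dlt_postS dlt_phi; apply: tenshom_ext => x.
by rewrite !postSE Psi_dlt.
Qed.

Lemma defect_postS n (Y Z : bimod S S) (g : Y -> Z) (gP : is_bihom g) (c : CC Y n) :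
  defect (postS gP c) = postS gP (defect c).
Proof.
rewrite /defect (linB (@postS_lin _ _ _ _ _ _ _ _ _)); congr (_ - _).
by apply: tenshom_ext => x; rewrite !postSE Psi_postS.
Qed.

Lemma defect_rmul Y (c : CC Y 0) : ev1_post (defect (rmul c)) = 0.
Proof.
rewrite /defect (linB (@ev1_post_lin _ _ _ _ _ _)); apply/eqP; rewrite subr_eq0.
apply/eqP/tenshom_ext => x; rewrite !ev1_postE rmulE [RHS]Psi_rmul phiP.1.
by rewrite (ituple0 inil x).
Qed.

(** Transpose of the usual recursion for a homotopy on the bar resolution: remove the contribution
    of the previous homotopy from the endomorphism, then apply the contraction. *)
Fixpoint htpy n : forall Y, CC Y n.+1 -> CC Y n :=
  match n with
  | 0 => fun Y c => ev1_post (defect (cur c))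
  | m.+1 => fun Y c => ev1_post (defect (cur c) - dlt (htpy (cur c)))
  end.

Lemma htpy_lin n : forall Y, linear (@htpy n Y).
Proof.
elim: n => [|n IHn] Y; apply: (linear_funcomp (@ev1_post_lin _ _ _ _ _ _)).
  by apply: linear_funcomp; [exact: defect_lin|exact: cur_lin].
apply: linear_funB; first by apply: linear_funcomp; [exact: defect_lin|exact: cur_lin].
apply: (linear_funcomp (@dlt_lin _ _ _ _ _ _)).
by apply: (linear_funcomp (IHn _)); exact: cur_lin.
Qed.

Lemma ev1_post_map (Y Z : bimod S S) (g : Y -> Z) (gP : is_bihom g) n
    (c : CC (coind eta Y) n) :
  ev1_post (postS (co_map_bihom eta gP) c) = postS gP (ev1_post c).
Proof. by apply: tenshom_ext. Qed.

Lemma htpy_postS n :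
  forall (Y Z : bimod S S) (g : Y -> Z) (gP : is_bihom g) (c : CC Y n.+1),
  htpy (postS gP c) = postS gP (htpy c).
Proof.
elim: n => [|n IHn] Y Z g gP c /=; rewrite cur_postS defect_postS.
  exact: ev1_post_map.
rewrite IHn dlt_postS -ev1_post_map.
congr ev1_post; symmetry.
exact: (linB (@postS_lin _ _ _ _ _ _ _ _ (co_map_bihom eta gP))).
Qed.

Lemma htpyP0 Y (c : CC Y 0) : defect c = htpy (dlt c).
Proof.
rewrite /= cur_dlt0 (linB (@defect_lin _ _)) (linB (@ev1_post_lin _ _ _ _ _ _)).
by rewrite defect_rmul subr0 defect_postS ev1_unit_post.
Qed.

(** Expanding [cur (dlt c)] inside [htpy (dlt c)] leaves, besides the expected terms, the coboundary
    of [defect (cur c) - htpy (dlt (cur c))], evaluated at 1. The identity one degree lower, for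
    [cur c], makes this difference a coboundary (zero in degree 0), so the extra term vanishes. *)
Lemma htpyP n : forall Y (c : CC Y n.+1),
  defect c = dlt (htpy c) + htpy (dlt c).
Proof.
have main m Y (c : CC Y m.+1) :
    dlt (defect (cur c)) = dlt (htpy (dlt (cur c))) ->
    defect c = dlt (htpy c) + htpy (dlt c).
  move=> H; rewrite [htpy (dlt c)]/= cur_dlt.
  rewrite (linB (@defect_lin _ _)) (linB (@htpy_lin _ _)) defect_postS htpy_postS.
  rewrite !(linB (@dlt_lin _ _ _ _ _ _)) defect_dlt H dlt_postS.
  rewrite !(linB (@ev1_post_lin _ _ _ _ _ _)) !ev1_unit_post.
  by rewrite opprB addrC addrA !subrK.
elim: n => [|n IHn] Y c; apply: main; first by rewrite htpyP0.
by rewrite IHn (linD (@dlt_lin _ _ _ _ _ _)) dlt_dlt add0r.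
Qed.
End Comparison.

Section ComparisonTheorem.
Variables (k : fieldType) (R S : algType k) (eta : {lrmorphism R -> S}).
Variable P : resolution (regbimod S).
Local Notation CC Y n := (relcochain eta Y n).
Local Notation d n := (res_d P n).
Local Notation eps := (res_eps P).

Variable phi : forall n, CC (P n) n.
Hypothesis phiP : bar_comparison phi.

Lemma exists_splittings :
  exists sig : forall n, P n -> seq (S * P n * S), forall n, splitting (sig n).
Proof.
have H n := projective_splitting (@res_proj _ _ _ _ P n).
by exists (fun n => sval (cid (H n))) => n; exact: (svalP (cid (H n))).
Qed.

Lemma dlt_pull n (Y : bimod S S) (u : P n -> Y) (uP : is_bihom u) :
  (forall z, u (d n z) = 0) -> dlt (pull phi uP) = 0.
Proof.
move=> u0; rewrite /pull dlt_postS (dlt_phi phiP).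
by apply: tenshom_ext => x; exact: u0.
Qed.

Lemma pull_surj n (Y : bimod S S) (c : CC Y n) : dlt c = 0 ->
  exists (u : P n -> Y) (uP : is_bihom u),
    (forall z, u (d n z) = 0) /\ cob (c - pull phi uP).
Proof.
move=> c0; have [sig sigP] := exists_splittings.
exists (Psi sig c), (Psi_bihom sigP c); split=> [z|].
  by rewrite -(Psi_dlt sigP) c0 (lin0 (Psi_lin _ _)).
rewrite -[c - _]/(defect sigP phi c); case: n c c0 => [|n] c c0.
  by rewrite (htpyP0 sigP phiP) c0 (lin0 (htpy_lin _ _ (Y := _))).
exists (htpy sigP phi c).
by rewrite (htpyP sigP phiP) c0 (lin0 (htpy_lin _ _ (Y := _))) addr0.
Qed.

(** The composite [theta] of the chain maps P -> bar -> P covers the identity of S, so 1 - theta is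
    null-homotopic. Hence the cocycle u differs from u theta by a coboundary, and u theta is the
    image under [Psi] of the pullback of u, assumed to be a coboundary. In degree 0 coboundaries are
    zero, hence the case distinction. *)
Lemma pull_inj n (Y : bimod S S) (u : P n -> Y) (uP : is_bihom u) :
  (forall z, u (d n z) = 0) -> cob (pull phi uP) ->
  match n return (P n -> Y) -> Prop with
  | 0 => fun u => forall x, u x = 0
  | m.+1 => fun u => exists2 v, is_bihom v & forall x, u x = v (d m x)
  end u.
Proof.
move=> u0 ucob; have [sig sigP] := exists_splittings.
have [gam gamP] : exists gam : forall n, P n -> P n.+1, forall n,
    linear (gam n) /\ forall x, d n (gam n (d n x)) = d n x.
  have H m := generalized_inverse (bihom_linear (bihomP (d m))).
  by exists (fun m => sval (cid (H m))) => m; exact: (svalP (cid (H m))).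
(* [phi m] is itself a cochain, with values in [P m]; applying [Psi] to it yields the composite
   chain map without naming the bar resolution. *)
pose theta m := Psi sig (phi m).
have thetaP m : is_bihom (theta m) := Psi_bihom sigP (phi m).
have d_theta m x : d m (theta m.+1 x) = theta m (d m x).
  rewrite /theta -(Psi_dlt sigP) (dlt_phi phiP).
  by rewrite (Psi_postS _ (bihomP (d m))).
have eps_theta x : eps (theta 0%N x) = eps x.
  rewrite /theta -(Psi_postS _ (bihomP eps)) [LHS]/=.
  rewrite -[RHS](avg_id (sigP 0%N) x (bihomP eps)); apply: eq_avg => z.
  by rewrite phiP.1; exact: mul1r.
pose w m x := x - theta m x.
have wP m : is_bihom (w m).
  have [t1 t2 t3] := thetaP m; split.
  - by apply: linear_funB.
  - by move=> s x; rewrite /w t2 -scaleN1r addrC -lactDr scaleN1r addrC.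
  - by move=> x s; rewrite /w t3 -scaleN1r addrC -ractDl scaleN1r addrC.
have eps_w x : eps (w 0%N x) = 0.
  by rewrite (linB (bihom_linear (bihomP eps))) eps_theta subrr.
have d_w m x : d m (w m.+1 x) = w m (d m x).
  by rewrite (linB (bihom_linear (bihomP (d m)))) d_theta.
have htP m := null_htpyP sigP wP eps_w d_w (fun m => (gamP m).1)
  (fun m => (gamP m).2) m.
have uw x : u x = u (w n x) + u (theta n x).
  by rewrite -(linD (bihom_linear uP)) subrK.
have utheta x : u (theta n x) = Psi sig (pull phi uP) x.
  by rewrite (Psi_postS _ uP).
have h_bihom m := let: And3 h _ _ := htP m in h.
have dh m x : d m (null_htpy sig w gam x) = null_src sig w gam x.
  by have [_ _ +] := htP m; exact.
case: n u uP u0 ucob uw utheta => [|n] u uP u0 ucob uw utheta.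
  move=> x; rewrite uw utheta ucob (lin0 (Psi_lin _ _)) addr0.
  by rewrite -[w 0%N x]/(null_src sig w gam x) -dh u0.
have [h hE] := ucob.
exists (fun y => u (null_htpy sig w gam y) + Psi sig h y).
  have [p1 p2 p3] := Psi_bihom sigP h; have [h1 h2 h3] := h_bihom n.
  have [u1 u2 u3] := uP; split.
  - by move=> a x y; rewrite h1 u1 p1 scalerDr addrACA.
  - by move=> s x; rewrite h2 u2 p2 lactD.
  - by move=> x s; rewrite h3 u3 p3 ractD.
move=> x; rewrite uw utheta hE (Psi_dlt sigP); congr (_ + _).
have := dh n.+1 x; rewrite /= => /(congr1 u); rewrite u0 (linB (bihom_linear uP)).
by move/esym/eqP; rewrite subr_eq0 => /eqP.
Qed.
End ComparisonTheorem.

(** * The chain map from the relative bar resolution to P *)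

Section ExistenceOfComparison.
Variables (k : fieldType) (S : algType k).
Local Notation diagk := (k^o * k^o)%type.
Variable eta : {lrmorphism diagk -> S}.
Variable P : resolution (regbimod S).
Local Notation CC Y n := (relcochain eta Y n).

Definition idem (b : bool) : diagk := if b then (1, 0) else (0, 1).

(* diagk is separable with separability idempotent the sum of the idem b (x) idem b,
   so that averaging makes a linear map diagk-bilinear. *)
Definition davg (X Y : bimod S S) (q : X -> Y) (x : X) : Y :=
  \sum_(b : bool) \sum_(c : bool)
    lact (eta (idem b)) (ract (q (lact (eta (idem b)) (ract x (eta (idem c)))))
                              (eta (idem c))).

Definition coef (r : diagk) (b : bool) : k := if b then r.1 else r.2.

Lemma idem_mull r b : eta r * eta (idem b) = coef r b *: eta (idem b).
Proof.
rewrite -rmorphM -linearZ; congr (eta _).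
by case: b r => -[r1 r2]; congr pair; rewrite /= ?mulr1 ?mulr0 ?scaler0 //;
  rewrite -[RHS]/(_ * 1) mulr1.
Qed.
Lemma idem_mulr r b : eta (idem b) * eta r = coef r b *: eta (idem b).
Proof.
rewrite -rmorphM -linearZ; congr (eta _).
by case: b r => -[r1 r2]; congr pair; rewrite /= ?mul1r ?mul0r ?scaler0 //;
  rewrite -[RHS]/(_ * 1) mulr1.
Qed.
Lemma idem_sum : \sum_(b : bool) eta (idem b) = 1.
Proof.
rewrite -linear_sum -(rmorph1 eta); congr (eta _).
by rewrite big_bool; congr pair; rewrite /= ?addr0 ?add0r.
Qed.

Lemma davg_bihom (X Y : bimod S S) (q : X -> Y) : linear q ->
  is_bihom (X := restr eta X) (Y := restr eta Y) (davg q).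
Proof.
move=> q_lin; split.
- move=> a x y; rewrite /davg scaler_sumr -big_split; apply: eq_bigr => b _ /=.
  rewrite scaler_sumr -big_split; apply: eq_bigr => c _ /=.
  by rewrite ractDl lactDr q_lin ractDl lactDr.
- move=> r x; rewrite -[RHS]/(lact (eta r) (davg q x)) /davg.
  rewrite (lin_sum (@lact_lin _ _ _ Y (eta r))); apply: eq_bigr => b _.
  rewrite (lin_sum (@lact_lin _ _ _ Y (eta r))); apply: eq_bigr => c _.
  rewrite -[lact r x]/(lact (eta r) (x : X)) -lractA -!lactA idem_mull idem_mulr.
  by rewrite !lactZs (linZ q_lin) ractZ lactZ.
- move=> x r; rewrite -[RHS]/(ract (davg q x) (eta r)) /davg.
  rewrite (lin_sum (@ract_lin _ _ _ Y (eta r))); apply: eq_bigr => b _.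
  rewrite (lin_sum (@ract_lin _ _ _ Y (eta r))); apply: eq_bigr => c _.
  rewrite -[ract x r]/(ract (x : X) (eta r)) -!lractA -!ractA idem_mull idem_mulr.
  by rewrite !ractZt !lactZ (linZ q_lin) ractZ lactZ.
Qed.

Lemma davg_id (X : bimod S S) (x : X) : davg id x = x.
Proof.
have idemK b : eta (idem b) * eta (idem b) = eta (idem b).
  by rewrite idem_mull; case: b; rewrite scale1r.
rewrite /davg (eq_bigr (fun b => lact (eta (idem b)) x)).
  rewrite -[RHS]lact1 -idem_sum.
  by rewrite (lin_sum (f := fun s => lact s x)) //; exact: lact_linl.
move=> b _; rewrite (eq_bigr (fun c => lact (eta (idem b)) (ract x (eta (idem c))))).
  rewrite -(lin_sum (@lact_lin _ _ _ X _)); congr (lact _ _).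
  rewrite -[RHS]ract1 -idem_sum.
  by rewrite (lin_sum (f := fun s => ract x s)) //; exact: ract_linr.
by move=> c _; rewrite -lractA -lactA idemK -ractA idemK.
Qed.

Lemma davg_comp (X Y Z : bimod S S) (f : Y -> Z) (q : X -> Y) x : is_bihom f ->
  f (davg q x) = davg (fun z => f (q z)) x.
Proof.
move=> [f1 f2 f3]; rewrite /davg (lin_sum f1); apply: eq_bigr => b _.
by rewrite (lin_sum f1); apply: eq_bigr => c _; rewrite f2 f3.
Qed.

(** Since f commutes with the idempotents, averaging a linear generalized inverse over them does not
    spoil f g f = f. *)
Lemma davg_inverse (X Y : bimod S S) (f : X -> Y) : is_bihom f ->
  exists2 g : Y -> X, is_bihom (X := restr eta Y) (Y := restr eta X) g &
    forall x, f (g (f x)) = f x.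
Proof.
move=> fP; have [g [g_lin gP]] := generalized_inverse (bihom_linear fP).
exists (davg g); first exact: davg_bihom.
move=> x; rewrite davg_comp // -[RHS](davg_id (f x)) /davg.
apply: eq_bigr => b _; apply: eq_bigr => c _.
by have [f1 f2 f3] := fP; rewrite -(f3 x) -(f2 _ (ract x _)) gP.
Qed.

Lemma one_tenshom :
  is_tenshom (X := restr eta (regbimod S)) (Y := restr eta (regbimod S))
    (fun _ : 'I_0 -> S => 1).
Proof.
split=> [x []//|x []//|x []//|x []//|_ x s].
by rewrite -[LHS]/(eta s * 1) -[RHS]/(1 * eta s) mul1r mulr1.
Qed.

(** Each [phi n.+1] is a preimage of [dlt (phi n)] under the differential, taken by a generalized
    inverse; this one has to be D-bilinear for [phi n.+1] to be balanced. A preimage exists by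
    exactness, as the preceding differential (or the augmentation) sends [dlt (phi n)] to zero: for
    n > 0 this is [dlt_dlt]. *)
Lemma exists_bar_comparison : exists phi : forall n, CC (P n) n, bar_comparison phi.
Proof.
have [g gP gE] := davg_inverse (bihomP (res_eps P)).
have H n := davg_inverse (bihomP (res_d P n)).
pose gam n := s2val (cid2 (H n)).
have gamP n : is_bihom (X := restr eta (P n)) (Y := restr eta (P n.+1)) (gam n) :=
  s2valP (cid2 (H n)).
have gamE n x : res_d P n (gam n (res_d P n x)) = res_d P n x :=
  s2valP' (cid2 (H n)) x.
pose phi := fix phi n : CC (P n) n :=
  match n with
  | 0 => post gP (mk_tenshom one_tenshom)
  | m.+1 => post (gamP m) (dlt (phi m))
  end.
have phi0 x : res_eps P (phi 0%N x) = 1.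
  by have [y yE] := res_eps_surj P 1; rewrite -[phi 0%N x]/(g 1) -yE gE.
suff phiS n x : res_d P n (phi n.+1 x) = dlt (phi n) x by exists phi.
suff [y yE] : exists y, res_d P n y = dlt (phi n) x.
  by rewrite -[phi n.+1 x]/(gam n (dlt (phi n) x)) -yE gamE.
elim: n x => [|n IHn] x.
  apply/res_exact0; rewrite -[LHS]/(postS (bihomP (res_eps P)) (dlt (phi 0%N)) x).
  rewrite -dlt_postS dltE hcoboundE rcobound0 !postSE !phi0.
  by rewrite -[LHS]/(x ord0 * 1 - 1 * x ord0) mulr1 mul1r subrr.
apply/res_exact.
rewrite -[LHS]/(postS (bihomP (res_d P n)) (dlt (phi n.+1)) x) -dlt_postS.
rewrite (_ : postS _ _ = dlt (phi n)) ?dlt_dlt //.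
apply: tenshom_ext => z; have [y yE] := IHn z.
by rewrite postSE [phi n.+1 z]/(gam n (dlt (phi n) z)) -yE gamE.
Qed.
End ExistenceOfComparison.

(** * Square-zero extensions *)

Section Multilinear.
Variables (k : fieldType) (X Y : lmodType k).

Definition multilinear n (f : ('I_n -> X) -> Y) : Prop :=
  forall x i (a : k) u v,
    f (upd x i (a *: u + v)) = a *: f (upd x i u) + f (upd x i v).

Lemma multilinear_head n (f : ('I_n.+1 -> X) -> Y) y :
  multilinear f -> linear (fun s => f (icons s y)).
Proof.
by move=> fm a u v; have := fm (icons 0 y) ord0 a u v; rewrite !upd_icons0.
Qed.

Lemma multilinear_icons n (f : ('I_n.+1 -> X) -> Y) s :
  multilinear f -> multilinear (fun y => f (icons s y)).
Proof. by move=> fm x i a u v; rewrite -!upd_iconsS fm. Qed.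

Lemma multilinear0 n (f : ('I_n -> X) -> Y) x i :
  multilinear f -> x i = 0 -> f x = 0.
Proof.
move=> fm xi0; have := fm x i (-1) 0 0.
by rewrite scaler0 addr0 -{1 2 3}xi0 !upd_id scaleN1r addNr.
Qed.
End Multilinear.

Lemma tenshom_multilinear (k : fieldType) (S : algType k) (X Y : bimod S S) n
  (f : ('I_n -> X) -> Y) : is_tenshom f -> multilinear f.
Proof. by case. Qed.

Lemma tenshom_restr (k : fieldType) (R S : algType k) (eta : {lrmorphism R -> S})
    (X Y : bimod S S) n (f : ('I_n -> X) -> Y) :
  is_tenshom f -> is_tenshom (X := restr eta X) (Y := restr eta Y) f.
Proof.
move=> [f1 f2 f3 f4 f5]; split.
- exact: f1.
- by move=> x i j s; exact: f2.
- by move=> x i s; exact: f3.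
- by move=> x i s; exact: f4.
- by move=> n0 x s; exact: f5.
Qed.

Lemma rcobound_tsum (k : fieldType) (S T : algType k) (Y : bimod T S) n
    (U V W : Type) (g : U -> V -> W -> ('I_n -> S) -> Y) l x :
  rcobound (fun z => tsum (fun u v w => g u v w z) l) x
  = tsum (fun u v w => rcobound (g u v w) x) l.
Proof.
have r_lin : linear (fun f : ('I_n -> S) -> Y => rcobound f x).
  by move=> a f h; exact: rcoboundDZ.
rewrite -(lin_tsum g l r_lin); congr (rcobound _ x).
apply/funext => z; rewrite /tsum.
by elim: l => [|p l IHl]; rewrite ?big_nil // !big_cons IHl.
Qed.

Lemma rcoboundB (k : fieldType) (S T : algType k) (Y : bimod T S) n
    (f g : ('I_n -> S) -> Y) x :
  rcobound (fun z => f z - g z) x = rcobound f x - rcobound g x.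
Proof.
have r_lin : linear (fun f : ('I_n -> S) -> Y => rcobound f x).
  by move=> a f' h; exact: rcoboundDZ.
exact: (linB r_lin f g).
Qed.

Lemma add_cancel (V : zmodType) (A1 A2 A3 B1 B2 C3 : V) :
  A1 - (A2 - A3) - (B1 - B2) + (A2 + B1 - (A3 - C3)) = A1 + (B2 + C3).
Proof.
rewrite !opprB [A2 + B1]addrC !addrA -[_ + B2 - B1 + B1]addrA addNr addr0.
rewrite [_ + B2 + A2]addrAC -[_ - A2 + A2]addrA addNr addr0.
by rewrite [A1 + A3 + B2]addrAC [_ + A3 + C3]addrAC addrK.
Qed.

(* L = inA AA (+) inM MM is a split extension of AA by the square-zero ideal MM. *)
Record square_zero (k : fieldType) (R AA L : algType k) (MM : bimod AA AA)
    (etaA : {lrmorphism R -> AA}) (etaL : {lrmorphism R -> L})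
    (inA : {lrmorphism AA -> L}) (prA : {lrmorphism L -> AA})
    (inM : MM -> L) (prM : L -> MM) : Prop := SquareZero {
  sz_etaL : forall r, etaL r = inA (etaA r);
  sz_inAK : forall a, prA (inA a) = a;
  sz_inMK : forall m, prM (inM m) = m;
  sz_prA_inM : forall m, prA (inM m) = 0;
  sz_prM_inA : forall a, prM (inA a) = 0;
  sz_decomp : forall x, x = inA (prA x) + inM (prM x);
  sz_inM_lin : linear inM;
  sz_prM_lin : linear prM;
  sz_mulAM : forall a m, inA a * inM m = inM (lact a m);
  sz_mulMA : forall a m, inM m * inA a = inM (ract m a);
  sz_mulMM : forall m m', inM m * inM m' = 0
}.

Section SquareZero.
Variables (k : fieldType) (R AA L : algType k) (MM : bimod AA AA).
Variables (etaA : {lrmorphism R -> AA}) (etaL : {lrmorphism R -> L}).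
Variables (inA : {lrmorphism AA -> L}) (prA : {lrmorphism L -> AA}).
Variables (inM : MM -> L) (prM : L -> MM).
Hypothesis sz : square_zero etaA etaL inA prA inM prM.

Local Notation etaLE := (sz_etaL sz).
Local Notation inAK := (sz_inAK sz).
Local Notation inMK := (sz_inMK sz).
Local Notation prA_inM := (sz_prA_inM sz).
Local Notation prM_inA := (sz_prM_inA sz).
Local Notation decomp := (sz_decomp sz).
Local Notation inM_lin := (sz_inM_lin sz).
Local Notation prM_lin := (sz_prM_lin sz).
Local Notation mulAM := (sz_mulAM sz).
Local Notation mulMA := (sz_mulMA sz).
Local Notation mulMM := (sz_mulMM sz).

Lemma prM_mul x y : prM (x * y) = lact (prA x) (prM y) + ract (prM x) (prA y).
Proof.
rewrite {1}(decomp x) {1}(decomp y) mulrDl !mulrDr mulMM mulAM mulMA addr0.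
by rewrite -rmorphM !(linD prM_lin) prM_inA !inMK add0r.
Qed.

Lemma inM_mulr m x : inM m * x = inM (ract m (prA x)).
Proof. by rewrite {1}(decomp x) mulrDr mulMM mulMA addr0. Qed.

Lemma prA_eta r : prA (etaL r) = etaA r.
Proof. by rewrite etaLE inAK. Qed.
Lemma prM_eta r : prM (etaL r) = 0.
Proof. by rewrite etaLE prM_inA. Qed.

Local Notation CL X n := (relcochain etaL (restr prA X) n).
Local Notation CA X n := (relcochain etaA X n).
Local Notation L_R := (restr etaL (regbimod L)).

Lemma prA_bihom :
  is_bihom (X := L_R) (Y := restr etaA (regbimod AA)) prA.
Proof.
split=> [a x y|r x|x r]; first exact: linearP.
- by rewrite -[LHS]/(prA (etaL r * x)) rmorphM /= prA_eta.
- by rewrite -[LHS]/(prA (x * etaL r)) rmorphM /= prA_eta.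
Qed.
Lemma inA_bihom :
  is_bihom (X := restr etaA (regbimod AA)) (Y := L_R) inA.
Proof.
split=> [a x y|r x|x r]; first exact: linearP.
- by rewrite -[LHS]/(inA (etaA r * x)) rmorphM /= -etaLE.
- by rewrite -[LHS]/(inA (x * etaA r)) rmorphM /= -etaLE.
Qed.
Lemma prM_bihom : is_bihom (X := L_R) (Y := restr etaA MM) prM.
Proof.
split=> [a x y|r x|x r]; first exact: prM_lin.
- by rewrite -[LHS]/(prM (etaL r * x)) prM_mul prA_eta prM_eta ract0l addr0.
- by rewrite -[LHS]/(prM (x * etaL r)) prM_mul prA_eta prM_eta lact0r add0r.
Qed.

Section Coefficients.
Variable X : bimod AA AA.

Lemma restr_id_bihom :
  is_bihom (X := restr etaA X) (Y := restr etaL (restr prA X)) id.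
Proof.
split=> // [r x|x r].
- by rewrite -[RHS]/(lact (prA (etaL r)) (x : X)) prA_eta.
- by rewrite -[RHS]/(ract (x : X) (prA (etaL r))) prA_eta.
Qed.
Lemma restr_id_bihom' :
  is_bihom (X := restr etaL (restr prA X)) (Y := restr etaA X) id.
Proof.
split=> // [r x|x r].
- by rewrite -[LHS]/(lact (prA (etaL r)) (x : X)) prA_eta.
- by rewrite -[LHS]/(ract (x : X) (prA (etaL r))) prA_eta.
Qed.

Definition infl n (c : CA X n) : CL X n :=
  mk_tenshom (tenshom_comp prA_bihom restr_id_bihom (tenshomP c)).
Lemma inflE n (c : CA X n) x : infl c x = c (fun i => prA (x i)).
Proof. by []. Qed.

Definition resA n (f : CL X n) : CA X n :=
  mk_tenshom (tenshom_comp inA_bihom restr_id_bihom' (tenshomP f)).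
Lemma resAE n (f : CL X n) x : resA f x = f (fun i => inA (x i)).
Proof. by []. Qed.

Definition ext n (t : tenshom MM X n) : CL X n :=
  mk_tenshom (tenshom_comp prM_bihom restr_id_bihom
    (tenshom_restr etaA (tenshomP t))).
Lemma extE n (t : tenshom MM X n) x : ext t x = t (fun i => prM (x i)).
Proof. by []. Qed.

Lemma infl_lin n : linear (@infl n).
Proof. by move=> a c c'; exact: tenshom_ext. Qed.
Lemma resA_lin n : linear (@resA n).
Proof. by move=> a c c'; exact: tenshom_ext. Qed.
Lemma ext_lin n : linear (@ext n).
Proof. by move=> a c c'; exact: tenshom_ext. Qed.

Lemma dlt_infl n (c : CA X n) : dlt (infl c) = infl (dlt c).
Proof.
apply: tenshom_ext => x; rewrite inflE !dltE.
exact: (@hcobound_comp _ AA L prA X (restr prA X) id n c x (rmorphM prA)).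
Qed.
Lemma dlt_resA n (f : CL X n) : dlt (resA f) = resA (dlt f).
Proof.
apply: tenshom_ext => x; rewrite resAE !dltE.
apply: (@hcobound_comp _ L AA inA (restr prA X) X id n f x (rmorphM inA)) => //.
- by move=> y s; rewrite -[LHS]/(ract (y : X) (prA (inA s))) inAK.
- by move=> y s; rewrite -[LHS]/(lact (prA (inA s)) (y : X)) inAK.
Qed.

Lemma resA_infl n (c : CA X n) : resA (infl c) = c.
Proof.
apply: tenshom_ext => x; rewrite resAE inflE; congr (c _).
by apply/funext => i; rewrite inAK.
Qed.
Lemma resA_ext n (t : tenshom MM X n.+1) : resA (ext t) = 0.
Proof.
apply: tenshom_ext => x; rewrite resAE extE.
apply: (multilinear0 (i := ord0)); last exact: prM_inA.
exact: (tenshom_multilinear (tenshomP t)).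
Qed.

(** On tensors with all factors in MM, the outer terms vanish because MM acts by zero on X, and the
    merged ones because MM MM = 0. *)
Lemma dlt_inM n (h : CL X n) x : dlt h (fun i => inM (x i)) = 0.
Proof.
have hm := tenshom_multilinear (tenshomP h).
have ract_inM (y : restr prA X) m : ract y (inM m) = 0.
  by rewrite -[LHS]/(ract (y : X) (prA (inM m))) prA_inM ract0r.
have lact_inM (y : restr prA X) m : lact (inM m) y = 0.
  by rewrite -[LHS]/(lact (prA (inM m)) (y : X)) prA_inM lact0l.
rewrite dltE /hcobound lact_inM ract_inM scaler0 addr0 add0r.
apply: big1 => i _; rewrite (multilinear0 (i := i)) ?scaler0 //.
by rewrite /merge_at ltnn eqxx mulMM.
Qed.

Lemma infl_inM n (c : CA X n.+1) x : infl c (fun i => inM (x i)) = 0.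
Proof.
rewrite inflE; apply: (multilinear0 (i := ord0)); last exact: prA_inM.
exact: (tenshom_multilinear (tenshomP c)).
Qed.
Lemma ext_inM n (t : tenshom MM X n) x : ext t (fun i => inM (x i)) = t x.
Proof. by rewrite extE; congr (t _); apply/funext => i; exact: inMK. Qed.

(** The two summands are separated by restriction: to AA, where [ext t] dies and coboundaries remain
    coboundaries, and to tensors from MM, where both [infl c] and every coboundary die. *)
Lemma normal_form_unique n (c : CA X n.+1) (t : tenshom MM X n.+1) :
  cob (infl c + ext t) -> cob c /\ t = 0.
Proof.
move=> [h hE]; split.
  exists (resA h); rewrite dlt_resA -hE (linD (@resA_lin _)) resA_infl resA_ext.
  by rewrite addr0.
apply: tenshom_ext => x.
have := dlt_inM h x; rewrite -hE.
rewrite -[LHS]/(infl c (fun i => inM (x i)) + ext t (fun i => inM (x i))).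
by rewrite infl_inM add0r ext_inM.
Qed.
End Coefficients.

Variable sigma : MM -> seq (AA * MM * AA).
Hypothesis sigmaP : splitting sigma.

Section Retraction.
Variable X : bimod AA AA.
Local Notation W := (lhom MM X).

Lemma co_retr_trilinear (F : coind etaA W) :
  trilinear (fun b m t => lact b (lhom_fun (coval F t) m)).
Proof.
split=> [m t|b t|b m] a u v.
- by rewrite lactDl.
- by rewrite (lhomP _).1 lactDr.
- by rewrite coval_lin lhom_funDZ lactDr.
Qed.
Lemma co_retr_subproof (F : coind etaA W) :
  left_linear (X := MM) (Y := X)
    (fun m => tsum (fun b m t => lact b (lhom_fun (coval F t) m)) (sigma m)).
Proof.
have tri := co_retr_trilinear F; split=> [|a m].
  exact: (split_lin sigmaP tri).
rewrite (split_lact sigmaP tri) (lin_tsum _ _ (@lact_lin _ _ _ X a)).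
by apply: eq_tsum => b z t; rewrite lactA.
Qed.
(** A retraction of [co_unit]. For F(t) = t w and m the sum of the products b z t, the value is the
    sum of the terms b w(z t), which is w(m) by left linearity. *)
Definition co_retr (F : coind etaA W) : W := mk_lhom (co_retr_subproof F).
Lemma co_retrE F m : lhom_fun (co_retr F) m =
  tsum (fun b m t => lact b (lhom_fun (coval F t) m)) (sigma m).
Proof. by []. Qed.

Lemma co_retr_bihom : is_bihom co_retr.
Proof.
split=> [a F G|a F|F a]; apply: lhom_ext => m.
- rewrite lhom_funDZ !co_retrE -tsumDZ; apply: eq_tsum => b z t.
  by rewrite [coval _ _](coval_linl t) lhom_funDZ lactDr.
- rewrite lhom_lactE !co_retrE (split_ract sigmaP (co_retr_trilinear F)).
  by [].
- rewrite lhom_ractE !co_retrE (lin_tsum _ _ (@ract_lin _ _ _ X a)).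
  by apply: eq_tsum => b z t; rewrite coval_ract lhom_ractE lractA.
Qed.

Lemma co_retr_unit w : co_retr (co_unit etaA w) = w.
Proof.
apply: lhom_ext => m; rewrite co_retrE -[in RHS](split_id sigmaP m).
rewrite (lin_tsum _ _ (lhomP w).1); apply: eq_tsum => b z t.
by rewrite co_unitE lhom_lactE -lractA (lhomP w).2.
Qed.

(* [lhom MM X] is a bimodule retract of a coinduced bimodule because MM is
   projective, and coinduced bimodules are acyclic. *)
Lemma lhom_acyclic n (c : CA W n.+1) : dlt c = 0 -> exists h, c = dlt h.
Proof.
move=> c0; exists (postS co_retr_bihom (cur c)).
have /eqP := cur_dlt c; rewrite c0 (lin0 (@cur_lin _ _ _ _ _ _)) eq_sym subr_eq0.
move=> /eqP E; rewrite dlt_postS -E; apply: tenshom_ext => x.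
by rewrite postSE [RHS]co_retr_unit.
Qed.
End Retraction.

(** * The homotopy acting on the first factor in MM *)

Section FirstFactor.

(* Inserts the section of the multiplication at the first argument that has a
   component in MM. *)
Fixpoint split_first (V : lmodType k) n :
    (('I_n.+1 -> L) -> V) -> ('I_n -> L) -> V :=
  match n with
  | 0 => fun f x => 0
  | m.+1 => fun f x =>
      tsum (fun b z t => f (icons (inA b) (icons (inM (ract z t)) (itail x))))
        (sigma (prM (x ord0)))
      - split_first (fun y => f (icons (inA (prA (x ord0))) y)) (itail x)
  end.

Lemma split_firstS (V : lmodType k) n (f : ('I_n.+2 -> L) -> V) s y :
  split_first f (icons s y) =
  tsum (fun b z t => f (icons (inA b) (icons (inM (ract z t)) y))) (sigma (prM s))
  - split_first (fun y => f (icons (inA (prA s)) y)) y.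
Proof. by rewrite /= icons0 itail_icons. Qed.

Lemma split_first_lin (V V' : lmodType k) (g : V -> V') n :
  linear g -> forall (f : ('I_n.+1 -> L) -> V) x,
  split_first (fun y => g (f y)) x = g (split_first f x).
Proof.
move=> g_lin; elim: n => [|n IHn] f x /=; first by rewrite (lin0 g_lin).
by rewrite (linB g_lin) (lin_tsum _ _ g_lin) -IHn.
Qed.

Lemma split_firstB (V : lmodType k) n (f g : ('I_n.+1 -> L) -> V) x :
  split_first (fun y => f y - g y) x = split_first f x - split_first g x.
Proof.
elim: n f g x => [|n IHn] f g x /=; first by rewrite subrr.
by rewrite tsumB IHn !opprD !opprK addrACA.
Qed.

Lemma split_first_trilinear (V : lmodType k) n (f : ('I_n.+2 -> L) -> V) y :
  multilinear f ->
  trilinear (fun b z t => f (icons (inA b) (icons (inM (ract z t)) y))).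
Proof.
move=> fm; have fm' b := multilinear_icons b fm; split=> [z t|b t|b z] a u v.
- by rewrite linearP (multilinear_head _ fm).
- by rewrite ractDl inM_lin (multilinear_head y (fm' (inA b))).
- by rewrite ractDr inM_lin (multilinear_head y (fm' (inA b))).
Qed.

Section Tensor.
Variable Y : bimod R R.
Local Notation HY := (lhom L_R Y).
Local Notation HHY := (lhom L_R HY).

Lemma ins_trilinear (G : HHY) :
  trilinear (fun b z t => lhom_fun (lhom_fun G (inM (ract z t))) (inA b)).
Proof.
split=> [z t|b t|b z] a u v.
- by rewrite linearP (lhomP _).1.
- by rewrite ractDl inM_lin (lhomP _).1.
- by rewrite ractDr inM_lin (lhomP _).1.
Qed.

Lemma ins_subproof (G : HHY) : left_linear (X := L_R) (Y := Y) (fun s =>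
  tsum (fun b z t => lhom_fun (lhom_fun G (inM (ract z t))) (inA b))
    (sigma (prM s))).
Proof.
have tri := ins_trilinear G; split=> [|r s].
  exact: (linear_funcomp (split_lin sigmaP tri) prM_lin).
have [_ p2 _] := prM_bihom; rewrite p2 (split_lact sigmaP tri).
rewrite (lin_tsum _ _ (@lact_lin _ _ _ Y r)); apply: eq_tsum => b z t.
rewrite -(lhomP _).2; congr (lhom_fun _ _).
by rewrite rmorphM /= -etaLE.
Qed.
Definition ins (G : HHY) : HY := mk_lhom (ins_subproof G).
Lemma insE G s : lhom_fun (ins G) s =
  tsum (fun b z t => lhom_fun (lhom_fun G (inM (ract z t))) (inA b))
    (sigma (prM s)).
Proof. by []. Qed.
Lemma ins_bihom : is_bihom ins.
Proof.
split=> [a F G|r F|F r]; apply: lhom_ext => s.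
- by rewrite lhom_funDZ !insE -tsumDZ; apply: eq_tsum => b z t; rewrite !lhom_funDZ.
- rewrite lhom_lactE !insE; have [_ _ p3] := prM_bihom.
  rewrite p3 (split_ract sigmaP (ins_trilinear F)); apply: eq_tsum => b z t.
  rewrite lhom_lactE; congr (lhom_fun (lhom_fun F _) _).
  rewrite -[LHS]/(inM (ract z t) * etaL r) etaLE mulMA.
  by rewrite ractA.
- rewrite lhom_ractE !insE (lin_tsum _ _ (@ract_lin _ _ _ Y r)).
  by apply: eq_tsum.
Qed.

Lemma atA_subproof (F : HY) :
  left_linear (X := L_R) (Y := Y) (fun s => lhom_fun F (inA (prA s))).
Proof.
split=> [a u v|r s]; first by rewrite !linearP (lhomP F).1.
rewrite -(lhomP F).2; congr lhom_fun.
by rewrite -[lact r s]/(etaL r * s) !rmorphM /= prA_eta -etaLE.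
Qed.
Definition atA (F : HY) : HY := mk_lhom (atA_subproof F).
Lemma atA_bihom : is_bihom atA.
Proof.
split=> [a F G|r F|F r]; apply: lhom_ext => s //.
rewrite -[LHS]/(lhom_fun F (inA (prA s) * etaL r : L)).
rewrite -[RHS]/(lhom_fun F (inA (prA (s * etaL r)))); congr lhom_fun.
by rewrite !rmorphM /= prA_eta -etaLE.
Qed.
End Tensor.

(** After currying, the recursion is a difference of two postcompositions with R-bimodule maps:
    [ins], which inserts the section in two curried arguments, and [atA], which projects the first
    argument to AA. *)
Lemma split_first_tenshom n : forall (Y : bimod R R) (f : tenshom L_R Y n.+1),
  is_tenshom (X := L_R) (Y := Y) (split_first f).
Proof.
elim: n => [|n IHn] Y f.
  exact: (tenshomP (0 : tenshom L_R Y 0)).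
pose f' := tcurry (lhom_spec L_R Y) f.
pose f'' := tcurry (lhom_spec L_R (lhom L_R Y)) f'.
have := tuncurry_tenshom (lhom_spec L_R Y)
  (tenshomP (post (ins_bihom Y) f'' - post (atA_bihom Y) (mk_tenshom (IHn _ f')))).
congr is_tenshom; apply/funext => x; rewrite -(icons_eta x).
rewrite split_firstS icons0 itail_icons.
rewrite -[LHS]/(lhom_fun (ins (f'' (itail x))) (x ord0)
  - lhom_fun (split_first f' (itail x)) (inA (prA (x ord0)))).
rewrite insE; congr (_ - _).
exact: (esym (@split_first_lin _ _
  (fun F : lhom L_R Y => lhom_fun F (inA (prA (x ord0)))) n (fun _ _ _ => erefl)
  f' (itail x))).
Qed.

(** By the product rule [prM_mul], the part of s t in MM has two terms. In one, the AA-part of s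
    moves to the left factor of the section; in the other, t is absorbed on the right of the section
    of the MM-part of s. *)
Lemma split_first_mul (V : lmodType k) n (f : ('I_n.+2 -> L) -> V) s t z :
  multilinear f ->
  split_first f (icons (s * t) z) =
  tsum (fun b w c => f (icons (inA b) (icons (inM (ract w c) * t) z)))
    (sigma (prM s))
  + split_first (fun y => f (icons (inA (prA s) * y ord0) (itail y))) (icons t z).
Proof.
move=> fm; have tri := split_first_trilinear z fm.
rewrite !split_firstS prM_mul (linD (split_lin sigmaP tri)).
rewrite (split_lact sigmaP tri) (split_ract sigmaP tri) [X in X - _]addrC -addrA.
congr (_ + (_ - _)).
- by apply: eq_tsum => b w c; rewrite inM_mulr ractA.
- by apply: eq_tsum => b w c; rewrite icons0 itail_icons rmorphM.
- congr (split_first _ z); apply/funext => y.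
  by rewrite icons0 itail_icons !rmorphM.
Qed.

(** The section is inserted at one place only, so the merges at this place recompose the argument
    and those elsewhere cancel in pairs. What remains telescopes from the given arguments to their
    projections to AA. The last term of [rcobound] drops when its argument is in MM, which acts by
    zero. *)
Lemma split_first_rcobound (X : bimod AA AA) n
    (f : ('I_n.+1 -> L) -> restr prA X) x : multilinear f ->
  split_first (rcobound f) x + rcobound (split_first f) x
  = f x - f (fun i => inA (prA (x i))).
Proof.
have ract_inM (y : restr prA X) m : ract y (inM m) = 0.
  by rewrite -[LHS]/(ract (y : X) (prA (inM m))) prA_inM ract0r.
elim: n f x => [|n IHn] f x fm; rewrite -(icons_eta x); set s := x ord0;
  set y := itail x; rewrite (icons_comp (fun t : L => inA (prA t))).
  rewrite split_firstS /= subr0 rcobound0 /= ract0l addr0.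
  rewrite (_ : icons (inA _) _ = icons (inA (prA s)) y); last first.
    by congr icons; exact: ituple0.
  rewrite -(linB (multilinear_head y fm)).
  (* The right-hand side is f at the MM-part of s, which the section writes as a sum of products b
     (z t); merging the two factors gives back exactly this. *)
  have -> : s - inA (prA s) = inM (prM s) by rewrite {1}(decomp s) addrAC subrr add0r.
  rewrite -[in RHS](split_id sigmaP (prM s)) (lin_tsum _ _ inM_lin).
  rewrite (lin_tsum _ _ (multilinear_head y fm)); apply: eq_tsum => b z t.
  rewrite rcoboundS rcobound0 icons0 itail_icons ract_inM subr0 mulAM.
  by rewrite lractA.
have f_lin := multilinear_head y fm.
have E1 : tsum (fun b z t => rcobound f (icons (inA b) (icons (inM (ract z t)) y)))
    (sigma (prM s))
  = f (icons (inM (prM s)) y)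
    - (tsum (fun b z t => f (icons (inA b)
               (icons (inM (ract z t) * y ord0) (itail y)))) (sigma (prM s))
       - tsum (fun b z t => rcobound
               (fun v => f (icons (inA b) (icons (inM (ract z t)) v))) y)
           (sigma (prM s))).
  rewrite -[in f (icons (inM _) y)](split_id sigmaP (prM s)).
  rewrite (lin_tsum _ _ inM_lin) (lin_tsum _ _ f_lin) -!tsumB.
  apply: eq_tsum => b z t; rewrite !rcoboundS !icons0 !itail_icons.
  by rewrite mulAM lractA.
have E2 : split_first (fun v => rcobound f (icons (inA (prA s)) v)) y
  = split_first (fun v => f (icons (inA (prA s) * v ord0) (itail v))) y
    - split_first (rcobound (fun v => f (icons (inA (prA s)) v))) y.
  by rewrite -split_firstB; congr split_first; apply/funext => v; rewrite rcoboundS.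
have E3 : rcobound (fun v => split_first f (icons s v)) y
  = tsum (fun b z t => rcobound
               (fun v => f (icons (inA b) (icons (inM (ract z t)) v))) y)
           (sigma (prM s))
    - rcobound (split_first (fun v => f (icons (inA (prA s)) v))) y.
  rewrite -rcobound_tsum -rcoboundB; congr (rcobound _ y).
  by apply/funext => v; rewrite split_firstS.
(* The two sums from [split_first_mul] cancel against the first merges in E1 and E2, and the inner
   coboundaries of E1 against those of E3. The induction hypothesis, with [inA (prA s)] frozen in
   front, handles the rest. *)
rewrite split_firstS E1 E2 rcoboundS E3 split_first_mul // icons_eta add_cancel.
rewrite (IHn _ y (multilinear_icons _ fm)) addrA; congr (_ - _).
by rewrite [in RHS](decomp s) (linD f_lin) addrC.
Qed.
End FirstFactor.

(** * Normal form of cocycles *)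

Section NormalForm.
Variable X : bimod AA AA.
Local Notation W := (lhom MM X).

Definition fsplit n (f : CL X n.+1) : CL X n :=
  mk_tenshom (split_first_tenshom f).

Lemma avgl_trilinear (F : coind etaL (restr prA X)) :
  trilinear (fun b z t => lact b (coval F (inM (ract z t)) : X)).
Proof.
split=> [z t|b t|b z] a u v.
- by rewrite lactDl.
- by rewrite ractDl inM_lin coval_lin lactDr.
- by rewrite ractDr inM_lin coval_lin lactDr.
Qed.
Lemma avgl_subproof (F : coind etaL (restr prA X)) :
  left_linear (X := MM) (Y := X)
    (fun m => tsum (fun b z t => lact b (coval F (inM (ract z t)) : X)) (sigma m)).
Proof.
have tri := avgl_trilinear F; split=> [|a m].
  exact: (split_lin sigmaP tri).
rewrite (split_lact sigmaP tri) (lin_tsum _ _ (@lact_lin _ _ _ X a)).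
by apply: eq_tsum => b z t; rewrite lactA.
Qed.
Definition avgl (F : coind etaL (restr prA X)) : W := mk_lhom (avgl_subproof F).
Lemma avglE F m : lhom_fun (avgl F) m =
  tsum (fun b z t => lact b (coval F (inM (ract z t)) : X)) (sigma m).
Proof. by []. Qed.

Lemma avgl_bihom :
  is_bihom (X := restr etaL (coind etaL (restr prA X)))
    (Y := restr etaL (restr prA W)) avgl.
Proof.
split=> [a F G|r F|F r]; apply: lhom_ext => m.
- rewrite lhom_funDZ !avglE -tsumDZ; apply: eq_tsum => b z t.
  by rewrite -lactDr.
- rewrite -[RHS]/(lhom_fun (avgl F) (ract m (prA (etaL r)))) !avglE.
  rewrite (split_ract sigmaP (avgl_trilinear F)); apply: eq_tsum => b z t.
  by rewrite -[coval (lact r F) _]/(coval F (_ * etaL r)) inM_mulr ractA.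
- rewrite -[RHS]/(ract (lhom_fun (avgl F) m) (prA (etaL r))) !avglE.
  rewrite (lin_tsum _ _ (@ract_lin _ _ _ X _)); apply: eq_tsum => b z t.
  by rewrite -lractA.
Qed.

(* Restriction of a cochain to tensors with first factor in MM, made left
   linear in that factor. *)
Definition headM n (f : CL X n.+1) : CL W n := post avgl_bihom (cur f).

Lemma tailM_subproof (F : W) :
  left_linear (X := lrestr etaL (regbimod L)) (Y := lrestr etaL (restr prA X))
    (fun s => lhom_fun F (prM s)).
Proof.
split=> [a u v|r s]; first by rewrite prM_lin (lhomP F).1.
rewrite -[lact r s]/(etaL r * s) prM_mul prM_eta ract0l addr0 (lhomP F).2.
by [].
Qed.
Definition tailM (F : W) : coind etaL (restr prA X) := mk_lhom (tailM_subproof F).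
Lemma tailM_bihom :
  is_bihom (X := restr etaL (restr prA W))
    (Y := restr etaL (coind etaL (restr prA X))) tailM.
Proof.
split=> [a F G|r F|F r]; apply: (coind_ext (eta := etaL)) => s //.
rewrite -[RHS]/(lhom_fun F (prM (s * etaL r))) prM_mul prM_eta lact0r add0r.
by [].
Qed.

Definition consM n (g : CL W n) : CL X n.+1 :=
  tuncurry (coind_spec etaL (restr prA X)) (post tailM_bihom g).
Lemma consME n (g : CL W n) s y : consM g (icons s y) = lhom_fun (g y) (prM s).
Proof. exact: (tuncurryE (coind_spec etaL (restr prA X)) (post tailM_bihom g)). Qed.

Lemma consM_lin n : linear (@consM n).
Proof.
apply: (linear_funcomp (@tuncurry_lin _ _ _ _ _ (coind_spec etaL (restr prA X)) n)).
exact: post_lin.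
Qed.

Lemma consM_inj n (g : CL W n) : consM g = 0 -> g = 0.
Proof.
move=> g0; apply: tenshom_ext => y; apply: lhom_ext => m.
by rewrite -[m]inMK -consME g0.
Qed.

(** In the merge of the first two arguments, [prM_mul] gives two terms. The one with the AA-part of
    s cancels the left action on X by left linearity, and the other is the left action on Hom_AA(MM,
    X). The sign comes from the shift by one argument. *)
Lemma dlt_consM n (g : CL W n) : dlt (consM g) = - consM (dlt g).
Proof.
apply: tenshom_ext => x; rewrite -(icons_eta x); set s := x ord0.
set y := itail x; rewrite -[RHS]/(- consM (dlt g) (icons s y)) consME !dltE.
rewrite !hcoboundE icons0 itail_icons rcoboundS consME.
rewrite -[in lact s _](icons_eta y) consME.
have E : rcobound (Y := restr prA X) (fun v => consM g (icons s v)) y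
    = lhom_fun (rcobound (Y := restr prA W) g y : W) (prM s).
  rewrite -(@rcobound_comp _ L L L L id (fun _ _ => erefl) (restr prA W)
    (restr prA X) (fun F : W => lhom_fun F (prM s)) n g y) //.
  by congr (rcobound _ y); apply/funext => v; rewrite consME.
rewrite E -[lhom_fun (_ - _) _]/(
  lhom_fun (lact (y ord0) (g (itail y) : restr prA W)) (prM s)
  - lhom_fun (rcobound (Y := restr prA W) g y : W) (prM s)).
rewrite !opprB addrCA; congr (_ + _).
rewrite -[lact s _]/(lact (prA s) (lhom_fun (g (itail y)) (prM (y ord0)))).
rewrite -[RHS]/(- lhom_fun (g (itail y)) (ract (prM s) (prA (y ord0)))).
rewrite prM_mul (linD (lhomP _).1).
by rewrite (lhomP _).2 opprD addrA subrr add0r.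
Qed.

(** [split_first_rcobound] accounts for the merges and the right action. From the left action only
    the terms with the section in front survive, and they form [consM (headM f)]. *)
Lemma fsplit_htpy n (f : CL X n.+1) :
  dlt (fsplit f) + fsplit (dlt f) = consM (headM f) - f + infl (resA f).
Proof.
have fm := tenshom_multilinear (tenshomP f).
apply: tenshom_ext => x.
rewrite -[LHS]/(hcobound (Y := restr prA X) (split_first f) x
  + split_first (hcobound (Y := restr prA X) f) x).
rewrite -[RHS]/(consM (headM f) x - f x + f (fun i => inA (prA (x i)))).
rewrite hcoboundE (_ : hcobound (Y := restr prA X) f = fun y =>
  lact (y ord0) (f (itail y) : restr prA X) - rcobound (Y := restr prA X) f y);
  last by apply/funext => y; rewrite hcoboundE.
rewrite split_firstB addrACA -opprD [rcobound _ _ + _]addrC.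
rewrite (split_first_rcobound _ fm) opprB addrA; rewrite [RHS]addrAC.
congr (_ + _ - _); rewrite -(icons_eta x) consME icons0 itail_icons.
rewrite split_firstS (_ : split_first (fun v : 'I_n.+1 -> L => _) (itail x)
    = lact (x ord0) (split_first f (itail x) : restr prA X)).
  rewrite addrC subrK.
  rewrite -[RHS]/(tsum
    (fun b z t => lact b (coval (cur f (itail x)) (inM (ract z t)) : X))
    (sigma (prM (x ord0)))).
  apply: eq_tsum => b z t; rewrite icons0 itail_icons curE.
  rewrite -[LHS]/(lact (prA (inA b)) (f (icons (inM (ract z t)) (itail x)) : X)).
  by rewrite inAK.
rewrite -(split_first_lin (@lact_lin _ _ _ (restr prA X) (x ord0))).
congr (split_first _ (itail x)); apply/funext => v; rewrite icons0 itail_icons.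
rewrite -[LHS]/(lact (prA (inA (prA (x ord0)))) (f v : X)) inAK.
by [].
Qed.

Lemma ext_consM n (t : tenshom MM X n.+1) :
  ext t = consM (ext (tcurry (lhom_spec MM X) t)).
Proof.
apply: tenshom_ext => x; rewrite -(icons_eta x) consME !extE icons_comp.
by rewrite -(tcurryE (lhom_spec MM X)).
Qed.
End NormalForm.

(** By [ext_consM], an extension by zero arises from a central element in degree 0 by iterating
    [consM], which preserves cocycles. *)
Lemma dlt_ext n : forall X (t : tenshom MM X n), dlt (ext t) = 0.
Proof.
elim: n => [|n IHn] X t; last first.
  by rewrite ext_consM dlt_consM IHn (lin0 (@consM_lin _ _)) oppr0.
have [_ _ _ _ t5] := tenshomP t.
apply: tenshom_ext => x; rewrite dltE hcoboundE rcobound0 extE.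
by rewrite [lact _ _]t5 // subrr.
Qed.

Lemma cocycle_decomposition X n (f : CL X n.+1) : dlt f = 0 ->
  f = infl (resA f) + consM (headM f) - dlt (fsplit f).
Proof.
move=> f0; have := fsplit_htpy f; rewrite f0 (_ : fsplit 0 = 0).
  rewrite addr0 => ->; apply/esym/eqP.
  by rewrite subr_eq addrA [f + _]addrC subrK addrC.
apply: tenshom_ext => x; rewrite -[LHS]/(split_first (fun _ => 0) x).
rewrite (_ : (fun _ => 0) = (fun _ : 'I_n.+2 -> L => 0 - 0 : restr prA X)).
  by rewrite split_firstB subrr.
by apply/funext => y; rewrite subr0.
Qed.

(** [consM] is injective and anticommutes with the coboundary, so it is enough that
    [consM (headM f)] is a cocycle; the decomposition expresses it through cocycles. *)
Lemma dlt_headM X n (f : CL X n.+1) : dlt f = 0 -> dlt (headM f) = 0.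
Proof.
move=> f0; apply: consM_inj; apply/eqP; rewrite -oppr_eq0 -dlt_consM; apply/eqP.
have := congr1 (@dlt _ _ _ _ _ _) (cocycle_decomposition f0).
rewrite (linB (@dlt_lin _ _ _ _ _ _)) (linD (@dlt_lin _ _ _ _ _ _)) dlt_dlt.
rewrite dlt_infl dlt_resA f0 (lin0 (@resA_lin _ _)) (lin0 (@infl_lin _ _)).
by rewrite add0r subr0.
Qed.

Section DegreeZero.
Variables (X : bimod AA AA) (g : CL X 0).
Hypothesis g0 : dlt g = 0.
Lemma central_tenshom :
  is_tenshom (fun _ : 'I_0 -> MM => g (@inil _ L) : X).
Proof.
split=> [x []//|x []//|x []//|x []//|_ x s].
have := congr1 (fun h : CL X 1 => h (fun=> inA s)) g0.
rewrite dltE hcoboundE rcobound0 (ituple0 (itail _) (@inil _ L)) => /eqP.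
rewrite subr_eq0 => /eqP.
rewrite -[lact (inA s) _]/(lact (prA (inA s)) (g (@inil _ L) : X)).
by rewrite -[ract _ (inA s)]/(ract (g (@inil _ L) : X) (prA (inA s))) inAK.
Qed.
Lemma central_ext : g = ext (mk_tenshom central_tenshom).
Proof. by apply: tenshom_ext => x; rewrite extE (ituple0 x (@inil _ L)). Qed.
End DegreeZero.

(** Up to a coboundary, f is the inflation of its restriction plus [consM (headM f)], and [headM f]
    is a cocycle of lower degree in Hom_AA(MM, X). In degree 0 it is a central element. In higher
    degrees its normal form has a bounding inflated part by [lhom_acyclic], and uncurrying the
    multilinear part gives t. *)
Lemma normal_form n : forall X (f : CL X n.+1), dlt f = 0 ->
  exists (c : CA X n.+1) (t : tenshom MM X n.+1),
    dlt c = 0 /\ cob (f - (infl c + ext t)).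
Proof.
elim: n => [|n IHn] X f f0; exists (resA f).
  exists (tuncurry (lhom_spec MM X) (mk_tenshom (central_tenshom (dlt_headM f0)))).
  split; first by rewrite dlt_resA f0 (lin0 (@resA_lin _ _)).
  exists (- fsplit f); rewrite (linN (@dlt_lin _ _ _ _ _ _)).
  rewrite ext_consM tuncurryK -central_ext {1}(cocycle_decomposition f0).
  by rewrite addrAC subrr add0r.
have [c1 [t1 [/lhom_acyclic[h2 ->] [h1 h1E]]]] := IHn _ _ (dlt_headM f0).
exists (tuncurry (lhom_spec MM X) t1).
split; first by rewrite dlt_resA f0 (lin0 (@resA_lin _ _)).
(* The sign in front of [consM] compensates the one in [dlt_consM]: the coboundary of the first term
   is [consM (headM f - ext t1)]. *)
exists (- consM (infl h2 + h1) - fsplit f).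
rewrite (linB (@dlt_lin _ _ _ _ _ _)) (linN (@dlt_lin _ _ _ _ _ _)) dlt_consM opprK.
rewrite (linD (@dlt_lin _ _ _ _ _ _)) dlt_infl -h1E ext_consM tuncurryK.
rewrite (_ : infl _ + (_ - _) = headM f - ext t1); last by rewrite opprD addrCA addNKr.
rewrite (linB (@consM_lin _ _)).
rewrite {1}(cocycle_decomposition f0) opprD addrA [infl _ + _]addrC.
by rewrite [X in X - _ = _]addrAC addrK addrAC.
Qed.
(** The vanishing of MM MM lets L act on MM through AA, which makes [inM] L-bilinear. The splittings
    [prM] and [inA] of the extension of bimodules are used over R only; they split it at the level
    of cochains. *)
Lemma sz_inM_bihom : is_bihom (X := restr prA MM) (Y := regbimod L) inM.
Proof.
split=> [a x y|s x|x s]; first exact: inM_lin.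
- rewrite -[RHS]/(s * inM x) {2}(decomp s) mulrDl mulMM addr0.
  by rewrite mulAM.
- by rewrite -[RHS]/(inM x * s) inM_mulr.
Qed.

Lemma sz_prA_bihom : is_bihom (X := regbimod L) (Y := restr prA (regbimod AA)) prA.
Proof.
by split=> [a x y|s x|x s]; [exact: linearP|exact: rmorphM|exact: rmorphM].
Qed.

Lemma sz_prM_bihom :
  is_bihom (X := restr etaL (regbimod L)) (Y := restr etaL (restr prA MM)) prM.
Proof.
have [p1 p2 p3] := prM_bihom; have [r1 r2 r3] := restr_id_bihom MM.
split=> [a x y|s x|x s]; first exact: p1.
- by rewrite p2; exact: r2.
- by rewrite p3; exact: r3.
Qed.

Lemma sz_inA_bihom :
  is_bihom (X := restr etaL (restr prA (regbimod AA)))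
    (Y := restr etaL (regbimod L)) inA.
Proof.
have [p1 p2 p3] := inA_bihom; have [r1 r2 r3] := restr_id_bihom' (regbimod AA).
split=> [a x y|s x|x s]; first exact: p1.
- by rewrite [lact s x]r2 p2.
- by rewrite [ract x s]r3 p3.
Qed.
End SquareZero.

(** * The long exact sequence *)

(** Maps in cohomology are first given as relations between classes having suitable representatives;
    the last hypothesis is then independence of the representatives. *)
Lemma linear_relation (k : fieldType) (V W : lmodType k) (rel : V -> W -> Prop) :
  (forall (a : k) v v' w w', rel v w -> rel v' w' ->
     rel (a *: v + v') (a *: w + w')) ->
  (forall v, exists w, rel v w) -> (forall w, rel 0 w -> w = 0) ->
  exists f : {linear V -> W}, forall v w, rel v w <-> w = f v.
Proof.
move=> rel_lin rel_tot rel0.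
have rel_fun v w w' : rel v w -> rel v w' -> w = w'.
  move=> vw vw'; apply/eqP; rewrite -subr_eq0; apply/eqP/rel0.
  have := rel_lin (-1) _ _ _ _ vw' vw.
  by rewrite !scaleN1r addNr addrC.
have [f fP] := choice rel_tot.
have f_lin : linear f.
  by move=> a u v; apply: rel_fun (fP _) _; exact: rel_lin.
pose F : {linear V -> W} := HB.pack f (GRing.isLinear.Build k V W _ f f_lin).
exists F => v w; split=> [vw|->]; first exact: rel_fun vw (fP v).
exact: fP.
Qed.

Section Realization.
Variables (k : fieldType) (R S : algType k) (eta : {lrmorphism R -> S}).
Local Notation CC Y n := (relcochain eta Y n).

(* [rep v f]: the cocycle f represents the element v of V, the latter space
   being identified by means of rep with the n-th cohomology space of CC Y. *)
Record realizes (V : lmodType k) (Y : bimod S S) n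
    (rep : V -> CC Y n -> Prop) : Prop := {
  rep_lin : forall (a : k) v v' f f', rep v f -> rep v' f' ->
    rep (a *: v + v') (a *: f + f');
  rep_tot : forall v, exists f, rep v f;
  rep_coc : forall v f, rep v f -> dlt f = 0;
  rep_surj : forall f, dlt f = 0 -> exists v, rep v f;
  rep_zero : forall v f, rep v f -> (v = 0 <-> cob f)
}.

Section Facts.
Variables (V : lmodType k) (Y : bimod S S) (n : nat) (rep : V -> CC Y n -> Prop).
Hypothesis repP : realizes rep.

Lemma rep_cohom v w f g : rep v f -> rep w g -> cob (f - g) -> v = w.
Proof.
move=> vf wg /(rep_zero repP _).2 H; apply/eqP; rewrite -subr_eq0; apply/eqP.
apply: H; have := rep_lin repP (-1) wg vf.
by rewrite !scaleN1r ![- _ + _]addrC.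
Qed.

Lemma rep_uniq v w f : rep v f -> rep w f -> v = w.
Proof. by move=> vf wf; apply: rep_cohom vf wf _; rewrite subrr; exact: cob0. Qed.

End Facts.

Lemma induced_map (V W : lmodType k) (Y Z : bimod S S) n
    (rep : V -> CC Y n -> Prop) (rep' : W -> CC Z n -> Prop)
    (g : Y -> Z) (gP : is_bihom g) :
  realizes rep -> realizes rep' ->
  exists f : {linear V -> W}, forall v c, rep v c -> rep' (f v) (postS gP c).
Proof.
move=> repP repP'.
have g_lin := @postS_lin _ _ _ eta _ _ n _ gP.
have [|v|w|f fP] := @linear_relation k V W
    (fun v w => exists2 c, rep v c & rep' w (postS gP c)).
- move=> a v v' w w' [c vc wc] [c' vc' wc']; exists (a *: c + c').
    exact: (rep_lin repP).
  by rewrite g_lin; exact: (rep_lin repP').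
- have [c vc] := rep_tot repP v.
  have [|w wc] := rep_surj repP' (f := postS gP c); last by exists w, c.
  by rewrite dlt_postS (rep_coc repP vc) (lin0 (@postS_lin _ _ _ _ _ _ _ _ gP)).
- move=> [c vc wc]; apply/(rep_zero repP' wc).
  by apply: cob_postS; apply/(rep_zero repP vc).
exists f => v c vc.
have [|w wc] := rep_surj repP' (f := postS gP c).
  by rewrite dlt_postS (rep_coc repP vc) (lin0 (@postS_lin _ _ _ _ _ _ _ _ gP)).
by rewrite -((fP v w).1 _) //; exists c.
Qed.
End Realization.

Section LongExactSequence.
Variables (k : fieldType) (R S : algType k) (eta : {lrmorphism R -> S}).
Local Notation CC Y n := (relcochain eta Y n).
Variables (Y1 Y2 Y3 : bimod S S).
Variables (i : Y1 -> Y2) (p : Y2 -> Y3) (q : Y2 -> Y1) (r : Y3 -> Y2).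
Hypothesis iP : is_bihom i.
Hypothesis pP : is_bihom p.
Hypothesis qP : is_bihom (X := restr eta Y2) (Y := restr eta Y1) q.
Hypothesis rP : is_bihom (X := restr eta Y3) (Y := restr eta Y2) r.
Hypothesis qi : forall y, q (i y) = y.
Hypothesis pi : forall y, p (i y) = 0.
Hypothesis pr : forall y, p (r y) = y.
Hypothesis riqp : forall y, y = r (p y) + i (q y).

Let i_lin n := @postS_lin _ _ _ eta _ _ n _ iP.
Let p_lin n := @postS_lin _ _ _ eta _ _ n _ pP.
Let dl Y n := @dlt_lin _ _ _ eta Y n.

Lemma lift_cochain n (y : CC Y3 n) : postS pP (post rP y) = y.
Proof. by apply: tenshom_ext => x; exact: pr. Qed.

Lemma post_pi n (w : CC Y1 n) : postS pP (postS iP w) = 0.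
Proof. by apply: tenshom_ext => x; exact: pi. Qed.

Lemma ker_p n (t : CC Y2 n) : postS pP t = 0 -> t = postS iP (post qP t).
Proof.
move=> t0; apply: tenshom_ext => x; rewrite [LHS]riqp.
rewrite -[p _]/(postS pP t x) t0.
by rewrite [r _](lin0 (bihom_linear rP)) add0r.
Qed.

Lemma inj_i n (w w' : CC Y1 n) : postS iP w = postS iP w' -> w = w'.
Proof.
move=> E; apply: tenshom_ext => x; rewrite -[LHS]qi -[RHS]qi.
by rewrite -[i (w x)]/(postS iP w x) E.
Qed.

Lemma dlt_i n (w : CC Y1 n) : dlt (postS iP w) = 0 -> dlt w = 0.
Proof. by rewrite dlt_postS -(lin0 (@i_lin _)); exact: inj_i. Qed.

(** A primitive of the image of t lifts along r, and subtracting its coboundary puts t in the kernel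
    of p. In degree 0 coboundaries are zero and nothing has to be subtracted. *)
Lemma cob_p n (t : CC Y2 n) : cob (postS pP t) ->
  exists w, cob (t - postS iP w).
Proof.
case: n t => [|n] t.
  by move=> /ker_p tE; exists (post qP t); rewrite {1}tE subrr.
move=> [h hE]; have /ker_p E : postS pP (t - dlt (post rP h)) = 0.
  by rewrite (linB (@p_lin _)) -dlt_postS lift_cochain hE subrr.
exists (post qP (t - dlt (post rP h))).
by rewrite -E subKr; exists (post rP h).
Qed.

Variable n : nat.
Variables (V1 V2 V3 V4 V5 : lmodType k).
Variables (rep1 : V1 -> CC Y2 n -> Prop) (rep2 : V2 -> CC Y3 n -> Prop).
Variables (rep3 : V3 -> CC Y1 n.+1 -> Prop) (rep4 : V4 -> CC Y2 n.+1 -> Prop).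
Variable rep5 : V5 -> CC Y3 n.+1 -> Prop.
Hypotheses (rep1P : realizes rep1) (rep2P : realizes rep2).
Hypotheses (rep3P : realizes rep3) (rep4P : realizes rep4).
Hypothesis rep5P : realizes rep5.
Hypothesis van_n : forall w : CC Y1 n, dlt w = 0 -> cob w.
Hypothesis van_n2 : forall w : CC Y1 n.+2, dlt w = 0 -> cob w.

Lemma connecting_lift m (y : CC Y3 m) : dlt y = 0 ->
  exists w, dlt (post rP y) = postS iP w /\ dlt w = 0.
Proof.
move=> y0; have /ker_p E : postS pP (dlt (post rP y)) = 0.
  by rewrite -dlt_postS lift_cochain.
by exists (post qP (dlt (post rP y))); split=> //; apply: dlt_i; rewrite -E dlt_dlt.
Qed.

(** The lift t is arbitrary rather than the one given by r: exactness at the third term requires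
    evaluating the map on a lift coming from a primitive. *)
Lemma connecting_map : exists f : {linear V2 -> V3}, forall v t w,
  rep2 v (postS pP t) -> dlt t = postS iP w -> rep3 (f v) w.
Proof.
have coc_w (t : CC Y2 n) w : dlt t = postS iP w -> dlt w = 0.
  by move=> E; apply: dlt_i; rewrite -E dlt_dlt.
have [|v|z|f fP] := @linear_relation k V2 V3 (fun v z =>
    exists t w, [/\ rep2 v (postS pP t), dlt t = postS iP w & rep3 z w]).
- move=> a v v' z z' [t [w [vt tw zw]]] [t' [w' [vt' tw' zw']]].
  exists (a *: t + t'), (a *: w + w'); split.
  + by rewrite p_lin; exact: (rep_lin rep2P).
  + by rewrite dl i_lin tw tw'.
  + exact: (rep_lin rep3P).
- have [y vy] := rep_tot rep2P v.
  have [w [E w0]] := connecting_lift (rep_coc rep2P vy).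
  have [z zw] := rep_surj rep3P w0.
  by exists z, (post rP y), w; rewrite lift_cochain.
- move=> [t [w [vt tw zw]]]; apply/(rep_zero rep3P zw).
  have /cob_p[w1 tc] := (rep_zero rep2P vt).1 erefl.
  exists w1; apply: inj_i; rewrite -tw -dlt_postS; apply/eqP.
  by rewrite -subr_eq0 -(linB (@dl _ _)) (cob_dlt tc).
exists f => v t w vt tw; have [z zw] := rep_surj rep3P (coc_w t w tw).
by rewrite -((fP v z).1 _) //; exists t, w.
Qed.

(** The vanishing of the cohomology of Y1 in degree n makes the first map injective, and in degree n
    + 2 the last one surjective. The final clause retains the description of the connecting map on
    cochains. *)
Lemma long_exact_sequence :
  exists (f1 : {linear V1 -> V2}) (f2 : {linear V2 -> V3})
         (f3 : {linear V3 -> V4}) (f4 : {linear V4 -> V5}),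
    five_term_exact f1 f2 f3 f4 /\
    forall v t w, rep2 v (postS pP t) -> dlt t = postS iP w -> rep3 (f2 v) w.
Proof.
have [f1 f1P] := induced_map pP rep1P rep2P.
have [f2 f2P] := connecting_map.
have [f3 f3P] := induced_map iP rep3P rep4P.
have [f4 f4P] := induced_map pP rep4P rep5P.
exists f1, f2, f3, f4; split=> //; split.
- move=> u u' /eqP; rewrite -subr_eq0 -linearB => /eqP fu; apply/eqP.
  rewrite -subr_eq0; apply/eqP; have [t ut] := rep_tot rep1P (u - u').
  apply/(rep_zero rep1P ut).
  have /cob_p[w tc] := (rep_zero rep2P (f1P _ _ ut)).1 fu.
  rewrite -[t](subrK (postS iP w)); apply: cobD => //; apply/cob_postS/van_n.
  apply: dlt_i; have /eqP := cob_dlt tc.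
  by rewrite (linB (@dl _ _)) subr_eq0 (rep_coc rep1P ut) => /eqP <-.
- move=> v; split=> [fv|[u <-]].
    have [y vy] := rep_tot rep2P v.
    have [w [E w0]] := connecting_lift (rep_coc rep2P vy).
    have vt : rep2 v (postS pP (post rP y)) by rewrite lift_cochain.
    have [h hE] := (rep_zero rep3P (f2P _ _ _ vt E)).1 fv.
    have t0 : dlt (post rP y - postS iP h) = 0.
      by rewrite (linB (@dl _ _)) E dlt_postS hE subrr.
    have [u ut] := rep_surj rep1P t0; exists u.
    apply: (rep_uniq rep2P) vy; have := f1P _ _ ut.
    by rewrite (linB (@p_lin _)) post_pi subr0 lift_cochain.
  have [t ut] := rep_tot rep1P u.
  have E : dlt t = postS iP 0 by rewrite (rep_coc rep1P ut) (lin0 (@i_lin _)).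
  by apply/(rep_zero rep3P (f2P _ _ _ (f1P _ _ ut) E)); exact: cob0.
- move=> z; split=> [fz|[v <-]].
    have [w zw] := rep_tot rep3P z.
    have [t tE] := (rep_zero rep4P (f3P _ _ zw)).1 fz.
    have [|v vt] := rep_surj rep2P (f := postS pP t).
      by rewrite dlt_postS -tE post_pi.
    exists v; apply: (rep_uniq rep3P) zw.
    exact: f2P vt (esym tE).
  have [y vy] := rep_tot rep2P v.
  have [w [E w0]] := connecting_lift (rep_coc rep2P vy).
  have vt : rep2 v (postS pP (post rP y)) by rewrite lift_cochain.
  by apply/(rep_zero rep4P (f3P _ _ (f2P _ _ _ vt E))); rewrite -E; exists (post rP y).
- move=> u; split=> [fu|[z <-]].
    have [t ut] := rep_tot rep4P u.
    have /cob_p[w tc] := (rep_zero rep5P (f4P _ _ ut)).1 fu.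
    have [|z zw] := rep_surj rep3P (f := w).
      apply: dlt_i; have /eqP := cob_dlt tc.
      by rewrite (linB (@dl _ _)) subr_eq0 (rep_coc rep4P ut) => /eqP <-.
    exists z; apply/esym/(rep_cohom rep4P ut (f3P _ _ zw)).
    exact: tc.
  have [w zw] := rep_tot rep3P z.
  have := f4P _ _ (f3P _ _ zw); rewrite post_pi => H.
  by apply/(rep_zero rep5P H); exact: cob0.
- move=> v; have [y vy] := rep_tot rep5P v.
  have [w [E w0]] := connecting_lift (rep_coc rep5P vy).
  have [h hE] := van_n2 w0.
  have t0 : dlt (post rP y - postS iP h) = 0.
    by rewrite (linB (@dl _ _)) E dlt_postS hE subrr.
  have [u ut] := rep_surj rep4P t0; exists u.
  apply: (rep_uniq rep5P) vy; have := f4P _ _ ut.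
  by rewrite (linB (@p_lin _)) post_pi subr0 lift_cochain.
Qed.
End LongExactSequence.

(** * Null-square algebras *)

(** Moving an idempotent across the i-th argument twists its index by [c i], so crossing the whole
    tensor twists it by the sum of the c i. Currying reduces to one argument, the left action on Hom
    being the right action on that argument. *)
Lemma tenshom_parity (k : fieldType) (S : algType k) (X : bimod S S)
    (e : bool -> S) n :
  forall (Y : bimod S S) (f : tenshom X Y n) x (c : 'I_n -> bool),
  (forall i b, lact (e b) (x i) = ract (x i) (e (b (+) c i))) ->
  forall b, lact (e b) (f x) = ract (f x) (e (b (+) \big[addb/false]_i c i)).
Proof.
elim: n => [|n IHn] Y f x c xc b.
  by have [_ _ _ _ f5] := tenshomP f; rewrite big_ord0 addbF f5.
pose H := lhom_spec X Y; pose F := tcurry H f (itail x).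
have fE : f x = hev H F (x ord0) by rewrite tcurryE icons_eta.
rewrite fE -(hev_left H F).2 xc -hev_lact big_ord_recl addbA.
rewrite (IHn _ (tcurry H f) (itail x) (fun i => c (lift ord0 i))) ?hev_ract //.
by move=> i b'; exact: xc.
Qed.

Lemma odd_card n (s : {set 'I_n}) : odd #|s| = \big[addb/false]_i (i \in s).
Proof.
rewrite -sum1_card big_mkcond (big_morph odd oddD (erefl _)).
by apply: eq_bigr => i _; case: (i \in s).
Qed.

Section SumSplitting.
Variables (k : fieldType) (A B : algType k) (M : bimod B A) (N : bimod A B).
Local Notation AA := (A * B)%type.
Local Notation MM := (sumbimod M N).

Section Components.
Variables (W : lmodType k) (g : AA -> MM -> AA -> W).
Definition compM (b : B) (m : M) (a : A) : W := g (0, b) (m, 0) (a, 0).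
Definition compN (a : A) (m : N) (b : B) : W := g (a, 0) (0, m) (0, b).

Lemma pair0_lin (U V : lmodType k) : linear (fun v : V => (0 : U, v)).
Proof. by move=> a u v; congr pair; rewrite /= scaler0 addr0. Qed.
Lemma pair1_lin (U V : lmodType k) : linear (fun u : U => (u, 0 : V)).
Proof. by move=> a u v; congr pair; rewrite /= scaler0 addr0. Qed.

Lemma compM_trilinear : trilinear g -> trilinear compM.
Proof.
move=> [g1 g2 g3]; split=> [m a|b a|b m].
- exact: (linear_funcomp (g1 _ _) (@pair0_lin A B)).
- exact: (linear_funcomp (g2 _ _) (@pair1_lin M N)).
- exact: (linear_funcomp (g3 _ _) (@pair1_lin A B)).
Qed.
Lemma compN_trilinear : trilinear g -> trilinear compN.
Proof.
move=> [g1 g2 g3]; split=> [m a|b a|b m].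
- exact: (linear_funcomp (g1 _ _) (@pair1_lin A B)).
- exact: (linear_funcomp (g2 _ _) (@pair0_lin M N)).
- exact: (linear_funcomp (g3 _ _) (@pair0_lin A B)).
Qed.
End Components.

Variables (sM : M -> seq (B * M * A)) (sN : N -> seq (A * N * B)).
Hypotheses (sMP : splitting sM) (sNP : splitting sN).

Definition sum_split (x : MM) : seq (AA * MM * AA) :=
  [seq ((0, p.1.1), (p.1.2, 0), (p.2, 0)) | p <- sM x.1]
  ++ [seq ((p.1.1, 0), (0, p.1.2), (0, p.2)) | p <- sN x.2].

Lemma sum_splitE (W : lmodType k) (g : AA -> MM -> AA -> W) x :
  tsum g (sum_split x) = tsum (compM g) (sM x.1) + tsum (compN g) (sN x.2).
Proof. by rewrite /tsum /sum_split big_cat !big_map. Qed.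

Lemma sum_splitting : splitting sum_split.
Proof.
split=> [W g gtri a u v|W g gtri a m|W g gtri m a|m]; rewrite !sum_splitE.
- rewrite (split_lin sMP (compM_trilinear gtri)).
  by rewrite (split_lin sNP (compN_trilinear gtri)) scalerDr addrACA.
- rewrite (split_lact sMP (compM_trilinear gtri)).
  rewrite (split_lact sNP (compN_trilinear gtri)).
  by congr (_ + _); apply: eq_tsum => b z t; rewrite /compM /compN;
    congr (g _ _ _); congr pair; rewrite /= mulr0.
- rewrite (split_ract sMP (compM_trilinear gtri)).
  rewrite (split_ract sNP (compN_trilinear gtri)).
  by congr (_ + _); apply: eq_tsum => b z t; rewrite /compM /compN;
    congr (g _ _ _); congr pair; rewrite /= mul0r.
- rewrite (_ : compM _ = fun b z t => (ract (lact b z) t, 0 : N)); last first.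
    apply/funext => b; apply/funext => z; apply/funext => t.
    by congr pair; rewrite /= lact0r ract0r.
  rewrite (_ : compN _ = fun b z t => (0 : M, ract (lact b z) t)); last first.
    apply/funext => b; apply/funext => z; apply/funext => t.
    by congr pair; rewrite /= lact0r ract0r.
  rewrite -(lin_tsum _ _ (@pair0_lin M N)) -(lin_tsum _ _ (@pair1_lin M N)).
  rewrite (split_id sMP) (split_id sNP) [RHS]surjective_pairing.
  by congr pair; rewrite /= ?addr0 ?add0r.
Qed.
End SumSplitting.

Section NullSquareAlgebra.
Variables (k : fieldType) (A B : algType k) (M : bimod B A) (N : bimod A B).
Local Notation AA := (A * B)%type.
Local Notation MM := (sumbimod M N).
Local Notation LL := (nullsq M N).
Local Notation D := (k^o * k^o)%type.

Lemma prA_linear : linear (@prA k A B M N).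
Proof. by []. Qed.
HB.instance Definition _ := GRing.isLinear.Build k LL AA _ (@prA k A B M N) prA_linear.
Lemma prA_monoid : monoid_morphism (@prA k A B M N).
Proof. by split=> // -[[a n] [m b]] [[a' n'] [m' b']]. Qed.
HB.instance Definition _ :=
  GRing.isMonoidMorphism.Build LL AA (@prA k A B M N) prA_monoid.

Definition prAm : {lrmorphism LL -> AA} := @prA k A B M N.
Definition inAm : {lrmorphism AA -> LL} := @inA k A B M N.
Definition etaAm : {lrmorphism D -> AA} := @etaA k A B.

Lemma nullsq_square_zero :
  square_zero (MM := MM) etaAm (etaL M N) inAm prAm (@inM k A B M N) (@prM k A B M N).
Proof.
split.
- by [].
- by case.
- by case.
- by [].
- by [].
- move=> [[a n] [m b]]; congr ((_, _), (_, _)); rewrite /= ?addr0 ?add0r //.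
- move=> a u v; rewrite /inM.
  by congr ((_, _), (_, _)); rewrite /= scaler0 addr0.
- by [].
- move=> [a b] [m n]; rewrite /inM -[LHS]/(nullsq_mul (inA M N (a, b)) (inM (m, n))) /=.
  by congr ((_, _), (_, _)); rewrite /= ?mulr0 ?ract0l ?ract0r ?addr0 ?add0r.
- move=> [a b] [m n]; rewrite /inM -[LHS]/(nullsq_mul (inM (m, n)) (inA M N (a, b))) /=.
  by congr ((_, _), (_, _)); rewrite /= ?mul0r ?lact0l ?lact0r ?addr0 ?add0r.
- move=> [m n] [m' n']; rewrite -[LHS]/(nullsq_mul (inM (m, n)) (inM (m', n'))) /=.
  by congr ((_, _), (_, _)); rewrite /= ?mul0r ?lact0l ?ract0r ?addr0.
Qed.
Local Notation sz := nullsq_square_zero.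

Definition eAA (b : bool) : AA := if b then (1, 0) else (0, 1).
Lemma etaA_idem b : etaAm (idem k b) = eAA b.
Proof. by case: b; congr pair; rewrite /= ?scale1r ?scale0r. Qed.

(** The two idempotents distinguish the summands: each is central in AA, and passing across MM
    exchanges them. An element with the behaviour of the other summand is zero ([odd_AA],
    [even_MM]). *)
Lemma eAA_comm b (a : AA) : eAA b * a = a * eAA b.
Proof.
by case: b a => -[a1 a2]; congr pair; rewrite /= ?mul1r ?mulr1 ?mul0r ?mulr0.
Qed.
Lemma eAA_MM b (m : MM) : lact (eAA b) m = ract m (eAA (~~ b)).
Proof.
by case: b m => -[m1 m2]; congr pair;
  rewrite /= ?lact1 ?ract1 ?lact0l ?ract0r.
Qed.
Lemma odd_AA (a : AA) : (forall b, eAA b * a = a * eAA (~~ b)) -> a = 0.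
Proof.
case: a => a1 a2 H; have := H true; case; rewrite !mul1r !mul0r mulr0 mulr1.
by move=> -> <-.
Qed.
Lemma even_MM (m : MM) : (forall b, lact (eAA b) m = ract m (eAA b)) -> m = 0.
Proof.
case: m => m1 m2 H; have := H true; case; rewrite !lact1 !lact0l ract1 ract0r.
by move=> <- ->.
Qed.

Lemma big_addb_true n : \big[addb/false]_(i < n) true = odd n.
Proof. by elim: n => [|n IHn]; rewrite ?big_ord0 // big_ord_recl IHn. Qed.

Lemma tenshom_MM_AA0 n (t : tenshom MM (regbimod AA) n) : odd n -> t = 0.
Proof.
move=> on; apply: tenshom_ext => x; apply: odd_AA => b.
have := @tenshom_parity k AA MM eAA n _ t x (fun=> true) (fun i b => _) b.
rewrite big_addb_true on addbT; apply=> i b'; rewrite addbT.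
exact: eAA_MM.
Qed.
Lemma tenshom_MM_MM0 n (t : tenshom MM MM n) : ~~ odd n -> t = 0.
Proof.
move=> en; apply: tenshom_ext => x; apply: even_MM => b.
have := @tenshom_parity k AA MM eAA n _ t x (fun=> true) (fun i b => _) b.
rewrite big_addb_true (negPf en) addbF; apply=> i b'; rewrite addbT.
exact: eAA_MM.
Qed.
(** Arguments in AA commute with the idempotents, hence so does the value, which is impossible for a
    nonzero element of MM. The cochains themselves vanish, and not only their classes. *)
Lemma cochain_AA_MM0 n (c : relcochain etaAm MM n) : c = 0.
Proof.
apply: tenshom_ext => x; apply: even_MM => b.
have := @tenshom_parity k D (restr etaAm (regbimod AA)) (idem k) n _ c x
  (fun=> false) (fun i b => _) b.
rewrite big1 ?addbF // -etaA_idem; apply=> i b'; rewrite addbF.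
by rewrite -[LHS]/(etaAm _ * x i) -[RHS]/(x i * etaAm _) etaA_idem eAA_comm.
Qed.

(** With an even number of factors in MM the twists cancel, so the value commutes with the
    idempotents; having no component in AA, it is zero. This places the cochains with values in MM
    in the subcomplex D. *)
Lemma even_vanish_MM n (f : relcochain (etaL M N) (regbimod LL) n) :
  (forall x, prA (f x) = 0) -> even_vanish f.
Proof.
move=> fM s x xs es.
suff fx : prM (f x) = 0.
  rewrite [f x](sz_decomp sz) fx [prAm _]fM.
  by rewrite rmorph0 add0r (lin0 (sz_inM_lin sz)).
apply: even_MM => b.
have := @tenshom_parity k D (restr (etaL M N) (regbimod LL)) (idem k) n _ f x
  (fun i => i \in s) (fun i b => _) b.
rewrite -odd_card (negPf es) addbF => H.
have {}H : prM (etaL M N (idem k b) * (f x : LL))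
    = prM ((f x : LL) * etaL M N (idem k b)).
  congr prM; apply: H => i b'.
  rewrite -[LHS]/(etaL M N (idem k b') * x i) -[RHS]/(x i * etaL M N (idem k _)).
  rewrite !(sz_etaL sz) !etaA_idem; move: (xs i); case: (i \in s) => xi.
    rewrite [x i](sz_decomp sz) -[prAm (x i)]/(prA (x i)) xi rmorph0 add0r.
    by rewrite (sz_mulAM sz) (sz_mulMA sz) eAA_MM addbT.
  rewrite [x i](sz_decomp sz) xi (lin0 (sz_inM_lin sz)) addr0 addbF.
  by rewrite -!rmorphM eAA_comm.
move: H; rewrite !(prM_mul sz) !(sz_etaL sz) !(sz_prM_inA sz) !(sz_inAK sz).
by rewrite ract0l lact0r addr0 add0r etaA_idem.
Qed.
End NullSquareAlgebra.

(** * Ext classes as classes of relative cocycles *)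

Section ExtRealization.
Variables (k : fieldType) (R S : algType k) (eta : {lrmorphism R -> S}).
Variable P : resolution (regbimod S).
Variable phi : forall n, relcochain eta (P n) n.
Hypothesis phiP : bar_comparison phi.
Variables (Y : bimod S S) (n : nat).
Local Notation cocycles := (sub_of (ext_cocycle P Y n)).

Definition ext_map (u : cocycles) : bihom (P n) Y := val u.

Definition ext_cochain (u : cocycles) : relcochain eta Y n :=
  postS (bihomP (ext_map u)) (phi n).
Lemma ext_cochain_lin : linear ext_cochain.
Proof. by move=> a u v; apply: tenshom_ext. Qed.

Lemma ext_cocycleP (u : cocycles) z : ext_map u (res_d P n z) = 0.
Proof. exact: (elimT (asboolP _) (valP u)). Qed.

Lemma dlt_ext_cochain u : dlt (ext_cochain u) = 0.
Proof. exact: (dlt_pull phiP (bihomP (ext_map u)) (ext_cocycleP u)). Qed.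

(** One direction pulls a primitive back along phi; the converse is [pull_inj]. *)
Lemma ext_cobound_cob (u : cocycles) :
  is_ext_cobound (ext_map u) <-> cob (ext_cochain u).
Proof.
have pu := @pull_inj _ _ _ _ _ phi phiP n Y (ext_map u) (bihomP (ext_map u))
  (ext_cocycleP u).
rewrite /ext_cochain; move: (ext_map u) (bihomP (ext_map u)) pu => {}u uP pu.
case: n u uP pu => [|m] u uP pu; split.
- by move=> u0; apply: tenshom_ext => x; rewrite postSE u0.
- by move=> /pu u0; apply: val_inj; apply/funext => x; exact: u0.
- move=> [v vE]; exists (postS (bihomP v) (phi m)).
  rewrite dlt_postS (dlt_phi phiP); apply: tenshom_ext => x.
  by rewrite !postSE vE.
- by move=> /pu[v vP vE]; exists (mk_bihom vP).
Qed.

Definition ext_rep (U : Ext P Y n) (f : relcochain eta Y n) : Prop :=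
  exists2 u : cocycles, ext_cls u = U & cob (f - ext_cochain u).

Lemma ext_cls0 (u : cocycles) : ext_cls u = 0 <-> cob (ext_cochain u).
Proof.
have cls0 : ext_cls (0 : cocycles) = 0 := lin0 (@cls_linear _ _ _ _).
by rewrite -ext_cobound_cob -cls0 /ext_cls clsP [val 0]raddf0 subr0.
Qed.

Lemma ext_realizes : realizes ext_rep.
Proof.
split.
- move=> a U V f g [u <- fu] [v <- gv]; exists (a *: u + v).
    exact: cls_linear.
  rewrite ext_cochain_lin opprD addrACA -scalerBr.
  exact: cobDZ.
- move=> U; have [u uE] := cls_surj U; exists (ext_cochain u); exists u => //.
  by rewrite subrr; exact: cob0.
- move=> U f [u _ /cob_dlt/eqP].
  by rewrite (linB (@dlt_lin _ _ _ _ _ _)) dlt_ext_cochain subr0 => /eqP.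
- move=> f /(pull_surj phiP)[u [uP [u0 fu]]].
  have uC : ext_cocycle P Y n (mk_bihom uP) by exact: u0.
  pose u' : cocycles := SubOf (in_subspaceT (S := ext_cocycle P Y n) uC).
  exists (ext_cls u'), u' => //.
  rewrite (_ : ext_cochain u' = pull phi uP) //.
  exact: tenshom_ext.
- move=> U f [u <- fu]; rewrite ext_cls0; split=> H.
    by rewrite -[f](subrK (ext_cochain u)); exact: cobD.
  by rewrite -[ext_cochain u](subKr f); exact: cobB.
Qed.
End ExtRealization.

(** * Cohomology of the null-square algebra with values in AA and MM *)

Section MainTheorem.
Variables (k : fieldType) (A B : algType k) (M : bimod B A) (N : bimod A B).
Hypotheses (M_proj : projective M) (N_proj : projective N).
Local Notation AA := (A * B)%type.
Local Notation MM := (sumbimod M N).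
Local Notation LL := (nullsq M N).
Local Notation D := (k^o * k^o)%type.
Local Notation sz := (nullsq_square_zero M N).
Local Notation prAm := (prAm M N).
Local Notation CL X n := (relcochain (etaL M N) (restr prAm X) n).
Local Notation CA X n := (relcochain (etaAm A B) X n).

Lemma nullsq_normal_form n (X : bimod AA AA) (f : CL X n) : (0 < n)%N ->
  dlt f = 0 -> exists (c : CA X n) (t : tenshom MM X n),
    dlt c = 0 /\ cob (f - (infl sz c + ext sz t)).
Proof.
case: n f => // n f _ f0.
have [sM sMP] := projective_splitting M_proj.
have [sN sNP] := projective_splitting N_proj.
exact: (normal_form sz (sum_splitting sMP sNP)).
Qed.

Lemma nullsq_unique n (X : bimod AA AA) (c : CA X n) (t : tenshom MM X n) :
  (0 < n)%N -> cob (infl sz c + ext sz t) -> cob c /\ t = 0.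
Proof. by case: n c t => // n c t _; exact: normal_form_unique. Qed.

Lemma cob_infl n (X : bimod AA AA) (c : CA X n) : cob c -> cob (infl sz c).
Proof.
case: n c => [|n] c; first by move=> ->; rewrite (lin0 (infl_lin sz (n := 0))).
by move=> [h ->]; exists (infl sz h); rewrite dlt_infl.
Qed.

Lemma infl_cob n (X : bimod AA AA) (c : CA X n) : cob (infl sz c) -> cob c.
Proof.
case: n c => [|n] c; rewrite -{2}[c](resA_infl sz).
  by move=> ->; rewrite (lin0 (resA_lin sz (n := 0))).
by move=> [h ->]; exists (resA sz h); rewrite dlt_resA.
Qed.

(** In positive even degree parity kills both parts of the normal form. In degree 0 the cochain is
    an element of MM commuting with D, hence zero. *)
Lemma nullsq_MM_vanishing n (f : CL MM n) : ~~ odd n -> dlt f = 0 -> cob f.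
Proof.
case: n f => [|n] f en f0.
  apply: tenshom_ext => x; rewrite -[x](ituple0 (fun i => inAm M N (@inil _ AA i))).
  by rewrite -(resAE sz) (cochain_AA_MM0 (resA sz f)).
have [c [t [_]]] := nullsq_normal_form (ltn0Sn n) f0.
rewrite (cochain_AA_MM0 c) (tenshom_MM_MM0 t en).
by rewrite (lin0 (infl_lin sz (n := n.+1))) (lin0 (ext_lin sz (n := n.+1))) addr0 subr0.
Qed.

Section BaseRealizations.
Variables (n : nat) (V : lmodType k) (rep : V -> CA (regbimod AA) n -> Prop).
Hypothesis repP : realizes rep.

Definition rep_infl (v : V) (f : CL (regbimod AA) n) : Prop :=
  exists2 c, rep v c & cob (f - infl sz c).

(** In odd degree parity removes the multilinear part of the normal form. In degree 0 there are no
    arguments, so a cochain is already the inflation of its restriction. *)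
Lemma rep_infl_realizes : (n == 0%N) || odd n -> realizes rep_infl.
Proof.
move=> n_odd; split.
- move=> a v v' f f' [c vc fc] [c' vc' fc']; exists (a *: c + c').
    exact: (rep_lin repP).
  by rewrite infl_lin opprD addrACA -scalerBr; exact: cobDZ.
- move=> v; have [c vc] := rep_tot repP v; exists (infl sz c); exists c => //.
  by rewrite subrr; exact: cob0.
- move=> v f [c vc /cob_dlt/eqP].
  rewrite (linB (@dlt_lin _ _ _ _ _ _)) dlt_infl (rep_coc repP vc).
  by rewrite (lin0 (infl_lin sz (n := n.+1))) subr0 => /eqP.
- move=> f f0; suff [c c0 fc] : exists2 c, dlt c = 0 & cob (f - infl sz c).
    by have [v vc] := rep_surj repP c0; exists v, c.
  move: n_odd; case: posnP => [n0 _|n_gt0 /= n_odd].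
    exists (resA sz f); first by rewrite dlt_resA f0 (lin0 (resA_lin sz (n := n.+1))).
    rewrite (_ : infl sz (resA sz f) = f) ?subrr; first exact: cob0.
    apply: tenshom_ext => x; rewrite inflE resAE; congr (f _); apply/funext => i.
    by have := ltn_ord i; rewrite {2}n0.
  have [c [t [c0 fc]]] := nullsq_normal_form n_gt0 f0; exists c => //.
  by move: fc; rewrite (tenshom_MM_AA0 t n_odd) (lin0 (ext_lin sz (n := n))) addr0.
- move=> v f [c vc fc]; rewrite (rep_zero repP vc); split=> H.
    by rewrite -[f](subrK (infl sz c)); apply: cobD => //; exact: cob_infl.
  have {}H : cob (infl sz c) by rewrite -[infl sz c](subKr f); exact: cobB.
  exact: infl_cob.
Qed.

Definition rep_pair (v : (V * tenshom MM (regbimod AA) n)%type)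
    (f : CL (regbimod AA) n) : Prop :=
  exists2 c, rep v.1 c & cob (f - (infl sz c + ext sz v.2)).

(** The degree must be positive: in degree 0, [infl] and [ext] both describe the central elements of
    AA, which would be counted twice. Hence the separate sequence for m = 0. *)
Lemma rep_pair_realizes : (0 < n)%N -> realizes rep_pair.
Proof.
move=> n_gt0; split.
- move=> a v v' f f' [c vc fc] [c' vc' fc']; exists (a *: c + c').
    exact: (rep_lin repP).
  rewrite infl_lin [ext sz _](ext_lin sz a v.2 v'.2) addrACA -scalerDr.
  by rewrite opprD addrACA -scalerBr; exact: cobDZ.
- move=> v; have [c vc] := rep_tot repP v.1.
  exists (infl sz c + ext sz v.2); exists c => //.
  by rewrite subrr; exact: cob0.
- move=> v f [c vc /cob_dlt/eqP].
  rewrite (linB (@dlt_lin _ _ _ _ _ _)) (linD (@dlt_lin _ _ _ _ _ _)) dlt_infl.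
  rewrite (rep_coc repP vc) dlt_ext.
  by rewrite (lin0 (infl_lin sz (n := n.+1))) addr0 subr0 => /eqP.
- move=> f /(nullsq_normal_form n_gt0)[c [t [c0 fc]]].
  by have [v vc] := rep_surj repP c0; exists (v, t), c.
- move=> [v t] f [c /= vc fc]; split=> H.
    have v0 : v = 0 := congr1 fst H.
    have t0 : t = 0 := congr1 snd H.
    rewrite -[f](subrK (infl sz c + ext sz t)); apply: cobD => //.
    rewrite t0 (lin0 (ext_lin sz (n := n))) addr0; apply: cob_infl.
    exact/(rep_zero repP vc).
  have /(nullsq_unique n_gt0)[/(rep_zero repP vc) -> ->] // : cob (infl sz c + ext sz t).
  by rewrite -[_ + _](subKr f); exact: cobB.
Qed.
End BaseRealizations.

Definition rep_MM n (t : tenshom MM MM n) (f : CL MM n) : Prop := cob (f - ext sz t).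

Lemma rep_MM_realizes n : odd n -> realizes (@rep_MM n).
Proof.
move=> n_odd; have n_gt0 : (0 < n)%N by case: n n_odd.
split.
- move=> a t t' f f' tf tf'; rewrite /rep_MM ext_lin opprD addrACA -scalerBr.
  exact: cobDZ.
- by move=> t; exists (ext sz t); rewrite /rep_MM subrr; exact: cob0.
- move=> t f /cob_dlt/eqP.
  by rewrite (linB (@dlt_lin _ _ _ _ _ _)) dlt_ext subr0 => /eqP.
- move=> f /(nullsq_normal_form n_gt0)[c [t [_]]]; rewrite (cochain_AA_MM0 c).
  by rewrite (lin0 (infl_lin sz (n := n))) add0r; exists t.
- move=> t f tf; split=> H.
    by move: tf; rewrite /rep_MM H (lin0 (ext_lin sz (n := n))) subr0.
  apply: (proj2 (nullsq_unique (c := 0) n_gt0 _)).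
  rewrite (lin0 (infl_lin sz (n := n))) add0r -[ext sz t](subKr f).
  exact: cobB.
Qed.
End MainTheorem.

Section BihomTenshom.
Variables (k : fieldType) (S : algType k) (X Y : bimod S S).

Lemma bihom_tenshom_subproof (g : bihom X Y) :
  is_tenshom (fun x : 'I_1 -> X => g (x ord0)).
Proof.
have [g1 g2 g3] := bihomP g.
split=> [x i a u v|x i j s|x i s _|x i s _|//]; rewrite ?(ord1 i) ?(ord1 j) //.
- by rewrite /upd eqxx g1.
- by rewrite /upd eqxx g2.
- by rewrite /upd eqxx g3.
Qed.
Definition bihom_tenshom (g : bihom X Y) : tenshom X Y 1 :=
  mk_tenshom (bihom_tenshom_subproof g).
Lemma bihom_tenshom_lin : linear bihom_tenshom.
Proof. by move=> a g h; apply: tenshom_ext. Qed.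

Lemma bihom_tenshom_inj (g : bihom X Y) : bihom_tenshom g = 0 -> g = 0.
Proof.
move=> g0; apply: val_inj; apply/funext => x.
exact: (congr1 (fun t : tenshom X Y 1 => t (fun=> x)) g0).
Qed.

Lemma bihom_tenshom_surj (t : tenshom X Y 1) : exists g, bihom_tenshom g = t.
Proof.
have [t1 t2 t3 t4 _] := tenshomP t.
have uE (x : 'I_1 -> X) u : upd x ord0 u = (fun=> u).
  by apply/funext => i; rewrite /upd (ord1 i).
have gP : is_bihom (fun x : X => t (fun=> x)).
  split=> [a u v|s x|x s].
  - by have := t1 (fun=> 0) ord0 a u v; rewrite !uE.
  - by have := t3 (fun=> x) ord0 s; rewrite uE; apply.
  - by have := t4 (fun=> x) ord0 s; rewrite uE; apply.
exists (mk_bihom gP); apply: tenshom_ext => x.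
by congr (t _); apply/funext => i; rewrite (ord1 i).
Qed.
End BihomTenshom.

Lemma realizes_transport (k : fieldType) (R S : algType k)
    (eta : {lrmorphism R -> S}) (Y : bimod S S) n (V W : lmodType k)
    (rep : V -> relcochain eta Y n -> Prop) (g : W -> V) :
  linear g -> (forall w, g w = 0 -> w = 0) -> (forall v, exists w, g w = v) ->
  realizes rep -> realizes (fun w => rep (g w)).
Proof.
move=> g_lin g_inj g_surj repP; split.
- by move=> a v v' f f' vf vf'; rewrite g_lin; exact: (rep_lin repP).
- by move=> v; exact: (rep_tot repP).
- by move=> v f; exact: (rep_coc repP).
- by move=> f /(rep_surj repP)[v vf]; have [w wv] := g_surj v; exists w; rewrite wv.
- move=> w f wf; rewrite -(rep_zero repP wf); split=> [->|]; first exact: lin0.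
  exact: g_inj.
Qed.

Theorem proposition7p2 (k : fieldType) (A B : algType k)
    (M : bimod B A) (N : bimod A B)
    (M_neq0 : exists x : M, x != 0) (N_neq0 : exists y : N, y != 0)
    (M_proj : projective M) (N_proj : projective N)
    (P : resolution (regbimod (nullsq M N)))
    (Q : resolution (regbimod (A * B)%type)) :
  (forall m : nat, (0 < m)%N ->
     exists nabla : {linear (HH Q (2 * m)%N
                       * tenshom (sumbimod M N) (regbimod (A * B)%type) (2 * m)%N)%type
                     -> tenshom (sumbimod M N) (sumbimod M N) (2 * m).+1%N},
       is_nabla nabla /\
       exists (f1 : {linear HH P (2 * m)%N -> (HH Q (2 * m)%N
                       * tenshom (sumbimod M N) (regbimod (A * B)%type) (2 * m)%N)%type})
              (f3 : {linear tenshom (sumbimod M N) (sumbimod M N) (2 * m).+1%N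
                     -> HH P (2 * m).+1%N})
              (f4 : {linear HH P (2 * m).+1%N -> HH Q (2 * m).+1%N}),
         five_term_exact f1 nabla f3 f4)
  /\ (exists nabla0 : {linear HH Q 0 -> bihom (sumbimod M N) (sumbimod M N)},
        is_nabla0 nabla0 /\
        exists (f1 : {linear HH P 0 -> HH Q 0})
               (f3 : {linear bihom (sumbimod M N) (sumbimod M N) -> HH P 1})
               (f4 : {linear HH P 1 -> HH Q 1}),
          five_term_exact f1 nabla0 f3 f4).
Proof.
have [phiP phiPP] := exists_bar_comparison (etaL M N) P.
have [phiQ phiQP] := exists_bar_comparison (etaAm A B) Q.
pose sz := nullsq_square_zero M N.
have iP := sz_inM_bihom sz; have pP := sz_prA_bihom (prAm M N).
have qP := sz_prM_bihom sz; have rP := sz_inA_bihom sz.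
have LES n V1 V2 V3 V4 V5 := @long_exact_sequence k _ _ (etaL M N) _ _ _ _ _ _ _
  iP pP qP rP (sz_inMK sz) (sz_prA_inM sz) (sz_inAK sz) (sz_decomp sz) n
  V1 V2 V3 V4 V5.
have repL n := ext_realizes phiPP (regbimod (nullsq M N)) n.
have repA n := ext_realizes phiQP (regbimod (A * B)%type) n.
have van n := @nullsq_MM_vanishing k A B M N M_proj N_proj n.
(* The cochain t of [connecting] is y seen in L through [inA], so its difference with y0 is zero.
   Its coboundary has values in MM and differs from the extension of z by a coboundary of cochains
   with values in MM, which lie in D by parity. *)
have conn n (y : relcochain (etaL M N) (restr (prAm M N) (regbimod (A * B)%type)) n)
    (z : tenshom (sumbimod M N) (sumbimod M N) n.+1) y0 :
    (forall x, inA M N (y x) = y0 x) ->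
    (forall w, dlt (post rP y) = postS iP w -> rep_MM z w) -> dlt y = 0 ->
    connecting y0 (extMM z).
  move=> yE zw dy0.
  have [w [E _]] := connecting_lift iP pP qP rP (sz_inMK sz) (sz_inAK sz)
    (sz_decomp sz) dy0.
  have [h hE] := zw w E.
  exists (post rP y), (postS iP h); split.
  - by move=> s x _ _; rewrite -yE subrr.
  - exact: even_vanish_MM.
  - move=> x; rewrite -[LHS]/(dlt (post rP y) x) E.
    rewrite -[hcobound _ _]/(dlt (postS iP h) x) dlt_postS -hE.
    rewrite (linB (@postS_lin _ _ _ _ _ _ _ _ iP)).
    rewrite -[RHS]/(postS iP (ext sz z) x + (postS iP w x - postS iP (ext sz z) x)).
    by rewrite addrC subrK.
split=> [m m_gt0|].
- have n_gt0 : (0 < 2 * m)%N by rewrite muln_gt0.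
  have n_even : ~~ odd (2 * m) by rewrite mul2n odd_double.
  (* [n_even] is also the oddness of 2m + 1, by conversion. The two open goals are the vanishing of
     the cohomology with values in MM in degrees 2m and 2m + 2. *)
  have [||f1 [nabla [f3 [f4 [ex nablaP]]]]] := LES (2 * m)%N _ _ _ _ _ _ _ _ _ _
    (repL _) (rep_pair_realizes M_proj N_proj (repA _) n_gt0)
    (rep_MM_realizes M_proj N_proj (n := (2 * m).+1) n_even) (repL _)
    (rep_infl_realizes M_proj N_proj (repA (2 * m).+1) n_even).
  + by move=> w; exact: van.
  + by move=> w; apply: van; rewrite /= negbK.
  exists nabla; split; last by exists f1, f3, f4.
  exists phiQ => // u f; apply: (conn _ (infl sz (ext_cochain phiQ u) + ext sz f)).
  + move=> x; rewrite -[LHS]/(inAm M N (infl sz (ext_cochain phiQ u) x + ext sz f x)).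
    by rewrite linearD.
  + move=> w; apply: nablaP; rewrite (lift_cochain pP rP (sz_inAK sz)).
    exists (ext_cochain phiQ u); first by exists u => //; rewrite subrr; exact: cob0.
    by rewrite subrr; exact: cob0.
  + rewrite (linD (@dlt_lin _ _ _ _ _ _)) dlt_infl dlt_ext dlt_ext_cochain //.
    by rewrite (lin0 (infl_lin sz (n := _))) addr0.
(* For m = 0 the third term is the space of endomorphisms of MM, which replaces the balanced maps of
   one argument. *)
have repE : realizes (fun (g : bihom (sumbimod M N) (sumbimod M N)) =>
    @rep_MM k A B M N 1 (bihom_tenshom g)).
  apply: realizes_transport (rep_MM_realizes M_proj N_proj (n := 1) isT).
  - exact: bihom_tenshom_lin.
  - exact: bihom_tenshom_inj.
  - exact: bihom_tenshom_surj.
have [||f1 [nabla [f3 [f4 [ex nablaP]]]]] := LES 0%N _ _ _ _ _ _ _ _ _ _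
  (repL _) (rep_infl_realizes M_proj N_proj (repA 0%N) isT) repE (repL _)
  (rep_infl_realizes M_proj N_proj (repA 1%N) isT).
- by move=> w; exact: van.
- by move=> w; exact: van.
exists nabla; split; last by exists f1, f3, f4.
exists phiQ => // u.
apply: (conn _ (infl sz (ext_cochain phiQ u)) (bihom_tenshom (nabla (ext_cls u)))).
- by [].
- move=> w; apply: nablaP; rewrite (lift_cochain pP rP (sz_inAK sz)).
  exists (ext_cochain phiQ u); first by exists u => //; rewrite subrr; exact: cob0.
  by rewrite subrr; exact: cob0.
- by rewrite dlt_infl dlt_ext_cochain // (lin0 (infl_lin sz (n := _))).
Qed.
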